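(* Let $(A,V,i,p,K)$ be a homotopy retract in which $A$ is a commutative differential graded algebra and $V$ is of finite type. Let $\mathcal L(V^\sharp)=\widehat{\mathbb L}(s^{-1}V^\sharp)$ be the free complete differential graded Lie algebra (cDGL) determined by the $C_\infty$-coalgebra structure on $V^\sharp$ dual to the $C_\infty$-algebra structure transferred to $V$ and, for a cDGL $L$, equip $V\otimes L=V\widehat\otimes L$ with the $L_\infty$-algebra structure transferred from the DGL $A\widehat\otimes L$. Then, for any cDGL $L$, there is a bijection $$\mathrm{MC}(V\otimes L)\;\cong\;\mathrm{Hom}_{\mathrm{cDGL}}(\mathcal L(V^\sharp),L).$$
   Context: The ground field has characteristic $0$ and graded objects are $\mathbb Z$-graded; $^\sharp$ denotes the dual. $\mathrm{Hom}$ denotes linear maps and $\mathrm{Hom}_{\mathrm{cDGL}}$ denotes the set of morphisms of cDGLs. A DGL $L$ (differential graded Lie algebra) is complete (a cDGL) if $L=\varprojlim_n L/L^n$, where $L^1=L$ and $L^n=[L,L^{n-1}]$ for $n\ge2$. $\widehat{\mathbb L}(W)=\varprojlim_n\mathbb L(W)/\mathbb L^{>n}(W)$, where $\mathbb L(W)\subset T(W)$ is the free Lie algebra generated by commutators on $W$. A homotopy retract $(M,V,i,p,K)$ consists of chain maps $i\colon V\to M$, $p\colon M\to V$ with $pi=\mathrm{id}_V$ and $ip\simeq\mathrm{id}_M$ through the chain homotopy $K$. For a graded vector space $B$, $B\widehat\otimes L=\varprojlim_n(B\otimes L/L^n)$; for $B=A$ it has the naturally inherited DGL structure. **Identifications.**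 Under the assumption that $V$ is of finite type one has natural isomorphisms $V\widehat\otimes L\cong V\otimes L$, $\Psi\colon V\otimes L\cong\mathrm{Hom}(V^\sharp,L)$ with $\Psi(a\otimes x)(\alpha)=(-1)^{|a||x|}\langle a,\alpha\rangle x$, and $(V^{\otimes k})^\sharp\cong(V^\sharp)^{\otimes k}$. **The cDGL $\mathcal L(V^\sharp)$.** Let $m$ be the multiplication of $A$. For each planar rooted binary tree $T$ with $k\ge2$ leaves, let $m_T\colon V^{\otimes k}\to V$ be the composition, moving down from the leaves to the root, obtained by labelling each leaf by $i$, each internal vertex by $m$, each internal edge by $K$ and the root by $p$. The transferred $C_\infty$-algebra structure on $V$ is $\{m_k\}_{k\ge1}$, where $m_1$ is the differential of $V$ and $m_k=\sum_Tm_T$ for $k\ge2$, the sum being over isomorphism classes of planar rooted binary trees with $k$ leaves. The dual maps $\Delta_k=m_k^\sharp\colon V^\sharp\to(V^{\otimes k})^\sharp\cong(V^\sharp)^{\otimes k}$ define a $C_\infty$-coalgebra structure on $V^\sharp$. With $s^{-1}$ the desuspension, $(s^{-1}W)_q=W_{q+1}$, the differential $d=\sum_{k\ge1}d_k$ of $\mathcal L(V^\sharp)=\widehat{\mathbb L}(s^{-1}V^\sharp)$ is determined on generators by $d_k=-(-1)^{k(k-1)/2}(s^{-1})^{\otimes k}\circ\Delta_k\circ s$, which takes values in Lie polynomials. **The $L_\infty$-algebra $V\otimes L$.** The structure $\{\ell_k\}_{k\ge1}$ is transferred along the homotopy retract $(A\widehat\otimes L,V\widehat\otimes L,i\widehat\otimes\mathrm{id}_L,p\widehat\otimes\mathrm{id}_L,K\widehat\otimes\mathrm{id}_L)$: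 $\ell_1$ is the differential and, for $k\ge2$, $\ell_k=\sum_T\frac{1}{|\mathrm{Aut}\,T|}\,\widetilde\ell_T\circ\mathcal S_k$, summed over isomorphism classes of non-planar rooted binary trees with $k$ leaves. Here, for a chosen planar embedding of $T$, $\widetilde\ell_T$ is the composition from the leaves to the root obtained by labelling leaves by $i\widehat\otimes\mathrm{id}_L$, internal vertices by the bracket of $A\widehat\otimes L$, internal edges by $K\widehat\otimes\mathrm{id}_L$ and the root by $p\widehat\otimes\mathrm{id}_L$; $\mathcal S_k(a_1\otimes\dots\otimes a_k)=\sum_{\sigma\in S_k}\varepsilon_\sigma\varepsilon\,a_{\sigma(1)}\otimes\dots\otimes a_{\sigma(k)}$, with $\varepsilon_\sigma$ the signature and $\varepsilon$ the Koszul sign; $\mathrm{Aut}\,T$ is the automorphism group of $T$. For an $L_\infty$-algebra $E$, $\mathrm{MC}(E)=\{x\in E_{-1}:\sum_{k\ge1}\frac1{k!}\ell_k(x,\dots,x)=0\}$. The bijection is provided by restricting a morphism to its generators, $\mathrm{Hom}_{\mathrm{cDGL}}(\mathcal L(V^\sharp),L)\to\mathrm{Hom}_{-1}(V^\sharp,L)\cong(V\otimes L)_{-1}$.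
   Formalization: ''Finite type'' means finite-dimensional in each degree and bounded; without boundedness V⊗L → Hom(V^♯,L) is not onto and the claim fails. Tree compositions carry the standard suspension signs, and restriction to generators is taken with sign −1. *)

(* Defs.v *)
From HB Require Import structures.
From mathcomp Require Import all_boot all_order all_algebra perm.
From mathcomp Require Import all_classical.

Set Implicit Arguments.
Unset Strict Implicit.
Unset Printing Implicit Defensive.

Import GRing.Theory.
Local Open Scope ring_scope.
Local Open Scope classical_set_scope.
Local Open Scope quotient_scope.

(* A Z-graded vector space is its total space [gcar], the direct sum of the
   homogeneous parts, together with the projections [gpr n] onto the parts. *)
Record gmod (F : fieldType) := GMod {
  gcar :> lmodType F;
  gpr : int -> gcar -> gcar;
  gpr_linear : forall n, linear (gpr n);
  gprK : forall m n x, gpr m (gpr n x) = if m == n then gpr n x else 0;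
  gpr_gen : forall x, exists s : seq (int * gcar),
    x = \sum_(p <- s) gpr p.1 p.2 }.

Section GradedModules.
Variable F : fieldType.

HB.instance Definition _ (M : gmod F) (n : int) :=
  GRing.isLinear.Build F M M _ (@gpr F M n) (gpr_linear n).

Definition has_degree (M N : gmod F) (k : int) (f : M -> N) :=
  forall n x, f (gpr n x) = gpr (n + k) (f x).

Definition par (M : gmod F) (x : M) : M :=
  \sum_(n \in [set: int]) (-1) ^ n *: gpr n x.

(* [kos f x y] is (-1)^{|x||y|} f x y, extended to inhomogeneous x and y. *)
Definition kos (M N : gmod F) (U : lmodType F) (f : M -> N -> U)
    (x : M) (y : N) : U :=
  \sum_(m \in [set: int]) \sum_(n \in [set: int])
    (-1) ^ (m * n) *: f (gpr m x) (gpr n y).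

Lemma gpr_supp (M : gmod F) (x : M) :
  exists s : seq int, forall n, n \notin s -> gpr n x = 0.
Proof.
have [s ->] := gpr_gen x; exists (map fst s) => n ns.
rewrite linear_sum big_seq big1 // => p ps /=.
rewrite gprK; case: eqP => // np; case/negP: ns.
by apply/mapP; exists p.
Qed.

Lemma fsum_seq (U : nmodType) (s : seq int) (f : int -> U) :
  (forall n, n \notin s -> f n = 0) ->
  \sum_(n \in [set: int]) f n = \sum_(n <- undup s) f n.
Proof.
move=> fs; rewrite [RHS]fsbig_seq ?undup_uniq //.
apply/esym/fsbig_widen => // n [_ /=]; rewrite mem_undup => /negP.
exact: fs.
Qed.

Lemma gpr_sumE (M : gmod F) (x : M) (s : seq int) :
  (forall n, n \notin s -> gpr n x = 0) ->
  x = \sum_(n <- undup s) gpr n x.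
Proof.
move=> xs; have [t xt] := gpr_gen x.
have gprx n : gpr n x = \sum_(p <- t | p.1 == n) gpr p.1 p.2.
  rewrite {1}xt linear_sum [RHS]big_mkcond /=; apply: eq_bigr => p _.
  by rewrite gprK eq_sym; case: eqP => // ->.
have xE : x = \sum_(n <- undup (s ++ map fst t)) gpr n x.
  under eq_bigr do rewrite gprx.
  rewrite (exchange_big_dep xpredT) //= {1}xt big_seq [RHS]big_seq.
  apply: eq_bigr => p pt; rewrite -big_filter.
  rewrite (_ : [seq i <- _ | _] = [:: p.1]) ?big_seq1 //.
  rewrite -(@filter_pred1_uniq _ (undup (s ++ map fst t))) ?undup_uniq //.
    by apply: eq_filter => i /=; rewrite eq_sym.
  by rewrite mem_undup mem_cat map_f ?orbT.
rewrite {1}xE (bigID [in s]) /= [X in _ + X]big1 => [|i /xs //]; rewrite addr0.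
rewrite -big_filter; apply: perm_big; apply: uniq_perm.
- by rewrite filter_uniq ?undup_uniq.
- exact: undup_uniq.
move=> n; rewrite mem_filter !mem_undup mem_cat.
by case: (n \in s).
Qed.

End GradedModules.

Lemma linD (F : fieldType) (M N : lmodType F) (f : M -> N) x y :
  linear f -> f (x + y) = f x + f y.
Proof. by move=> lf; rewrite -[x]scale1r lf !scale1r. Qed.

Lemma linZ (F : fieldType) (M N : lmodType F) (f : M -> N) c x :
  linear f -> f (c *: x) = c *: f x.
Proof.
move=> lf; have f0 : f 0 = 0.
  by apply: (@addrI _ (f 0)); rewrite -(linD 0 0 lf) !addr0.
by rewrite -[c *: x]addr0 lf f0 addr0.
Qed.

Definition bilin (F : fieldType) (B M U : lmodType F) (f : B -> M -> U) :=
  (forall b, linear (f b)) /\ (forall m, linear (f ^~ m)).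

(* B (x) M: finite formal sums of pairs, two of them being identified when
   every bilinear map takes the same value on them. *)
Section Tensor.
Variables (F : fieldType) (B M : lmodType F).
Implicit Types (s t u : seq (B * M)).

Definition tequiv s t := `[< forall (U : lmodType F) (f : B -> M -> U),
  bilin f -> \sum_(p <- s) f p.1 p.2 = \sum_(p <- t) f p.1 p.2 >].

Lemma tequiv_equiv : equiv_class_of tequiv.
Proof.
split=> [s|s t|t s u].
- exact/asboolP.
- by apply/asbool_equiv_eq; split=> st U f fb; rewrite st.
- by move=> /asboolP st /asboolP tu; apply/asboolP => U f fb; rewrite st ?tu.
Qed.

Canonical tequiv_equivRel := EquivRelPack tequiv_equiv.

Definition tens := {eq_quot tequiv}.
HB.instance Definition _ := Choice.on tens.
HB.instance Definition _ := EqQuotient.on tens.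

Lemma tensW (P : tens -> Prop) : (forall s, P (\pi_tens s)) -> forall x, P x.
Proof. by move=> Ps x; rewrite -[x]reprK; exact: Ps. Qed.

Definition tlift (U : lmodType F) (f : B -> M -> U) (t : tens) : U :=
  \sum_(p <- repr t) f p.1 p.2.

Lemma tliftE (U : lmodType F) (f : B -> M -> U) s :
  bilin f -> tlift f (\pi_tens s) = \sum_(p <- s) f p.1 p.2.
Proof.
move=> fb; have /eqmodP/asboolP : repr (\pi_tens s) = s %[mod tens] by rewrite reprK.
by move=> /(_ U f fb).
Qed.

Lemma tens_eq s t :
  (forall (U : lmodType F) (f : B -> M -> U), bilin f ->
    \sum_(p <- s) f p.1 p.2 = \sum_(p <- t) f p.1 p.2) ->
  \pi_tens s = \pi_tens t.
Proof. by move=> st; apply/eqmodP/asboolP. Qed.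

Definition tzero : tens := \pi_tens [::].
Definition tadd (t u : tens) : tens := \pi_tens (repr t ++ repr u).
Definition tscale (c : F) (t : tens) : tens :=
  \pi_tens [seq (c *: p.1, p.2) | p <- repr t].
Definition topp (t : tens) : tens := tscale (-1) t.

Lemma bilinZ (U : lmodType F) (f : B -> M -> U) c s : bilin f ->
  \sum_(p <- [seq (c *: p.1, p.2) | p <- s]) f p.1 p.2 =
  c *: \sum_(p <- s) f p.1 p.2.
Proof.
move=> [_ fl]; rewrite big_map scaler_sumr; apply: eq_bigr => p _ /=.
exact: linZ (fl p.2).
Qed.

Lemma tadd_pi s t : tadd (\pi_tens s) (\pi_tens t) = \pi_tens (s ++ t).
Proof.
apply: tens_eq => U f fb; rewrite !big_cat.
by congr (_ + _); exact: tliftE.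
Qed.

Lemma tscale_pi c s :
  tscale c (\pi_tens s) = \pi_tens [seq (c *: p.1, p.2) | p <- s].
Proof.
apply: tens_eq => U f fb; rewrite !bilinZ //.
by congr (_ *: _); exact: tliftE.
Qed.

Lemma taddA : associative tadd.
Proof.
by elim/tensW=> s; elim/tensW=> t; elim/tensW=> u; rewrite !tadd_pi catA.
Qed.

Lemma taddC : commutative tadd.
Proof.
elim/tensW=> s; elim/tensW=> t; rewrite !tadd_pi; apply: tens_eq => U f fb.
by rewrite !big_cat /= addrC.
Qed.

Lemma tadd0 : left_id tzero tadd.
Proof. by elim/tensW=> s; rewrite tadd_pi. Qed.

Lemma taddN : left_inverse tzero topp tadd.
Proof.
elim/tensW=> s; rewrite /topp tscale_pi tadd_pi; apply: tens_eq => U f fb.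
by rewrite big_cat /= bilinZ // scaleN1r addNr big_nil.
Qed.

HB.instance Definition _ := GRing.isZmodule.Build tens taddA taddC tadd0 taddN.

Lemma tscaleA a b x : tscale a (tscale b x) = tscale (a * b) x.
Proof.
elim/tensW: x => s; rewrite !tscale_pi; apply: tens_eq => U f fb.
by rewrite !bilinZ // scalerA.
Qed.

Lemma tscale1 : left_id 1 tscale.
Proof.
elim/tensW=> s; rewrite !tscale_pi; apply: tens_eq => U f fb.
by rewrite !bilinZ // scale1r.
Qed.

Lemma tscaleDr : right_distributive tscale +%R.
Proof.
move=> c; elim/tensW=> s; elim/tensW=> t; rewrite [_ + _]tadd_pi !tscale_pi.
by rewrite [RHS]tadd_pi map_cat.
Qed.

Lemma tscaleDl x : {morph tscale^~ x : a b / a + b}.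
Proof.
elim/tensW: x => s a b; rewrite !tscale_pi [RHS]tadd_pi.
by apply: tens_eq => U f fb; rewrite big_cat /= !bilinZ // scalerDl.
Qed.

HB.instance Definition _ := GRing.Zmodule_isLmodule.Build F tens
  tscaleA tscale1 tscaleDr tscaleDl.

Definition tpure (b : B) (m : M) : tens := \pi_tens [:: (b, m)].

Lemma tpure_bilin : bilin tpure.
Proof.
split=> x c y z;
  rewrite -[RHS]/(tadd (tscale c (\pi_tens _)) (\pi_tens _)) tscale_pi tadd_pi;
  apply: tens_eq => U f [fr fl]; rewrite /= !big_cons !big_nil /= !addr0.
  by rewrite fr (linZ _ _ (fl y)).
by rewrite [LHS](fl x) (linZ _ _ (fl x)).
Qed.

Lemma tlift_linear (U : lmodType F) (f : B -> M -> U) :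
  bilin f -> linear (tlift f).
Proof.
move=> fb c; elim/tensW=> s; elim/tensW=> t.
rewrite -[_ *: _ + _]/(tadd (tscale c (\pi_tens s)) (\pi_tens t)).
rewrite tscale_pi tadd_pi !tliftE // big_cat /= bilinZ //.
Qed.

Lemma tlift_pure (U : lmodType F) (f : B -> M -> U) b m :
  bilin f -> tlift f (tpure b m) = f b m.
Proof. by move=> fb; rewrite tliftE // big_seq1. Qed.

Lemma tens_gen (t : tens) : t = \sum_(p <- repr t) tpure p.1 p.2.
Proof.
rewrite -{1}[t]reprK; elim: (repr t) => [|[b m] s IH]; first by rewrite big_nil.
by rewrite big_cons -IH [RHS]tadd_pi.
Qed.

End Tensor.

Section TensorGrading.
Variable F : fieldType.

Lemma fsum_linear (M : gmod F) (U : lmodType F) (f : int -> M -> U) :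
  (forall n, linear (f n)) -> (forall n x, gpr n x = 0 -> f n x = 0) ->
  linear (fun x => \sum_(n \in [set: int]) f n x).
Proof.
move=> fl f0 c x y; have [s xs] := gpr_supp x; have [t yt] := gpr_supp y.
have s0 n : n \notin s ++ t -> gpr n x = 0 /\ gpr n y = 0.
  by rewrite mem_cat negb_or => /andP[/xs-> /yt->].
have z0 n : n \notin s ++ t -> gpr n (c *: x + y) = 0.
  by rewrite linearP /= => /s0[-> ->]; rewrite scaler0 addr0.
rewrite !(@fsum_seq _ (s ++ t)) => [|n /s0[_ /f0]|n /s0[/f0]|n /z0 /f0] //.
by rewrite scaler_sumr -big_split /=; apply: eq_bigr => n _; rewrite fl.
Qed.

Variables B M : gmod F.

Let tl m : linear (fun b => @tpure F B M b m).
Proof. exact: (tpure_bilin B M).2. Qed.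

Let tr b : linear (@tpure F B M b).
Proof. exact: (tpure_bilin B M).1. Qed.

Lemma tpure0l m : @tpure F B M 0 m = 0.
Proof. by have := linZ 0 0 (tl m); rewrite !scale0r. Qed.

Lemma tpure0r b : @tpure F B M b 0 = 0.
Proof. by have := linZ 0 0 (tr b); rewrite !scale0r. Qed.

Lemma tpure_suml (I : Type) (s : seq I) (P : pred I) (f : I -> B) m :
  tpure (\sum_(i <- s | P i) f i) m = \sum_(i <- s | P i) @tpure F B M (f i) m.
Proof.
exact: (big_morph (fun b => tpure b m) (fun x y => linD x y (tl m)) (tpure0l m)).
Qed.

Lemma tpure_sumr (I : Type) (s : seq I) (P : pred I) b (f : I -> M) :
  tpure b (\sum_(i <- s | P i) f i) = \sum_(i <- s | P i) @tpure F B M b (f i).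
Proof.
exact: (big_morph (tpure b) (fun x y => linD x y (tr b)) (tpure0r b)).
Qed.

Lemma tens_ind (P : tens B M -> Prop) :
  P 0 -> (forall x y, P x -> P y -> P (x + y)) ->
  (forall i j b m, P (tpure (gpr i b) (gpr j m))) -> forall t, P t.
Proof.
move=> P0 PD Pp t; rewrite [t]tens_gen; apply: big_ind => // -[b m] _ /=.
have [s ->] := gpr_gen b; have [u ->] := gpr_gen m.
rewrite tpure_suml; apply: big_ind => // p _.
by rewrite tpure_sumr; apply: big_ind.
Qed.

Definition tgpr_pure q (b : B) (m : M) : tens B M :=
  \sum_(n \in [set: int]) tpure (gpr n b) (gpr (q - n) m).

Definition tgpr q : tens B M -> tens B M := tlift (tgpr_pure q).

Lemma tgpr_pure_bilin q : bilin (tgpr_pure q).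
Proof.
split=> [b|m].
  have [s bs] := gpr_supp b => c x y; rewrite /tgpr_pure.
  rewrite !(@fsum_seq _ s) => [|n /bs->|n /bs->|n /bs->]; rewrite ?tpure0l //.
  rewrite scaler_sumr -big_split /=; apply: eq_bigr => n _.
  by rewrite linearP /= tr.
apply: fsum_linear => [n c x y|n x ->]; last exact: tpure0l.
by rewrite linearP /= [LHS]tl.
Qed.

Lemma tgpr_linear q : linear (tgpr q).
Proof. exact: tlift_linear (tgpr_pure_bilin q). Qed.

HB.instance Definition _ q :=
  GRing.isLinear.Build F _ _ _ (tgpr q) (tgpr_linear q).

Lemma tgpr_homog q i j b m :
  tgpr q (tpure (gpr i b) (gpr j m)) =
  if q == i + j then tpure (gpr i b) (gpr j m) else 0.
Proof.
rewrite /tgpr tlift_pure; last exact: tgpr_pure_bilin.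
rewrite /tgpr_pure (@fsum_seq _ [:: i]) => [|n]; last first.
  by rewrite inE gprK => /negPf->; rewrite tpure0l.
rewrite big_seq1 !gprK eqxx subr_eq addrC.
by case: eqP => // _; rewrite tpure0r.
Qed.

Lemma tgprK m n x : tgpr m (tgpr n x) = if m == n then tgpr n x else 0.
Proof.
elim/tens_ind: x => [|x y IHx IHy|i j b c].
- by rewrite !linear0 if_same.
- by rewrite !linearD /= IHx IHy; case: eqP; rewrite ?addr0.
rewrite !tgpr_homog; case: (n =P i + j) => [->|_]; first exact: tgpr_homog.
by rewrite linear0 if_same.
Qed.

Lemma tgpr_gen x : exists s : seq (int * tens B M),
  x = \sum_(p <- s) tgpr p.1 p.2.
Proof.
elim/tens_ind: x => [|x y [s ->] [t ->]|i j b c].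
- by exists [::]; rewrite big_nil.
- by exists (s ++ t); rewrite big_cat.
exists [:: (i + j, tpure (gpr i b) (gpr j c))].
by rewrite big_seq1 tgpr_homog eqxx.
Qed.

Definition tensg := GMod tgpr_linear tgprK tgpr_gen.

End TensorGrading.

Section BasicModules.
Variable F : fieldType.

Definition ugpr (n : int) (c : F^o) : F^o := if n == 0 then c else 0.

Lemma ugpr_linear n : linear (ugpr n).
Proof. by move=> c x y; rewrite /ugpr; case: eqP; rewrite ?scaler0 ?addr0. Qed.

Lemma ugprK m n x : ugpr m (ugpr n x) = if m == n then ugpr n x else 0.
Proof.
rewrite /ugpr; case: (n =P 0) => [->|_]; first by case: eqP.
by rewrite !if_same.
Qed.

Lemma ugpr_gen x : exists s : seq (int * F^o),
  x = \sum_(p <- s) ugpr p.1 p.2.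
Proof. by exists [:: (0, x)]; rewrite big_seq1. Qed.

(* The ground field, in degree 0. *)
Definition unitg := GMod ugpr_linear ugprK ugpr_gen.

Variable M : gmod F.

(* s^{-1} M; the underlying space does not change, so that s and s^{-1} are
   the identity map. *)
Definition sgpr (q : int) (x : M) : M := gpr (q + 1) x.

Lemma sgpr_linear q : linear (sgpr q).
Proof. exact: gpr_linear. Qed.

Lemma sgprK m n x : sgpr m (sgpr n x) = if m == n then sgpr n x else 0.
Proof. by rewrite /sgpr gprK (inj_eq (addIr 1)). Qed.

Lemma sgpr_gen x : exists s : seq (int * M),
  x = \sum_(p <- s) sgpr p.1 p.2.
Proof.
have [s ->] := gpr_gen x; exists [seq (p.1 - 1, p.2) | p <- s].
by rewrite big_map; apply: eq_bigr => p _; rewrite /sgpr /= subrK.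
Qed.

Definition desus := GMod sgpr_linear sgprK sgpr_gen.

(* M^#: linear forms that vanish on M_n for all but finitely many n. *)
Definition dual_pred : {pred M -> F^o} := fun f =>
  `[< linear f /\
      exists s : seq int, forall n x, n \notin s -> f (gpr n x) = 0 >].

Lemma dual_closed : submod_closed dual_pred.
Proof.
split.
  apply/asboolP; split; last by exists [::].
  by move=> c x y /=; rewrite scaler0 addr0.
move=> c f g /asboolP[fl [s fs]] /asboolP[gl [t gt]]; apply/asboolP; split.
  move=> a x y; rewrite -![(_ + _) _]/(_ *: _ + _) fl gl.
  by rewrite !scalerDr !scalerA (mulrC c a) addrACA.
exists (s ++ t) => n x; rewrite mem_cat negb_or => /andP[ns nt].
by rewrite -![(_ + _) _]/(_ *: _ + _) fs // gt // scaler0 addr0.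
Qed.

HB.instance Definition _ := GRing.isSubmodClosed.Build F _ dual_pred dual_closed.

Record dual := Dual { dual_val :> M -> F^o; dual_valP : dual_val \in dual_pred }.

HB.instance Definition _ := [isSub for dual_val].
HB.instance Definition _ := [Choice of dual by <:].
HB.instance Definition _ := [SubChoice_isSubLmodule of dual by <:].

Lemma dual_linear (f : dual) : linear f.
Proof. by have /asboolP[] := dual_valP f. Qed.

HB.instance Definition _ (f : dual) :=
  GRing.isLinear.Build F M F^o _ (dual_val f) (dual_linear f).

Lemma dgpr_subproof (q : int) (f : dual) :
  (fun x => f (gpr (- q) x)) \in dual_pred.
Proof.
have /asboolP[fl [s fs]] := dual_valP f; apply/asboolP; split.
  by move=> c x y; rewrite linearP fl.
exists [:: - q] => n x; rewrite inE gprK eq_sym => /negPf->.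
by rewrite (linear0 f).
Qed.

Definition dgpr (q : int) (f : dual) : dual := Dual (dgpr_subproof q f).

Lemma dgpr_linear q : linear (dgpr q).
Proof. by move=> c f g; apply: val_inj. Qed.

Lemma dgprK m n f : dgpr m (dgpr n f) = if m == n then dgpr n f else 0.
Proof.
apply/val_inj/funext => x /=; rewrite gprK (inj_eq (@oppr_inj _)) eq_sym.
by case: eqP => [->//|_]; rewrite (linear0 f).
Qed.

Lemma dgpr_gen f : exists s : seq (int * dual),
  f = \sum_(p <- s) dgpr p.1 p.2.
Proof.
have /asboolP[fl [s fs]] := dual_valP f.
exists [seq (- n, f) | n <- undup s]; rewrite big_map.
apply/val_inj; rewrite [RHS](raddf_sum val) fct_sumE; apply/funext => x /=.
have [t xt] := gpr_supp x.
have st n : n \notin s ++ t -> gpr n x = 0.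
  by rewrite mem_cat negb_or => /andP[_ /xt].
rewrite [in LHS](gpr_sumE st) (linear_sum f) /=.
rewrite (bigID [in s]) /= [X in _ + X]big1 => [|i /fs //]; rewrite addr0.
rewrite -big_filter; under [RHS]eq_bigr do rewrite opprK.
apply: perm_big; apply: uniq_perm.
- by rewrite filter_uniq ?undup_uniq.
- exact: undup_uniq.
by move=> n; rewrite mem_filter !mem_undup mem_cat; case: (n \in s).
Qed.

Definition dualg := GMod dgpr_linear dgprK dgpr_gen.

End BasicModules.

Record gsub (F : fieldType) (M : gmod F) := GSub {
  gsub_pred :> {pred M};
  gsub_closed : submod_closed gsub_pred;
  gsub_gpr : forall n x, x \in gsub_pred -> gpr n x \in gsub_pred }.

Section Quotient.
Variables (F : fieldType) (M : gmod F) (N : gsub M).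

HB.instance Definition _ :=
  GRing.isSubmodClosed.Build F M (gsub_pred N) (gsub_closed N).

Definition qequiv (x y : M) := x - y \in gsub_pred N.

Lemma qequiv_equiv : equiv_class_of qequiv.
Proof.
split=> [x|x y|y x z]; rewrite /qequiv; first by rewrite subrr rpred0.
  by rewrite -opprB rpredN.
move=> xy yz; have := rpredD xy yz.
by rewrite addrA subrK.
Qed.

Canonical qequiv_equivRel := EquivRelPack qequiv_equiv.

Definition quot := {eq_quot qequiv}.
HB.instance Definition _ := Choice.on quot.
HB.instance Definition _ := EqQuotient.on quot.

Definition qpi (x : M) : quot := \pi_quot x.

Lemma qpi_eq x y : x - y \in gsub_pred N -> qpi x = qpi y.
Proof. by move=> xy; apply/eqmodP. Qed.

Lemma qpi_repr x : repr (qpi x) - x \in gsub_pred N.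
Proof. by have /eqmodP : repr (qpi x) = x %[mod quot] by rewrite reprK. Qed.

Lemma quotW (P : quot -> Prop) : (forall x, P (qpi x)) -> forall u, P u.
Proof. by move=> Px u; rewrite -[u]reprK; exact: Px. Qed.

Definition qadd (u v : quot) : quot := qpi (repr u + repr v).
Definition qopp (u : quot) : quot := qpi (- repr u).
Definition qscale (c : F) (u : quot) : quot := qpi (c *: repr u).

Lemma qadd_pi x y : qadd (qpi x) (qpi y) = qpi (x + y).
Proof. by apply: qpi_eq; rewrite opprD addrACA rpredD ?qpi_repr. Qed.

Lemma qopp_pi x : qopp (qpi x) = qpi (- x).
Proof. by apply: qpi_eq; rewrite -opprD rpredN qpi_repr. Qed.

Lemma qscale_pi c x : qscale c (qpi x) = qpi (c *: x).
Proof. by apply: qpi_eq; rewrite -scalerBr rpredZ ?qpi_repr. Qed.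

Lemma qaddA : associative qadd.
Proof.
by elim/quotW=> x; elim/quotW=> y; elim/quotW=> z; rewrite !qadd_pi addrA.
Qed.

Lemma qaddC : commutative qadd.
Proof. by elim/quotW=> x; elim/quotW=> y; rewrite !qadd_pi addrC. Qed.

Lemma qadd0 : left_id (qpi 0) qadd.
Proof. by elim/quotW=> x; rewrite qadd_pi add0r. Qed.

Lemma qaddN : left_inverse (qpi 0) qopp qadd.
Proof. by elim/quotW=> x; rewrite qopp_pi qadd_pi addNr. Qed.

HB.instance Definition _ := GRing.isZmodule.Build quot qaddA qaddC qadd0 qaddN.

Lemma qscaleA a b u : qscale a (qscale b u) = qscale (a * b) u.
Proof. by elim/quotW: u => x; rewrite !qscale_pi scalerA. Qed.

Lemma qscale1 : left_id 1 qscale.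
Proof. by elim/quotW=> x; rewrite qscale_pi scale1r. Qed.

Lemma qscaleDr : right_distributive qscale +%R.
Proof.
move=> c; elim/quotW=> x; elim/quotW=> y.
by rewrite [qpi x + _]qadd_pi !qscale_pi scalerDr [RHS]qadd_pi.
Qed.

Lemma qscaleDl u : {morph qscale^~ u : a b / a + b}.
Proof.
by elim/quotW: u => x a b; rewrite !qscale_pi scalerDl [RHS]qadd_pi.
Qed.

HB.instance Definition _ := GRing.Zmodule_isLmodule.Build F quot
  qscaleA qscale1 qscaleDr qscaleDl.

Lemma qpi_linear : linear qpi.
Proof.
by move=> c x y; rewrite -[RHS]/(qadd (qscale c _) _) qscale_pi qadd_pi.
Qed.

HB.instance Definition _ := GRing.isLinear.Build F M quot _ qpi qpi_linear.

Definition qgpr n (u : quot) : quot := qpi (gpr n (repr u)).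

Lemma qgpr_pi n x : qgpr n (qpi x) = qpi (gpr n x).
Proof. by apply: qpi_eq; rewrite -linearB gsub_gpr ?qpi_repr. Qed.

Lemma qgpr_linear n : linear (qgpr n).
Proof.
move=> c; elim/quotW=> x; elim/quotW=> y.
by rewrite -linearP !qgpr_pi -linearP -linearP.
Qed.

Lemma qgprK m n u : qgpr m (qgpr n u) = if m == n then qgpr n u else 0.
Proof.
by elim/quotW: u => x; rewrite !qgpr_pi gprK; case: eqP; rewrite ?linear0.
Qed.

Lemma qgpr_gen u : exists s : seq (int * quot), u = \sum_(p <- s) qgpr p.1 p.2.
Proof.
elim/quotW: u => x; have [s ->] := gpr_gen x.
exists [seq (p.1, qpi p.2) | p <- s]; rewrite big_map linear_sum.
by apply: eq_bigr => p _; rewrite qgpr_pi.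
Qed.

Definition quotg := GMod qgpr_linear qgprK qgpr_gen.

End Quotient.

Section Product.
Variables (F : fieldType) (M : nat -> lmodType F).

Definition dprod := forall n, M n.

HB.instance Definition _ := gen_eqMixin dprod.
HB.instance Definition _ := gen_choiceMixin dprod.

Definition dpzero : dprod := fun n => 0.
Definition dpadd (f g : dprod) : dprod := fun n => f n + g n.
Definition dpopp (f : dprod) : dprod := fun n => - f n.
Definition dpscale (c : F) (f : dprod) : dprod := fun n => c *: f n.

Lemma dpaddA : associative dpadd.
Proof. by move=> f g h; apply: functional_extensionality_dep => n; exact: addrA. Qed.

Lemma dpaddC : commutative dpadd.
Proof. by move=> f g; apply: functional_extensionality_dep => n; exact: addrC. Qed.

Lemma dpadd0 : left_id dpzero dpadd.
Proof. by move=> f; apply: functional_extensionality_dep => n; exact: add0r. Qed.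

Lemma dpaddN : left_inverse dpzero dpopp dpadd.
Proof. by move=> f; apply: functional_extensionality_dep => n; exact: addNr. Qed.

HB.instance Definition _ :=
  GRing.isZmodule.Build dprod dpaddA dpaddC dpadd0 dpaddN.

Lemma dpscaleA a b f : dpscale a (dpscale b f) = dpscale (a * b) f.
Proof. by apply: functional_extensionality_dep => n; exact: scalerA. Qed.

Lemma dpscale1 : left_id 1 dpscale.
Proof. by move=> f; apply: functional_extensionality_dep => n; exact: scale1r. Qed.

Lemma dpscaleDr : right_distributive dpscale +%R.
Proof. by move=> c f g; apply: functional_extensionality_dep => n; exact: scalerDr. Qed.

Lemma dpscaleDl f : {morph dpscale^~ f : a b / a + b}.
Proof. by move=> a b; apply: functional_extensionality_dep => n; exact: scalerDl. Qed.

HB.instance Definition _ := GRing.Zmodule_isLmodule.Build F dprod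
  dpscaleA dpscale1 dpscaleDr dpscaleDl.

End Product.

Record cplx (F : fieldType) := Cplx {
  ccar :> gmod F;
  cd : ccar -> ccar;
  cd_linear : linear cd;
  cd_degree : has_degree (-1) cd;
  cdd : forall x, cd (cd x) = 0 }.

(* Existence of a unit is not required. *)
Record cdga (F : fieldType) := Cdga {
  acar :> cplx F;
  amul : acar -> acar -> acar;
  amul_bilin : bilin amul;
  amul_degree : forall m n a b,
    gpr (m + n) (amul (gpr m a) (gpr n b)) = amul (gpr m a) (gpr n b);
  amulA : associative amul;
  amul_com : forall m n a b,
    amul (gpr m a) (gpr n b) = (-1) ^ (m * n) *: amul (gpr n b) (gpr m a);
  amul_leibniz : forall m a b,
    cd (amul (gpr m a) b) =
    amul (cd (gpr m a)) b + (-1) ^ m *: amul (gpr m a) (cd b) }.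

Record dgl (F : fieldType) := Dgl {
  lcar :> cplx F;
  lbr : lcar -> lcar -> lcar;
  lbr_bilin : bilin lbr;
  lbr_degree : forall m n x y,
    gpr (m + n) (lbr (gpr m x) (gpr n y)) = lbr (gpr m x) (gpr n y);
  lbr_anti : forall m n x y,
    lbr (gpr m x) (gpr n y) = - ((-1) ^ (m * n) *: lbr (gpr n y) (gpr m x));
  lbr_jacobi : forall m n x y z,
    lbr (gpr m x) (lbr (gpr n y) z) =
    lbr (lbr (gpr m x) (gpr n y)) z +
    (-1) ^ (m * n) *: lbr (gpr n y) (lbr (gpr m x) z);
  lbr_leibniz : forall m x y,
    cd (lbr (gpr m x) y) =
    lbr (cd (gpr m x)) y + (-1) ^ m *: lbr (gpr m x) (cd y) }.

Section Completion.
Variables (F : fieldType) (L : dgl F).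

(* L^n for n >= 1, with L^0 := L^1 = L. *)
Fixpoint lcs_pred (n : nat) : {pred L} :=
  if n is (k.+1 as m).+1 then fun x => `[< exists s : seq (L * L),
    (forall p, p \in s -> p.2 \in lcs_pred m) /\
    x = \sum_(p <- s) lbr p.1 p.2 >]
  else predT.

Lemma lbr0l y : lbr 0 y = 0 :> L.
Proof. by have := linZ 0 0 ((lbr_bilin L).2 y); rewrite !scale0r. Qed.

Lemma lbr0r x : lbr x 0 = 0 :> L.
Proof. by have := linZ 0 0 ((lbr_bilin L).1 x); rewrite !scale0r. Qed.

Lemma lbr_sumr (I : Type) (s : seq I) (P : pred I) x (f : I -> L) :
  lbr x (\sum_(i <- s | P i) f i) = \sum_(i <- s | P i) lbr x (f i) :> L.
Proof.
exact: (big_morph (lbr x) (fun y z => linD y z ((lbr_bilin L).1 x)) (lbr0r x)).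
Qed.

Lemma lbr_suml (I : Type) (s : seq I) (P : pred I) y (f : I -> L) :
  lbr (\sum_(i <- s | P i) f i) y = \sum_(i <- s | P i) lbr (f i) y :> L.
Proof.
exact: (big_morph (fun x => lbr x y)
  (fun x z => linD x z ((lbr_bilin L).2 y)) (lbr0l y)).
Qed.

Lemma lcs_closed n : submod_closed (lcs_pred n).
Proof.
case: n => [|[|n]]; try by split.
split; first by apply/asboolP; exists [::]; rewrite big_nil.
move=> c x y /asboolP[s [sP ->]] /asboolP[t [tP ->]]; apply/asboolP.
exists ([seq (c *: p.1, p.2) | p <- s] ++ t); split=> [p|].
  by rewrite mem_cat => /orP[/mapP[q /sP qn ->]|/tP].
rewrite big_cat big_map /= scaler_sumr; congr (_ + _).
by apply: eq_bigr => p _; rewrite (linZ _ _ ((lbr_bilin L).2 _)).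
Qed.

Lemma lcs_gpr n q x : x \in lcs_pred n -> gpr q x \in lcs_pred n.
Proof.
elim: n q x => [|[|n] IH] q x //.
have [P0 PS] := lcs_closed n.+2.
have PD y z : y \in lcs_pred n.+2 -> z \in lcs_pred n.+2 ->
    y + z \in lcs_pred n.+2.
  by move=> yP zP; rewrite -[y]scale1r; exact: PS.
move=> /asboolP[s [sP ->]]; rewrite linear_sum big_seq /=.
apply: (big_ind [in lcs_pred n.+2]) => // -[a b] /sP /= bP.
have [u au] := gpr_supp a; have [v bv] := gpr_supp b.
rewrite {1}(gpr_sumE au) lbr_suml linear_sum /=.
apply: (big_ind [in lcs_pred n.+2]) => // i _.
rewrite {1}(gpr_sumE bv) lbr_sumr linear_sum /=.
apply: (big_ind [in lcs_pred n.+2]) => // j _.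
rewrite -lbr_degree gprK; case: eqP => // _; rewrite lbr_degree.
apply/asboolP; exists [:: (gpr i a, gpr j b)]; rewrite big_seq1; split=> // p.
by rewrite inE => /eqP-> /=; exact: IH.
Qed.

Definition lcs n : gsub L := GSub (lcs_closed n) (@lcs_gpr n).

Definition lquot n : gmod F := quotg (lcs n).

Definition lqbr n (x y : lquot n) : lquot n := qpi (lcs n) (lbr (repr x) (repr y)).

Definition lqd n (x : lquot n) : lquot n := qpi (lcs n) (cd (repr x)).

Definition lproj n (x : lquot n.+1) : lquot n := qpi (lcs n) (repr x).

(* L = lim L/L^n in the category of graded spaces, i.e. degree by degree. *)
Definition complete := forall q : int,
  (forall x : L, gpr q x = x -> (forall n, x \in lcs n) -> x = 0) /\
  (forall y : forall n, lquot n,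
    (forall n, lproj (y n.+1) = y n) -> (forall n, gpr q (y n) = y n) ->
    exists2 x : L, gpr q x = x & forall n, qpi (lcs n) x = y n).

End Completion.

Record cdgl (F : fieldType) := Cdgl {
  cdgl_dgl :> dgl F;
  cdglP : complete cdgl_dgl }.

(* Homotopy retract; the homotopy satisfies i p - id = d K + K d. *)
Record retract (F : fieldType) (A V : cplx F) := Retract {
  ri : V -> A;
  rp : A -> V;
  rK : A -> A;
  ri_linear : linear ri;
  rp_linear : linear rp;
  rK_linear : linear rK;
  ri_degree : has_degree 0 ri;
  rp_degree : has_degree 0 rp;
  rK_degree : has_degree 1 rK;
  ri_chain : forall v, ri (cd v) = cd (ri v);
  rp_chain : forall a, rp (cd a) = cd (rp a);
  rpi : forall v, rp (ri v) = v;
  rip : forall a, ri (rp a) - a = cd (rK a) + rK (cd a) }.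

(* Bounded, and finite-dimensional in each degree. Without boundedness neither
   V (x) L -> Hom(V^#, L) nor (V^#)^{(x) k} -> (V^{(x) k})^# is onto. *)
Definition finite_type (F : fieldType) (V : gmod F) :=
  (exists N : nat, forall n (v : V), (N < `|n|)%N -> gpr n v = 0) /\
  (forall n, exists s : seq V, forall v : V,
    exists c : nat -> F, gpr n v = \sum_(i < size s) c i *: s`_i).

Inductive btree := Leaf | Node of btree & btree.

Fixpoint leaves (T : btree) : nat :=
  if T is Node l r then (leaves l + leaves r)%N else 1%N.

(* The planar binary trees with k leaves; [h] bounds the height. *)
Fixpoint ptrees_rec (h k : nat) : seq btree :=
  if k == 1%N then [:: Leaf] else
  if h is h'.+1 then
    flatten [seq [seq Node l r | l <- ptrees_rec h' j, r <- ptrees_rec h' (k - j)]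
            | j <- iota 1 k.-1]
  else [::].

Definition ptrees (k : nat) := ptrees_rec k k.

(* The number of isomorphisms of rooted trees from S to T, planar structures
   being ignored: at each vertex the two branches may be exchanged. *)
Fixpoint num_iso (S T : btree) : nat :=
  match S, T with
  | Leaf, Leaf => 1
  | Node a b, Node c d =>
      num_iso a c * num_iso b d + num_iso a d * num_iso b c
  | _, _ => 0
  end.

(* One planar embedding of each isomorphism class of non-planar trees. *)
Definition nptrees (k : nat) : seq btree :=
  foldr (fun T s => if has (fun S => 0 < num_iso T S)%N s then s else T :: s)
        [::] (ptrees k).

Section Trees.
Variables (F : fieldType) (H E : lmodType F).
Variables (inc : H -> E) (op : E -> E -> E) (h : E -> E) (sg : H -> H).
Variable eps : nat -> nat -> nat.

(* The composition defined by T, without the label of the root. The branches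
   at a vertex with n leaves on the left and m on the right define maps f and
   g, of degrees n - 1 and m - 1, and (f (x) g)(a (x) b) is
   (-1)^{|g||a|} f a (x) g b, whence the m - 1 applications of the sign
   operator [sg] to the entries of a. The factor (-1)^{eps n m} is the sign
   attached to the vertex. *)
Fixpoint tree_op (T : btree) (a : seq H) : E :=
  match T with
  | Leaf => inc (head 0 a)
  | Node l r =>
      let edge S b := if S is Leaf then tree_op S b else h (tree_op S b) in
      let n := leaves l in let m := leaves r in
      (-1) ^+ eps n m *:
        op (edge l (map (iter m.-1 sg) (take n a))) (edge r (drop n a))
  end.

End Trees.

Section CInfinity.
Variables (F : fieldType) (A : cdga F) (V : cplx F) (R : retract A V).

(* The sign (-1)^{n-1} at a vertex with n leaves on the left is the one for
   which m_T = s^{-1} b_T s^{(x) k}, b_T being the composition, without signs,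
   of the maps b and s K s^{-1}, where m = s^{-1} b (s (x) s). It goes with the
   sign of d_k in [sd_gen], as (-1)^{k(k-1)/2} (s^{-1})^{(x) k} is the inverse
   of s^{(x) k}. *)
Definition ctree (T : btree) (a : seq V) : V :=
  rp R (tree_op (ri R) (@amul F A) (rK R) (@par F V) (fun n _ => n.-1) T a).

Definition cinf (k : nat) (a : seq V) : V :=
  match k with
  | 0 => 0
  | 1 => cd (head 0 a)
  | _ => \sum_(T <- ptrees k) ctree T a
  end.

Fixpoint tpow (W : gmod F) (k : nat) : gmod F :=
  if k is k'.+1 then tensg W (tpow W k') else unitg F.

(* The isomorphism from (V^#)^{(x) k} to (V^{(x) k})^#:
   <f (x) g, a (x) b> = (-1)^{|g||a|} <f, a> <g, b>. *)
Fixpoint pairing (k : nat) : tpow (dualg V) k -> seq V -> F^o :=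
  match k with
  | 0 => fun c _ => c
  | k'.+1 => fun t a =>
      tlift (fun (f : dualg V) (u : tpow (dualg V) k') =>
        kos (fun (u : tpow (dualg V) k') (x : V) =>
               (f x : F) *: pairing u (behead a)) u (head 0 a)) t
  end.

(* Delta_k = m_k^#, that is f |-> (-1)^{k|f|} f o m_k, as m_k has degree k - 2. *)
Definition delta (k : nat) (f : dualg V) : tpow (dualg V) k :=
  xget 0 [set t | forall a : seq V, size a = k ->
    pairing t a = iter k (@par F (dualg V)) f (cinf k a)].

Local Notation W := (desus (dualg V)).

Fixpoint desus_pow (k : nat) : tpow (dualg V) k -> tpow W k :=
  match k with
  | 0 => id
  | k'.+1 => tlift (fun (f : dualg V) (u : tpow (dualg V) k') =>
      tpure (iter k' (@par F (dualg V)) f : W) (desus_pow u))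
  end.

(* Products of the tensor powers of W: the completed tensor algebra. *)
Definition series := dprod (fun n => tpow W n : lmodType F).

Definition sproj (q : int) (f : series) : series := fun n => gpr q (f n).

Fixpoint cat_pow (k n : nat) : tpow W k -> tpow W n -> tpow W (k + n) :=
  match k with
  | 0 => fun c t => (c : F) *: t
  | k'.+1 => fun s t =>
      tlift (fun (w : W) (u : tpow W k') => tpure w (cat_pow u t)) s
  end.

Definition smul (f g : series) : series := fun n =>
  \sum_(i < n.+1) ecast j (tpow W j) (subnKC (leq_ord i))
    (cat_pow (f i) (g (n - i)%N)).

Definition sinj (n : nat) (t : tpow W n) : series := fun m =>
  match n =P m with
  | ReflectT e => ecast j (tpow W j) e t
  | ReflectF _ => 0
  end.

Definition sbr (f g : series) : series :=
  smul f g - \sum_(m \in [set: int]) \sum_(n \in [set: int])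
    (-1) ^ (m * n) *: smul (sproj n g) (sproj m f).

Definition sgen (w : W) : series := sinj (n := 1) (tpure w (1 : unitg F)).

(* The differential on generators, with components
   d_k = - (-1)^{k(k-1)/2} (s^{-1})^{(x) k} o Delta_k o s. *)
Definition sd_gen (w : W) : series := fun k =>
  if k is 0 then 0 else (- (-1) ^+ 'C(k, 2)) *: desus_pow (delta k w).

(* Its extension as a derivation, first to tensors of length n. *)
Fixpoint sd_pow (n : nat) : tpow W n -> series :=
  match n with
  | 0 => fun _ => 0
  | n'.+1 => tlift (fun (w : W) (t : tpow W n') =>
      smul (sd_gen w) (sinj t) + smul (sgen (par w)) (sd_pow t))
  end.

Definition sd (f : series) : series := fun m => \sum_(n < m.+1) sd_pow (f n) m.

Inductive lie_poly : series -> Prop :=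
| LieGen w : lie_poly (sgen w)
| LieZero : lie_poly 0
| LieLin c f g : lie_poly f -> lie_poly g -> lie_poly (c *: f + g)
| LieBr f g : lie_poly f -> lie_poly g -> lie_poly (sbr f g).

(* The elements of the completion of the free Lie algebra: the series that
   agree with Lie polynomials up to any given length. The limit being taken
   degree by degree, only finitely many degrees occur. *)
Definition lie_series_pred : {pred series} := fun f =>
  `[< (forall n, exists2 g, lie_poly g & forall k, (k <= n)%N -> f k = g k) /\
      (exists s : seq int, forall q, q \notin s -> sproj q f = 0) >].

Lemma lie_series_closed : submod_closed lie_series_pred.
Proof.
split=> [|c f g /asboolP[fP [s fs]] /asboolP[gP [t gt]]]; apply/asboolP; split.
- by move=> n; exists 0; first exact: LieZero.
- exists [::] => q _; apply: functional_extensionality_dep => n.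
  exact: linear0.
- move=> n; have [f' f'P ff'] := fP n; have [g' g'P gg'] := gP n.
  exists (c *: f' + g'); first exact: LieLin.
  move=> k kn; rewrite -[LHS]/(c *: f k + g k) -[RHS]/(c *: f' k + g' k).
  by rewrite ff' ?gg'.
exists (s ++ t) => q; rewrite mem_cat negb_or => /andP[/fs fq /gt gq].
apply: functional_extensionality_dep => n.
rewrite -[LHS]/(gpr q (c *: f n + g n)) linearP /=.
rewrite -[gpr q (f n)]/(sproj q f n) -[gpr q (g n)]/(sproj q g n) fq gq.
by rewrite scaler0 addr0.
Qed.

Lemma sgen_lie w : sgen w \in lie_series_pred.
Proof.
apply/asboolP; split=> [n|]; first by exists (sgen w); first exact: LieGen.
have [s ws] := gpr_supp (tpure w (1 : unitg F) : tpow W 1).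
exists s => q /ws wq; apply: functional_extensionality_dep => m.
rewrite /sproj /sgen /sinj; case: eqP => [e|_]; last exact: linear0.
by case: m / e.
Qed.

HB.instance Definition _ :=
  GRing.isSubmodClosed.Build F _ lie_series_pred lie_series_closed.

Record lie_series := LieSeries {
  lie_val :> series;
  lie_valP : lie_val \in lie_series_pred }.

HB.instance Definition _ := [isSub for lie_val].
HB.instance Definition _ := [Choice of lie_series by <:].
HB.instance Definition _ := [SubChoice_isSubLmodule of lie_series by <:].

Definition lgen (f : dualg V) : lie_series := LieSeries (sgen_lie (f : W)).

End CInfinity.

(* A graded space with a bracket and a differential, no axiom being imposed. *)
Record lie_ops (F : fieldType) := LieOps {
  ocar :> lmodType F;
  odeg : int -> ocar -> Prop;
  obr : ocar -> ocar -> ocar;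
  od : ocar -> ocar }.

Definition dgl_ops (F : fieldType) (L : dgl F) : lie_ops F :=
  @LieOps F L (fun q x => gpr q x = x) (@lbr F L) (@cd F L).
Coercion dgl_ops : dgl >-> lie_ops.

(* The cDGL L(V^#). Lie series are closed under the bracket and the
   differential of the completed tensor algebra, so the default value 0 of
   [insubd] is never used. *)
Definition free_cdgl (F : fieldType) (A : cdga F) (V : cplx F)
    (R : retract A V) : lie_ops F :=
  @LieOps F (lie_series V) (fun q f => sproj q f = f)
    (fun f g => insubd 0 (sbr f g)) (fun f => insubd 0 (sd R f)).

Definition is_dgl_hom (F : fieldType) (M N : lie_ops F) (phi : M -> N) :=
  [/\ linear phi,
      forall q x, odeg q x -> odeg q (phi x),
      forall x y, phi (obr x y) = obr (phi x) (phi y) &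
      forall x, phi (od x) = od (phi x)].

(* cDGL's form a full subcategory of DGL's. *)
Definition hom_cdgl (F : fieldType) (M N : lie_ops F) :=
  {phi : M -> N | is_dgl_hom phi}.

Section LInfinity.
Variables (F : fieldType) (L : dgl F).

(* The product of the B (x) L/L^n; the completed tensor product of B and L
   consists of its coherent elements, and the operations below preserve them. *)
Definition ctens (B : gmod F) := dprod (fun n => tensg B (lquot L n) : lmodType F).

Definition coherent (B : gmod F) (x : ctens B) :=
  forall n, tlift (fun b (y : lquot L n.+1) => tpure b (lproj y)) (x n.+1) = x n.

Definition cproj (B : gmod F) (q : int) (x : ctens B) : ctens B :=
  fun n => gpr q (x n).

Definition cpar (B : gmod F) (x : ctens B) : ctens B := fun n => par (x n).

Definition cmap (B C : gmod F) (f : B -> C) (x : ctens B) : ctens C :=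
  fun n => tlift (fun b (y : lquot L n) => tpure (f b) y) (x n).

Definition cdiff (B : cplx F) (x : ctens B) : ctens B := fun n =>
  tlift (fun b (y : lquot L n) => tpure (cd b) y + tpure (par b) (lqd y)) (x n).

(* [a (x) x, b (x) y] = (-1)^{|x||b|} ab (x) [x, y] *)
Definition cbr (A : cdga F) (x y : ctens A) : ctens A := fun n =>
  tlift (fun a (u : lquot L n) =>
    tlift (fun b (v : lquot L n) =>
      kos (fun (u : lquot L n) (b : A) => tpure (amul a b) (lqbr u v)) u b)
    (y n)) (x n).

Variables (A : cdga F) (V : cplx F) (R : retract A V).

(* The sign (-1)^{n(m-1)} at a vertex with n leaves on the left and m on the
   right is the one for which s l_T (s^{-1})^{(x) k} is the composition,
   without signs, of the maps s [,] (s^{-1} (x) s^{-1}) and s K s^{-1}. Then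
   l_T o S_k does not depend on the planar embedding of T, and the
   Maurer-Cartan equation has no signs. *)
Definition ltree (T : btree) (a : seq (ctens V)) : ctens V :=
  cmap (rp R) (tree_op (cmap (ri R)) (@cbr A) (cmap (rK R)) (@cpar V)
    (fun n m => n * m.-1)%N T a).

(* Signature times Koszul sign, for elements of degrees e_0, ..., e_{k-1}. *)
Definition koszul (k : nat) (e : 'I_k -> int) (s : 'S_k) : F :=
  (-1) ^+ s * \prod_(i < k) \prod_(j < k | (i < j)%N && (s j < s i)%N)
                (-1) ^ (e (s i) * e (s j)).

(* l_k on homogeneous elements a_0, ..., a_{k-1} of degrees e_0, ..., e_{k-1} *)
Definition linf (k : nat) : ('I_k -> int) -> ('I_k -> ctens V) -> ctens V :=
  match k with
  | 0 => fun _ _ => 0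
  | 1 => fun _ a => cdiff (a ord0)
  | k'.+2 => fun e a =>
      \sum_(T <- nptrees k'.+2) (num_iso T T)%:R^-1 *:
        \sum_(s : 'S_k'.+2)
          koszul e s *: ltree T [seq a (s i) | i <- enum 'I_k'.+2]
  end.

(* Maurer-Cartan elements; the series converges in the inverse limit, where
   it has finitely many nonzero terms at each stage. *)
Definition is_mc (x : ctens V) :=
  [/\ coherent x, cproj (-1) x = x &
      forall n, exists N : nat, forall N' : nat, (N <= N')%N ->
        (\sum_(1 <= k < N'.+1) (k`!)%:R^-1 *:
           linf (k := k) (fun=> -1) (fun=> x)) n = 0].

Definition mc := {x : ctens V | is_mc x}.

(* The isomorphism from V (x) L to its completion. *)
Definition to_ctens (t : tens V L) : ctens V := fun n =>
  tlift (fun v x => tpure v (qpi (lcs L n) x)) t.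

(* Psi (a (x) x) f = (-1)^{|a||x|} f(a) x *)
Definition Psi (t : tens V L) (f : dualg V) : L :=
  tlift (fun a x => kos (fun (a : V) (x : L) => (f a : F) *: x) a x) t.

(* Restriction of a morphism to the generators, as a map of degree -1 on V^#.
   The identification of Hom_0(s^{-1} V^#, L) with Hom_{-1}(V^#, L) carries a
   sign, forced by the sign of d_2: for A = V = F the generator w of L(V^#)
   satisfies d w = 1/2 [w, w], while d x = - 1/2 [x, x] if x is in MC(L). *)
Definition gen_restr (phi : hom_cdgl (free_cdgl R) L) (f : dualg V) : L :=
  - sval phi (lgen f).

End LInfinity.

(* Main.v *)
(* A bounded space of finite type is finite-dimensional; let e_i be a homogeneous
   basis of V, with dual basis e_i^#. Elements of the completed tensor algebra on
   s^{-1} V^# are then functions on words in the indices i. By the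
   Dynkin-Specht-Wever identity, the projection w_1 ... w_k |->
   (1/k) [w_1, [w_2, ...]] fixes Lie series; replacing the letters by elements t_i
   of L extends t to a morphism of complete Lie algebras, and shows that it is the
   only one. The differentials are respected if and only if they are so on the
   generators.

   Put x = - sum_i e_i (x) t_i. All Koszul signs being trivial on copies of x,
   (1/k!) l_k(x, ..., x) is 2^{1-k} times the sum over planar trees, by counting
   planar representatives of a class, so that it is p X_k with
   X_k = (1/2) sum_j [K X_j, K X_{k-j}], K being omitted on X_1 = i x. The
   coefficients in A of the words of the transferred coproducts satisfy the same
   recursion, with words instead of elements of L. Hence the component at e_i of
   the Maurer-Cartan series of x is, up to sign, the image of d e_i^# minus
   d t_i. *)

From HB Require Import structures.
Require Import Defs.
From mathcomp Require Import all_boot all_order all_algebra perm.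
From mathcomp Require Import all_classical.
From mathcomp Require Import zify ring.

Set Implicit Arguments.
Unset Strict Implicit.
Unset Printing Implicit Defensive.

Import GRing.Theory.
Local Open Scope ring_scope.

(** * Words and word functions *)

(** Nested brackets span the free Lie algebra but are linearly dependent, so a map cannot simply be
    prescribed on them. A Lie series f is evaluated through the canonical coefficients f(I)/|I|; the
    Dynkin-Specht-Wever identity, proved in any target satisfying Jacobi and antisymmetry, shows
    that all other coefficients give the same value. The same lemmas are used with word functions as
    target, where they give closure properties of Lie series, and with L as target, where they give
    compatibility with brackets. That the dual coproducts take values in Lie polynomials is not read
    off shuffle relations: it follows from the commutativity of A, by the very identity that
    computes the Maurer-Cartan series. The signs are gathered in one factor per word, chosen so that
    the recursion over trees carries exactly the Koszul sign of the bracket of A (x) L. Continuity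
    of morphisms is proved, not assumed: letters are peeled off one at a time, so a series starting
    in length m is sent into L^m and equalities in L can be tested modulo every L^N. Characteristic
    0 permits division by word lengths, by k! and by powers of 2. *)

Section Signs.
Variable F : fieldType.

(** Only parities matter: together with [odd_absE] this turns sign identities into boolean ones. *)
Lemma signzE (m : int) : (-1 : F) ^ m = (-1) ^+ odd `|m|%N.
Proof.
rewrite signr_odd; case: m => n //.
by rewrite -[LHS]/(((-1) ^+ n.+1)^-1) -exprVn invrN1.
Qed.

Lemma odd_abszD (m n : int) : odd `|(m + n)%R|%N = odd `|m|%N (+) odd `|n|%N.
Proof. lia. Qed.

Lemma odd_abszM (m n : int) : odd `|(m * n)%R|%N = odd `|m|%N && odd `|n|%N.
Proof. by rewrite abszM oddM. Qed.

Definition odd_absE := (odd_abszD, odd_abszM, abszN).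

Lemma signzMK (m : int) : (-1 : F) ^ m * (-1) ^ m = 1.
Proof. by rewrite signzE -expr2 sqrr_sign. Qed.

Lemma signz_even (m : int) : ~~ odd `|m|%N -> (-1 : F) ^ m = 1.
Proof. by rewrite signzE => /negPf->. Qed.

Lemma signz_eq (m n : int) : odd `|m|%N = odd `|n|%N -> (-1 : F) ^ m = (-1) ^ n.
Proof. by rewrite !signzE => ->. Qed.

Lemma signzD (m n : int) : (-1 : F) ^ (m + n) = (-1) ^ m * (-1) ^ n.
Proof. by rewrite expfzDr // oppr_eq0 oner_eq0. Qed.

End Signs.

Section Words.
Variable T : finType.
Implicit Types (i j : T) (I J K : seq T).

Fixpoint words (k : nat) : seq (seq T) :=
  if k is k'.+1 then [seq i :: J | i <- enum T, J <- words k'] else [:: [::]].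

Lemma words_size k I : I \in words k -> size I = k.
Proof.
elim: k I => [|k IH] I /=; first by rewrite inE => /eqP->.
by case/allpairsP => -[i J] /= [_ /IH <- ->].
Qed.

(** Deconcatenations of a word, dual to the concatenation product. *)
Fixpoint splits (K : seq T) : seq (seq T * seq T) :=
  ([::], K) ::
  if K is i :: K' then [seq (i :: p.1, p.2) | p <- splits K'] else [::].

Lemma splits_cat K p : p \in splits K -> p.1 ++ p.2 = K.
Proof.
elim: K p => [|i K IH] p /=; first by rewrite inE => /eqP->.
by rewrite inE => /orP[/eqP->//|/mapP[q /IH <- ->]].
Qed.

Lemma splits_size K p : p \in splits K -> (size p.1 + size p.2)%N = size K.
Proof. by move=> /splits_cat <-; rewrite size_cat. Qed.

Lemma eq_big_words (R : Type) (idx : R) (op : R -> R -> R) k (G H : seq T -> R) :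
  (forall I, size I = k -> G I = H I) ->
  \big[op/idx]_(I <- words k) G I = \big[op/idx]_(I <- words k) H I.
Proof.
move=> GH; rewrite big_seq [RHS]big_seq.
by apply: eq_bigr => I /words_size /GH.
Qed.

Variable U : nmodType.

Lemma big_words0 (G : seq T -> U) : \sum_(I <- words 0) G I = G [::].
Proof. by rewrite /= big_seq1. Qed.

Lemma big_wordsS k (G : seq T -> U) :
  \sum_(I <- words k.+1) G I = \sum_i \sum_(I <- words k) G (i :: I).
Proof. by rewrite /= big_allpairs_dep -big_enum. Qed.

Lemma big_words1 (G : seq T -> U) :
  \sum_(I <- words 1) G I = \sum_i G [:: i].
Proof. by rewrite big_wordsS; under eq_bigr do rewrite big_words0. Qed.

Lemma big_words_cat l k (G : seq T -> U) :
  \sum_(K <- words (l + k)) G K =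
  \sum_(I <- words l) \sum_(J <- words k) G (I ++ J).
Proof.
elim: l G => [|l IH] G; first by rewrite big_words0.
rewrite addSn !big_wordsS; apply: eq_bigr => i _.
by rewrite (IH (fun K => G (i :: K))).
Qed.

Lemma big_words_rcons k (G : seq T -> U) :
  \sum_(K <- words k.+1) G K = \sum_(I <- words k) \sum_i G (rcons I i).
Proof.
rewrite -addn1 big_words_cat; apply: eq_bigr => I _.
by rewrite big_words1; apply: eq_bigr => i _; rewrite cats1.
Qed.

Lemma big_words_pred1 J (G : seq T -> U) :
  \sum_(I <- words (size J)) (if I == J then G I else 0) = G J.
Proof.
elim: J G => [|j J IH] G; first by rewrite big_words0.
rewrite big_wordsS (bigD1 j) //= [X in _ + X]big1 ?addr0 => [|i ij].
  rewrite -[RHS](IH (fun I => G (j :: I))); apply: eq_bigr => I _.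
  by rewrite eqseq_cons eqxx.
by rewrite big1 // => I _; rewrite eqseq_cons (negPf ij).
Qed.

Lemma big_splits_cons i K (G : seq T -> seq T -> U) :
  \sum_(p <- splits (i :: K)) G p.1 p.2 =
  G [::] (i :: K) + \sum_(p <- splits K) G (i :: p.1) p.2.
Proof. by rewrite /= big_cons big_map. Qed.

Lemma big_splits_nil (G : seq T -> seq T -> U) :
  \sum_(p <- splits [::]) G p.1 p.2 = G [::] [::].
Proof. by rewrite /= big_seq1. Qed.

Lemma big_splits_rcons K i (G : seq T -> seq T -> U) :
  \sum_(p <- splits (rcons K i)) G p.1 p.2 =
  \sum_(p <- splits K) G p.1 (rcons p.2 i) + G (rcons K i) [::].
Proof.
elim: K G => [|j K IH] G; first by rewrite /= !(big_cons, big_nil) /= !addr0.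
rewrite rcons_cons big_splits_cons (IH (fun I => G (j :: I))) addrA.
by rewrite (big_splits_cons j K (fun I J => G I (rcons J i))).
Qed.

Lemma big_words_splits k (G : seq T -> seq T -> U) :
  \sum_(K <- words k) \sum_(p <- splits K) G p.1 p.2 =
  \sum_(j < k.+1) \sum_(I <- words j) \sum_(J <- words (k - j)) G I J.
Proof.
elim: k G => [|k IH] G.
  by rewrite big_words0 big_splits_nil big_ord1 !big_words0.
rewrite big_wordsS big_ord_recl big_words0 subn0 big_wordsS.
under eq_bigr do under eq_bigr do rewrite big_splits_cons.
under eq_bigr => i _ do rewrite big_split (IH (fun I => G (i :: I))).
rewrite big_split; congr (_ + _); rewrite exchange_big.
by apply: eq_bigr => j _; rewrite big_wordsS.
Qed.

Lemma big_splits_sym K (G : seq T -> seq T -> U) :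
  \sum_(p <- splits K) G p.1 p.2 =
  \sum_(j < (size K).+1) G (take j K) (drop j K).
Proof.
elim: K G => [|i K IH] G; first by rewrite big_splits_nil big_ord1.
by rewrite big_splits_cons big_ord_recl (IH (fun I => G (i :: I))).
Qed.

End Words.

Arguments words : simpl never.
Arguments splits : simpl never.

Section WordFunctions.
Variables (F : fieldType) (T : finType) (u : T -> int).
Implicit Types (i j : T) (I J K : seq T).
Local Notation wfun := (seq T -> F^o).
Implicit Types (f g h : wfun).

Lemma wfunD f g K : (f + g) K = (f K : F) + g K :> F. Proof. by []. Qed.
Lemma wfunN f K : (- f) K = - (f K : F) :> F. Proof. by []. Qed.
Lemma wfunZ c f K : (c *: f) K = c * (f K : F) :> F. Proof. by []. Qed.
Definition wfunE := (wfunD, wfunN, wfunZ).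

Definition wdeg I : int := \sum_(i <- I) u i.

Lemma wdeg_nil : wdeg [::] = 0. Proof. exact: big_nil. Qed.
Lemma wdeg_cons i I : wdeg (i :: I) = u i + wdeg I. Proof. exact: big_cons. Qed.
Lemma wdeg_cat I J : wdeg (I ++ J) = wdeg I + wdeg J. Proof. exact: big_cat. Qed.
Lemma wdeg1 i : wdeg [:: i] = u i. Proof. exact: big_seq1. Qed.

Definition mulw f g : wfun := fun K =>
  (\sum_(p <- splits K) (f p.1 : F) * g p.2 : F).

(** The Koszul sign is read off the two factors of the word, so this is the graded commutator for
    inhomogeneous f and g too. *)
Definition brw f g : wfun := fun K => (\sum_(p <- splits K)
  ((f p.1 : F) * g p.2 - (-1) ^ (wdeg p.1 * wdeg p.2) * ((g p.1 : F) * f p.2)) : F).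

Lemma brw_def f g K : brw f g K = \sum_(p <- splits K)
  ((f p.1 : F) * g p.2 - (-1) ^ (wdeg p.1 * wdeg p.2) * ((g p.1 : F) * f p.2)) :> F.
Proof. by []. Qed.

Definition genw i : wfun := fun K => if K == [:: i] then 1 else 0.

(** The sign picked up by f when something of degree m moves past it. *)
Definition twist (m : int) f : wfun := fun K => ((-1) ^ (m * wdeg K) * (f K : F) : F).

Definition homw (m : int) f := forall K, wdeg K != m -> f K = 0.

(** Left quotient by a letter; products and derivations are handled by induction on the word through
    it. *)
Definition shiftw i f : wfun := fun K => f (i :: K).

Lemma mulw_nil f g : mulw f g [::] = (f [::] : F) * g [::] :> F.
Proof. by rewrite /mulw /= big_seq1. Qed.

Lemma mulw_cons f g i K :
  mulw f g (i :: K) = (f [::] : F) * g (i :: K) + mulw (shiftw i f) g K :> F.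
Proof. by rewrite /mulw (big_splits_cons i K (fun I J => (f I : F) * g J)). Qed.

Lemma mulwDl f g h : mulw (f + g) h = mulw f h + mulw g h.
Proof.
apply/funext => K; rewrite -[RHS]/(_ K + _ K) /mulw -big_split.
by apply: eq_bigr => p _; rewrite /= mulrDl.
Qed.

Lemma mulwDr f g h : mulw h (f + g) = mulw h f + mulw h g.
Proof.
apply/funext => K; rewrite -[RHS]/(_ K + _ K) /mulw -big_split.
by apply: eq_bigr => p _; rewrite /= mulrDr.
Qed.

Lemma mulwZl c f g : mulw (c *: f) g = c *: mulw f g.
Proof.
apply/funext => K; rewrite -[RHS]/(c * mulw f g K) /mulw big_distrr.
by apply: eq_bigr => p _; rewrite /= mulrA.
Qed.

Lemma mulwZr c f g : mulw f (c *: g) = c *: mulw f g.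
Proof.
apply/funext => K; rewrite -[RHS]/(c * mulw f g K) /mulw big_distrr.
by apply: eq_bigr => p _; rewrite /= mulrCA.
Qed.

Lemma mulwNl f g : mulw (- f) g = - mulw f g.
Proof. by rewrite -scaleN1r mulwZl scaleN1r. Qed.

Lemma mulwNr f g : mulw f (- g) = - mulw f g.
Proof. by rewrite -scaleN1r mulwZr scaleN1r. Qed.

Definition mulwE := (mulwDl, mulwDr, mulwNl, mulwNr, mulwZl, mulwZr).

Lemma shiftw_mulw i f g :
  shiftw i (mulw f g) = f [::] *: shiftw i g + mulw (shiftw i f) g.
Proof. by apply/funext => K; rewrite /shiftw mulw_cons. Qed.

Lemma mulwA f g h : mulw f (mulw g h) = mulw (mulw f g) h.
Proof.
apply/funext => K; elim: K f g h => [|i K IH] f g h.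
  by rewrite !mulw_nil mulrA.
rewrite mulw_cons IH [RHS]mulw_cons mulw_nil shiftw_mulw mulwDl mulwZl mulw_cons.
rewrite -[(_ + _) K]/(f [::] * mulw (shiftw i g) h K + _) mulrDr addrA.
by rewrite (mulrA (f [::])).
Qed.

Lemma brwDl f g h : brw (f + g) h = brw f h + brw g h.
Proof.
apply/funext => K; rewrite -[RHS]/(_ K + _ K) /brw -big_split.
by apply: eq_bigr => p _; rewrite /= mulrDl !mulrDr opprD addrACA.
Qed.

Lemma brwDr f g h : brw h (f + g) = brw h f + brw h g.
Proof.
apply/funext => K; rewrite -[RHS]/(_ K + _ K) /brw -big_split.
by apply: eq_bigr => p _; rewrite /= mulrDl !mulrDr opprD addrACA.
Qed.

Lemma brwZl c f g : brw (c *: f) g = c *: brw f g.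
Proof.
apply/funext => K; rewrite -[RHS]/(c * brw f g K) /brw big_distrr.
apply: eq_bigr => p _; rewrite -[(c *: f) _]/(c * f _) -[(c *: f) p.2]/(c * f _) /=.
by ring.
Qed.

Lemma brwZr c f g : brw f (c *: g) = c *: brw f g.
Proof.
apply/funext => K; rewrite -[RHS]/(c * brw f g K) /brw big_distrr.
apply: eq_bigr => p _; rewrite -[(c *: g) p.1]/(c * g _) -[(c *: g) _]/(c * g _) /=.
by ring.
Qed.

Lemma brw_bilin : bilin brw.
Proof. split=> f c x y /=; first by rewrite brwDr brwZr.
by rewrite brwDl brwZl. Qed.

Lemma homw_mulw m n f g : homw m f -> homw n g -> homw (m + n) (mulw f g).
Proof.
move=> fm gn K Kd; rewrite /mulw big_seq big1 // => p /splits_cat pK.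
have [pm|/fm->] := eqVneq (wdeg p.1) m; last exact: mul0r.
rewrite gn ?mulr0 //; apply: contraNneq Kd => <-.
by rewrite -pm -wdeg_cat pK.
Qed.

Lemma twist_hom m n f : homw n f -> twist m f = (-1) ^ (m * n) *: f.
Proof.
move=> fn; apply/funext => K; rewrite /twist -[RHS]/(_ * f K).
by have [->//|/fn->] := eqVneq (wdeg K) n; rewrite !mulr0.
Qed.

Lemma twistD m f g : twist m (f + g) = twist m f + twist m g.
Proof. by apply/funext => K; rewrite /twist /= mulrDr. Qed.

Lemma twistN m f : twist m (- f) = - twist m f.
Proof. by apply/funext => K; rewrite /twist /= mulrN. Qed.

Lemma twist_mulw m f g : twist m (mulw f g) = mulw (twist m f) (twist m g).
Proof.
apply/funext => K; rewrite /twist /mulw big_distrr /= !big_seq.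
apply: eq_bigr => p /splits_cat <-; rewrite wdeg_cat mulrDr signzD.
by rewrite !mulrA; congr (_ * _); rewrite mulrAC.
Qed.

Lemma twist_twist m n f : twist m (twist n f) = twist (m + n) f.
Proof. by apply/funext => K; rewrite /twist mulrA -signzD -mulrDl. Qed.

(** Wherever f does not vanish the second factor has degree m, so the sign can be moved onto g. *)
Lemma brwE m f g : homw m f -> brw f g = mulw f g - mulw (twist m g) f.
Proof.
move=> fm; apply/funext => K; rewrite -[RHS]/(_ K - _ K) /brw /mulw -sumrB.
apply: eq_bigr => p _; rewrite /twist.
have [->|/fm->] := eqVneq (wdeg p.2) m; last by rewrite !mulr0.
by rewrite mulrA (mulrC m).
Qed.

Lemma homwD m f g : homw m f -> homw m g -> homw m (f + g).
Proof. by move=> fm gm K Kd; rewrite -[LHS]/(f K + g K) fm ?gm ?addr0. Qed.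

Lemma homwZ m c f : homw m f -> homw m (c *: f).
Proof. by move=> fm K Kd; rewrite -[LHS]/(c * f K) fm ?mulr0. Qed.

Lemma homw_twist m n f : homw n f -> homw n (twist m f).
Proof. by move=> fn K Kd; rewrite /twist fn ?mulr0. Qed.

Lemma homw_brw m n f g : homw m f -> homw n g -> homw (m + n) (brw f g).
Proof.
move=> fm gn; rewrite (brwE g fm); apply: homwD; first exact: homw_mulw.
rewrite -scaleN1r addrC; apply/homwZ/homw_mulw => //; exact: homw_twist.
Qed.

Lemma homw_gen i : homw (u i) (genw i).
Proof.
by move=> K; rewrite /genw; case: (K =P _) => // ->; rewrite wdeg1 eqxx.
Qed.

Lemma brw_anti m n f g : homw m f -> homw n g ->
  brw f g = - ((-1) ^ (m * n) *: brw g f).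
Proof.
move=> fm gn; rewrite (brwE g fm) (brwE f gn) (twist_hom _ fm) (twist_hom _ gn).
rewrite !mulwE scalerBr scalerA mulrC (mulrC n) signzMK scale1r opprB.
by congr (_ - _); rewrite ?mul1r.
Qed.

(** Both sides expand into associative triple products; h may be inhomogeneous because its signs are
    carried by [twist]. *)
Lemma brw_jacobi m n f g h : homw m f -> homw n g ->
  brw (brw f g) h = brw f (brw g h) - (-1) ^ (m * n) *: brw g (brw f h).
Proof.
move=> fm gn.
rewrite (brwE h (homw_brw fm gn)) (brwE g fm) (brwE _ fm) (brwE h gn) (brwE _ gn).
rewrite (brwE h fm) !(twistD, twistN, twist_mulw, twist_twist).
rewrite !(twist_hom _ fm, twist_hom _ gn, mulwE, scalerBr, scalerN, scalerA).
rewrite !(mulrC n m) !(addrC n m) signzMK !scale1r !mulwA.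
apply/funext => K.
by rewrite !wfunE; ring.
Qed.

End WordFunctions.

Lemma lin0 (F : fieldType) (M N : lmodType F) (f : M -> N) : linear f -> f 0 = 0.
Proof. by move=> fl; have := linZ 0 0 fl; rewrite !scale0r. Qed.

Lemma linN (F : fieldType) (M N : lmodType F) (f : M -> N) x :
  linear f -> f (- x) = - f x.
Proof. by move=> fl; rewrite -scaleN1r (linZ _ _ fl) scaleN1r. Qed.

Lemma lin_sum (F : fieldType) (M N : lmodType F) (f : M -> N)
    (I : Type) (s : seq I) (P : pred I) (G : I -> M) : linear f ->
  f (\sum_(i <- s | P i) G i) = \sum_(i <- s | P i) f (G i).
Proof.
by move=> fl; apply: (big_morph f) => [x y|]; [exact: linD|exact: lin0].
Qed.

Lemma bilin0l (F : fieldType) (B M U : lmodType F) (f : B -> M -> U) y :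
  bilin f -> f 0 y = 0.
Proof. by move=> [_ fl]; exact: lin0 (fl y). Qed.

Lemma bilin0r (F : fieldType) (B M U : lmodType F) (f : B -> M -> U) x :
  bilin f -> f x 0 = 0.
Proof. by move=> [fr _]; exact: lin0 (fr x). Qed.

Lemma bilinDl (F : fieldType) (B M U : lmodType F) (f : B -> M -> U) x y z :
  bilin f -> f (x + y) z = f x z + f y z.
Proof. by move=> [_ fl]; exact: linD (fl z). Qed.

Lemma bilinDr (F : fieldType) (B M U : lmodType F) (f : B -> M -> U) x y z :
  bilin f -> f z (x + y) = f z x + f z y.
Proof. by move=> [fr _]; exact: linD (fr z). Qed.

Lemma bilinZl (F : fieldType) (B M U : lmodType F) (f : B -> M -> U) c x y :
  bilin f -> f (c *: x) y = c *: f x y.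
Proof. by move=> [_ fl]; exact: linZ (fl y). Qed.

Lemma bilinZr (F : fieldType) (B M U : lmodType F) (f : B -> M -> U) c x y :
  bilin f -> f x (c *: y) = c *: f x y.
Proof. by move=> [fr _]; exact: linZ (fr x). Qed.

Lemma bilinNl (F : fieldType) (B M U : lmodType F) (f : B -> M -> U) x y :
  bilin f -> f (- x) y = - f x y.
Proof. by move=> fb; rewrite -scaleN1r (bilinZl _ _ _ fb) scaleN1r. Qed.

Lemma bilinNr (F : fieldType) (B M U : lmodType F) (f : B -> M -> U) x y :
  bilin f -> f x (- y) = - f x y.
Proof. by move=> fb; rewrite -scaleN1r (bilinZr _ _ _ fb) scaleN1r. Qed.

Lemma bilin_suml (F : fieldType) (B M U : lmodType F) (f : B -> M -> U)
    (I : Type) (s : seq I) (P : pred I) (G : I -> B) y : bilin f ->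
  f (\sum_(i <- s | P i) G i) y = \sum_(i <- s | P i) f (G i) y.
Proof.
move=> fb; apply: (big_morph (fun x => f x y)); last exact: bilin0l.
by move=> a b; exact: bilinDl.
Qed.

Lemma bilin_sumr (F : fieldType) (B M U : lmodType F) (f : B -> M -> U)
    (I : Type) (s : seq I) (P : pred I) (G : I -> M) x : bilin f ->
  f x (\sum_(i <- s | P i) G i) = \sum_(i <- s | P i) f x (G i).
Proof.
move=> fb; apply: (big_morph (f x)); last exact: bilin0r.
by move=> a b; exact: bilinDr.
Qed.

(** * Nested brackets and Lie functions *)

Section Nested.
Variables (F : fieldType) (T : finType).

Fixpoint nest (U : lmodType F) (br : U -> U -> U) (t : T -> U) (I : seq T) : U :=
  match I with
  | [::] => 0
  | [:: i] => t i
  | i :: I' => br (t i) (nest br t I')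
  end.

Definition adw (U : lmodType F) (br : U -> U -> U) (t : T -> U) (I : seq T)
  (z : U) : U := foldr (fun i => br (t i)) z I.

Lemma nest_cons (U : lmodType F) (br : U -> U -> U) t i I :
  I != [::] -> nest br t (i :: I) = br (t i) (nest br t I).
Proof. by case: I. Qed.

Lemma nest_cat (U : lmodType F) (br : U -> U -> U) t I J :
  J != [::] -> nest br t (I ++ J) = adw br t I (nest br t J).
Proof.
move=> J0; elim: I => //= i I <-.
by rewrite -nest_cons; case: I => //; case: J J0.
Qed.

Lemma nest_rcons (U : lmodType F) (br : U -> U -> U) t I i :
  nest br t (rcons I i) = adw br t I (t i).
Proof. by rewrite -cats1 nest_cat. Qed.

Lemma adw_rcons (U : lmodType F) (br : U -> U -> U) t I i z :
  adw br t (rcons I i) z = adw br t I (br (t i) z).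
Proof. exact: foldr_rcons. Qed.

Lemma adw_linear (U : lmodType F) (br : U -> U -> U) t I :
  bilin br -> linear (adw br t I).
Proof.
by move=> brb; elim: I => // i I IH c x y; rewrite /= IH (brb.1 (t i)).
Qed.

Lemma adw_sum (U : lmodType F) (br : U -> U -> U) t I
    (X : Type) (s : seq X) (P : pred X) (G : X -> U) : bilin br ->
  adw br t I (\sum_(i <- s | P i) G i) = \sum_(i <- s | P i) adw br t I (G i).
Proof.
move=> brb; elim: I => // i I /= ->; exact: bilin_sumr.
Qed.

Variable u : T -> int.
Local Notation wfun := (seq T -> F^o).
Local Notation genw := (@genw F T).
Local Notation brw := (@brw F T u).

(** [wb I K] is the coefficient of the word K in the nested bracket of generators along I. As a
    matrix on words of a given length, its square is that length times itself, see [wb_wb]. *)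
Definition wb (I : seq T) : wfun := nest brw genw I.

Lemma mulw_genl i (g : wfun) j K :
  mulw (genw i) g (j :: K) = (if j == i then g K else 0) :> F.
Proof.
rewrite mulw_cons {1}/genw /= mul0r add0r.
case: K => [|l K].
  by rewrite mulw_nil /shiftw /genw eqseq_cons andbT; case: eqP; rewrite ?mul1r ?mul0r.
rewrite mulw_cons /shiftw {1}/genw eqseq_cons andbT.
rewrite (_ : mulw _ _ _ = 0).
  by case: eqP; rewrite ?mul1r ?mul0r addr0.
rewrite /mulw big1 // => p _; rewrite /genw.
by rewrite !eqseq_cons andbF mul0r.
Qed.

Lemma mulw_genr i (g : wfun) j K :
  mulw g (genw i) (rcons K j) = (if j == i then g K else 0) :> F.
Proof.
rewrite /mulw (big_splits_rcons K j (fun I J => (g I : F) * genw i J)).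
rewrite {2}/genw /= mulr0 addr0.
elim: K g => [|l K IH] g.
  rewrite (big_splits_nil (fun I J => (g I : F) * genw i (rcons J j))) /genw.
  by rewrite eqseq_cons andbT; case: eqP; rewrite ?mulr1 ?mulr0.
rewrite (big_splits_cons l K (fun I J => (g I : F) * genw i (rcons J j))).
rewrite (IH (fun I => g (l :: I))) /genw eqseq_cons.
by case: K {IH} => [|? ?]; rewrite andbF mulr0 add0r.
Qed.

(** Transpose of the bracket with a generator: it puts i before or, with a sign, after the words of
    g. *)
Lemma big_brw_gen (U : lmodType F) k i (g : wfun) (G : seq T -> U) :
  \sum_(K <- words T k.+1) brw (genw i) g K *: G K =
  \sum_(K <- words T k)
    g K *: (G (i :: K) - (-1) ^ (u i * wdeg u K) *: G (rcons K i)).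
Proof.
under eq_bigr do rewrite (brwE _ (@homw_gen F T u i)) !wfunE scalerBl.
rewrite sumrB big_wordsS big_words_rcons.
under [RHS]eq_bigr do rewrite scalerBr.
rewrite sumrB; congr (_ - _).
  rewrite (bigD1 i) //= [X in _ + X]big1 ?addr0 => [|j ji].
    by apply: eq_bigr => K _; rewrite mulw_genl eqxx.
  by rewrite big1 // => K _; rewrite mulw_genl (negPf ji) scale0r.
apply: eq_bigr => K _; rewrite (bigD1 i) //= [X in _ + X]big1 ?addr0 => [|j ji].
  by rewrite mulw_genr eqxx /twist mulrC scalerA.
by rewrite mulw_genr (negPf ji) scale0r.
Qed.

Lemma wb_size I K : size K != size I -> wb I K = 0.
Proof.
elim: I K => // i I IH K; rewrite /wb.
have [->|I0] := eqVneq I [::].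
  by rewrite /= /genw; case: (K =P _) => // ->.
rewrite nest_cons // (brwE _ (@homw_gen F T u i)) !wfunE => Ks.
case/lastP: K Ks => [|K j]; first by rewrite !mulw_nil /twist /genw /= mul0r mulr0 subr0.
rewrite mulw_genr size_rcons eqSS => Ks; rewrite /twist.
rewrite -/(wb I) (IH _ Ks) mulr0 if_same subr0.
have : size (rcons K j) != (size I).+1 by rewrite size_rcons.
case: (rcons K j) => [|l K'] /=; first by rewrite mulw_nil /genw mul0r.
by rewrite eqSS => /IH; rewrite mulw_genl => ->; rewrite if_same.
Qed.

Lemma wb_hom I : homw u (wdeg u I) (wb I).
Proof.
elim: I => // i I IH; rewrite /wb.
have [->|I0] := eqVneq I [::]; first by rewrite wdeg1; exact: homw_gen.
by rewrite nest_cons // wdeg_cons; apply: homw_brw => //; exact: homw_gen.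
Qed.

Section Target.
Variables (U : lmodType F) (br : U -> U -> U) (t : T -> U).
Hypothesis brb : bilin br.
Local Notation tb := (nest br t).
Local Notation ad := (adw br t).
(** The axioms are asked for only between a generator and a nested bracket, z being arbitrary. They
    then hold for word functions, and in a DGL as soon as each [t i] is homogeneous of degree
    [u i]. *)
Hypothesis br_jac : forall i I z, I != [::] ->
  br (br (t i) (tb I)) z = br (t i) (br (tb I) z)
    - (-1) ^ (u i * wdeg u I) *: br (tb I) (br (t i) z).
Hypothesis br_anti : forall i I, I != [::] ->
  br (tb I) (t i) = - ((-1) ^ (u i * wdeg u I) *: br (t i) (tb I)).

Lemma big_words_wb (G : seq T -> U) i I : I != [::] ->
  \sum_(K <- words T (size I).+1) wb (i :: I) K *: G K =
  \sum_(K <- words T (size I)) wb I K *: G (i :: K)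
  - (-1) ^ (u i * wdeg u I) *:
     \sum_(K <- words T (size I)) wb I K *: G (rcons K i).
Proof.
move=> I0; rewrite /wb nest_cons // big_brw_gen scaler_sumr -sumrB.
apply: eq_bigr => K _; rewrite scalerBr !scalerA.
have [->|/wb_hom wb0] := eqVneq (wdeg u K) (wdeg u I); first by rewrite mulrC.
by rewrite -/(wb I) wb0 mulr0 !mul0r !scale0r.
Qed.

(** By the Jacobi identity the adjoint action turns brackets into commutators, hence a nested
    bracket acts through its associative expansion. *)
Lemma br_nest I z :
  br (tb I) z = \sum_(J <- words T (size I)) wb I J *: ad J z.
Proof.
elim: I z => [|i I IH] z.
  by rewrite big_words0 scale0r bilin0l.
have [->|I0] := eqVneq I [::].
  rewrite big_words1 (bigD1 i) //= big1 => [|j ji].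
    by rewrite /wb /= /genw eqxx scale1r addr0.
  by rewrite /wb /= /genw eqseq_cons (negPf ji) scale0r.
rewrite nest_cons // br_jac // big_words_wb // !IH (bilin_sumr _ _ _ _ brb).
congr (_ - _); first by apply: eq_bigr => J _; rewrite bilinZr.
by congr (_ *: _); apply: eq_bigr => J _; rewrite adw_rcons.
Qed.

(* The Dynkin-Specht-Wever identity. *)
Lemma nest_wb I :
  \sum_(J <- words T (size I)) wb I J *: tb J = (size I)%:R *: tb I.
Proof.
elim: I => [|i I IH]; first by rewrite big_words0 !scaler0.
have [->|I0] := eqVneq I [::].
  rewrite big_words1 (bigD1 i) //= big1 => [|j ji].
    by rewrite /wb /= /genw eqxx addr0.
  by rewrite /wb /= /genw eqseq_cons (negPf ji) scale0r.
rewrite big_words_wb //.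
(* The words ending in i add up to the bracket of [tb I] with [t i], which antisymmetry turns into
   one more copy of the nested bracket along [i :: I]; the words beginning with i give |I| copies by
   induction. *)
under [X in _ - _ *: X]eq_bigr do rewrite nest_rcons.
rewrite -br_nest br_anti // scalerN scalerA signzMK scale1r opprK.
rewrite (@eq_big_words _ _ _ _ _ _ (fun K => br (t i) (wb I K *: tb K))); last first.
  move=> K Ks; rewrite bilinZr // nest_cons //.
  by case: K Ks => //; case: (I) I0.
rewrite -bilin_sumr // IH bilinZr // -nest_cons // -[(size (i :: I))]addn1.
by rewrite natrD scalerDl scale1r.
Qed.

End Target.

Lemma wb_jac i I (z : wfun) :
  brw (brw (genw i) (wb I)) z = brw (genw i) (brw (wb I) z)
    - (-1) ^ (u i * wdeg u I) *: brw (wb I) (brw (genw i) z).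
Proof. by apply: brw_jacobi; [exact: homw_gen|exact: wb_hom]. Qed.

Lemma wb_anti i I :
  brw (wb I) (genw i) = - ((-1) ^ (u i * wdeg u I) *: brw (genw i) (wb I)).
Proof. by rewrite mulrC; apply: brw_anti; [exact: wb_hom|exact: homw_gen]. Qed.

Lemma wb_wb I K :
  \sum_(J <- words T (size I)) (wb I J : F) * wb J K = (size I)%:R * (wb I K : F).
Proof.
have := @nest_wb wfun brw genw (@brw_bilin F T u) (fun i I z _ => wb_jac i I z)
  (fun i I _ => wb_anti i I) I.
move=> /(congr1 (fun f : wfun => f K)).
by rewrite fct_sumE.
Qed.

End Nested.

(** * Lie series as fixed points of the Dynkin projection *)

Section LieFunctions.
Variables (F : fieldType) (T : finType) (u : T -> int).
Hypothesis char0 : [pchar F] =i pred0.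
Implicit Types (i j : T) (I J K : seq T).
Local Notation wfun := (seq T -> F^o).
Implicit Types (f g c : wfun).
Local Notation wb := (@wb F T u).
Local Notation brw := (@brw F T u).
Local Notation genw := (@genw F T).
Local Notation twist := (@twist F T u).
Local Notation homw := (@homw F T u).
Local Notation wdeg := (@wdeg T u).

(* f is the combination of the nested brackets [wb I] with coefficients c I. *)
Definition rep c f := forall J,
  f J = \sum_(I <- words T (size J)) (c I : F) * wb I J :> F.

(** The coefficients used for a Lie series; they vanish on the empty word because 0^-1 = 0. *)
Definition dynk f : wfun := fun I => (((size I)%:R^-1 : F) * (f I : F) : F).

(* By the Dynkin-Specht-Wever identity this holds for Lie polynomials, and
   conversely it exhibits f as one. *)
Definition liew f := rep (dynk f) f.

Lemma dynk_nil f : dynk f [::] = 0.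
Proof. by rewrite /dynk invr0 mul0r. Qed.

Lemma natr_neq0 n : n != 0%N -> n%:R != 0 :> F.
Proof. by move/pcharf0P: char0 => ->. Qed.

(** Whatever the coefficients c, [wb_wb] shows that replacing them by those of [dynk] reproduces
    f. *)
Lemma rep_lie c f : rep c f -> liew f.
Proof.
move=> cf J; rewrite (@eq_big_words _ _ _ _ _ _ (fun I =>
  ((size J)%:R^-1 : F) * \sum_(H <- words T (size J)) (c H : F) * wb H I * wb I J)); last first.
  by move=> I IJ; rewrite /dynk IJ cf IJ -mulrA -mulr_suml /= mulrA.
rewrite /= -mulr_sumr exchange_big /= cf.
have [->|J0] := eqVneq J [::]; first by rewrite !big_words0 /= invr0 mul0r mulr0.
rewrite [in RHS](@eq_big_words _ _ _ _ _ _ (fun H =>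
   (size J)%:R * ((c H : F) * wb H J))); last first.
  move=> H HJ; rewrite -HJ mulrCA -wb_wb mulr_sumr /=.
  by apply: eq_bigr => I _; rewrite mulrA.
by rewrite /= -mulr_sumr mulKf // natr_neq0 // size_eq0.
Qed.

Lemma liew0 : liew 0.
Proof. by move=> J; rewrite big1 // => I _; rewrite /dynk mulr0 mul0r. Qed.

Lemma liewD f g : liew f -> liew g -> liew (f + g).
Proof.
move=> fl gl J; rewrite wfunE fl gl -big_split; apply: eq_bigr => I _ /=.
by rewrite -mulrDl /dynk -mulrDr.
Qed.

Lemma liewZ a f : liew f -> liew (a *: f).
Proof.
move=> fl J; rewrite wfunE fl mulr_sumr; apply: eq_bigr => I _ /=.
by rewrite /dynk mulrA (mulrCA a).
Qed.

(** Different lengths do not mix in [liew], so the condition passes from Lie polynomials to their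
    limits. *)
Lemma liew_local f :
  (forall k, exists2 g, liew g & forall J, size J = k -> f J = g J) -> liew f.
Proof.
move=> fP J; have [g gl fg] := fP (size J); rewrite fg // gl.
by apply: eq_big_words => I IJ; rewrite /dynk fg.
Qed.

Lemma rep_wb I : rep (fun J => if J == I then 1 else 0) (wb I).
Proof.
move=> J; have [IJ|/wb_size JI] := eqVneq (size J) (size I).
  rewrite IJ -[LHS](@big_words_pred1 _ _ I (fun H => wb H J)).
  by apply: eq_bigr => H _; case: eqP => _; rewrite ?mul1r ?mul0r.
rewrite JI big_seq big1 // => H /words_size HJ.
by have [->|_] := eqVneq; rewrite ?mul0r // JI mulr0.
Qed.

Lemma liew_wb I : liew (wb I).
Proof. exact: rep_lie (rep_wb I). Qed.

Section Target.
Variables (U : lmodType F) (br : U -> U -> U) (t : T -> U).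
Hypothesis brb : bilin br.
Local Notation tb := (nest br t).
Local Notation ad := (adw br t).
Hypothesis br_jac : forall i I z, I != [::] ->
  br (br (t i) (tb I)) z = br (t i) (br (tb I) z)
    - (-1) ^ (u i * wdeg I) *: br (tb I) (br (t i) z).
Hypothesis br_anti : forall i I, I != [::] ->
  br (tb I) (t i) = - ((-1) ^ (u i * wdeg I) *: br (t i) (tb I)).

Definition evalk k c : U := \sum_(I <- words T k) c I *: tb I.

(** Nested brackets being dependent, f has many systems of coefficients; by the Dynkin-Specht-Wever
    identity in U they all have the same value. *)
Lemma evalk_dynk k c f : rep c f -> evalk k (dynk f) = evalk k c.
Proof.
move=> cf; rewrite /evalk.
case: k => [|k]; first by rewrite !big_words0 !scaler0.
rewrite (@eq_big_words _ _ _ _ _ _ (fun J => k.+1%:R^-1 *: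
    \sum_(I <- words T k.+1) (c I * wb I J) *: tb J)); last first.
  by move=> J Jk; rewrite /dynk cf Jk -scalerA scaler_suml.
rewrite /= -scaler_sumr exchange_big /=.
rewrite (@eq_big_words _ _ _ _ _ _ (fun I => k.+1%:R *: (c I *: tb I))); last first.
  move=> I Ik; under eq_bigr do rewrite -scalerA.
  rewrite -scaler_sumr -Ik (nest_wb brb br_jac br_anti).
  by rewrite !scalerA mulrC.
by rewrite /= -scaler_sumr scalerA mulVf ?scale1r // natr_neq0.
Qed.

(** Through products of adjoint maps, a Lie function acts as the bracket with its own value. *)
Lemma adw_lie k f z : liew f ->
  \sum_(H <- words T k) f H *: ad H z = br (evalk k (dynk f)) z.
Proof.
move=> fl; rewrite /evalk bilin_suml //.
rewrite (@eq_big_words _ _ _ _ _ _ (fun H =>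
    \sum_(I <- words T k) ((dynk f I : F) * wb I H) *: ad H z)); last first.
  by move=> H Hk; rewrite {1}fl Hk scaler_suml.
rewrite exchange_big; apply: eq_big_words => I Ik /=.
rewrite bilinZl // (br_nest brb br_jac) scaler_sumr Ik.
by apply: eq_bigr => H _; rewrite scalerA.
Qed.

(** The nested bracket along [I ++ J] is [adw] along I of the one along J, so concatenating f with
    the coefficients c gives coefficients of a bracket. The empty word must be excluded from c,
    since [nest_cat] fails there. *)
Lemma evalk_mulw k c f : liew f -> c [::] = 0 ->
  evalk k (mulw f c) =
  \sum_(a < k.+1) br (evalk a (dynk f)) (evalk (k - a) c).
Proof.
move=> fl c0; rewrite {1}/evalk.
rewrite (@eq_big_words _ _ _ _ _ _ (fun K => \sum_(p <- splits K)
    ((f p.1 : F) * c p.2) *: tb (p.1 ++ p.2))); last first.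
  move=> K _; rewrite /mulw scaler_suml !big_seq.
  by apply: eq_bigr => p /splits_cat ->.
rewrite /= (big_words_splits _ (fun I J => ((f I : F) * c J) *: tb (I ++ J))).
apply: eq_bigr => a _; rewrite -adw_lie //; apply: eq_bigr => H _.
rewrite /evalk adw_sum // scaler_sumr; apply: eq_bigr => J _.
rewrite (linZ _ _ (adw_linear _ _ brb)) scalerA.
by have [->|J0] := eqVneq J [::]; rewrite ?c0 ?mulr0 ?scale0r // nest_cat.
Qed.

End Target.

Local Notation evalw := (evalk brw genw).

Lemma evalw_rep k c f K :
  rep c f -> evalw k c K = (if size K == k then f K else 0) :> F.
Proof.
move=> fl; rewrite /evalk fct_sumE; case: eqP => [<-|/eqP Kk].
  by rewrite [RHS]fl.
by rewrite big_seq big1 // => I /words_size Ik; rewrite wfunE -/(wb _) wb_size ?mulr0 ?Ik.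
Qed.

(** This is [evalk_mulw] with word functions as target, where the value of f in length k is its own
    part of that length. *)
Lemma rep_brw c f g :
  liew f -> rep c g -> c [::] = 0 -> rep (mulw f c) (brw f g).
Proof.
move=> fl gc c0 K; transitivity (evalw (size K) (mulw f c) K); last first.
  by rewrite /evalk fct_sumE.
rewrite (evalk_mulw (@brw_bilin F T u) (fun i I z _ => wb_jac u i I z)) //.
rewrite fct_sumE.
under eq_bigr do rewrite brw_def.
rewrite brw_def exchange_big /= !big_seq; apply: eq_bigr => p /splits_size sp.
rewrite sumrB -mulr_sumr; congr (_ - _ * _).
  have p1 : (size p.1 < (size K).+1)%N by rewrite -sp ltnS leq_addr.
  rewrite (bigD1 (Ordinal p1)) //= big1 => [|a ap].
    by rewrite (evalw_rep _ _ fl) (evalw_rep _ _ gc) -sp addKn !eqxx addr0.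
  by rewrite (evalw_rep _ _ fl) -val_eqE /= eq_sym in ap *; rewrite (negPf ap) mul0r.
have p2 : (size p.2 < (size K).+1)%N by rewrite -sp ltnS leq_addl.
rewrite (bigD1 (Ordinal p2)) //= big1 => [|a ap].
  by rewrite (evalw_rep _ _ fl) (evalw_rep _ _ gc) -sp addnK !eqxx addr0 mulrC.
by rewrite mulrC (evalw_rep _ _ fl) -val_eqE /= eq_sym in ap *; rewrite (negPf ap) mul0r.
Qed.

Lemma liew_brw f g : liew f -> liew g -> liew (brw f g).
Proof.
by move=> fl gl; apply: rep_lie; exact: (rep_brw fl gl (dynk_nil g)).
Qed.

End LieFunctions.

(** * Derivations of the completed tensor algebra *)

Section Derivation.
Variables (F : fieldType) (T : finType) (u : T -> int).
Hypothesis char0 : [pchar F] =i pred0.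
Implicit Types (i j : T) (I J K : seq T).
Local Notation wfun := (seq T -> F^o).
Implicit Types (f g c : wfun).
Local Notation wb := (@wb F T u).
Local Notation brw := (@brw F T u).
Local Notation genw := (@genw F T).
Local Notation twist := (@twist F T u).
Local Notation homw := (@homw F T u).
Local Notation wdeg := (@wdeg T u).
Local Notation mulw := (@mulw F T).
Local Notation liew := (@liew F T u).

Variable d : T -> wfun.
Hypothesis d0 : forall i, d i [::] = 0.

(* The derivation of the completed tensor algebra with value [d i] on the
   generator i: on i (x) t it is d_i t + (-1)^{|i|} i (x) (derivation of t). *)
Fixpoint sdw f (K : seq T) : F^o :=
  match K with
  | [::] => 0
  | j :: K' => (\sum_i (mulw (d i) (shiftw i f) K : F)
      + (-1) ^ u j * (sdw (shiftw j f) K' : F) : F)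
  end.

Lemma sdw_cons f j K : sdw f (j :: K) =
  \sum_i (mulw (d i) (shiftw i f) (j :: K) : F)
  + (-1) ^ u j * (sdw (shiftw j f) K : F) :> F.
Proof. by []. Qed.

Lemma sdwD f g : sdw (f + g) = sdw f + sdw g.
Proof.
apply/funext => K; elim: K f g => [|j K IH] f g; first by rewrite wfunE /= addr0.
rewrite wfunE !sdw_cons (IH (shiftw j f) (shiftw j g)) wfunE mulrDr addrACA.
rewrite -big_split; congr (_ + _); apply: eq_bigr => i _.
by rewrite -[shiftw i (f + g)]/(shiftw i f + shiftw i g) mulwDr.
Qed.

Lemma sdwZ a f : sdw (a *: f) = a *: sdw f.
Proof.
apply/funext => K; elim: K f => [|j K IH] f; first by rewrite wfunE /= mulr0.
rewrite wfunE !sdw_cons (IH (shiftw j f)) wfunE mulrDr mulrCA mulr_sumr.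
congr (_ + _); apply: eq_bigr => i _.
by rewrite -[shiftw i (a *: f)]/(a *: shiftw i f) mulwZr wfunE.
Qed.

Lemma sdw0 : sdw 0 = 0.
Proof. by have := sdwZ 0 0; rewrite !scale0r. Qed.

Lemma sdw_sum (X : Type) (s : seq X) (P : pred X) (f : X -> wfun) :
  sdw (\sum_(x <- s | P x) f x) = \sum_(x <- s | P x) sdw (f x).
Proof.
exact: (big_morph _ sdwD sdw0).
Qed.

Lemma sdwB f g : sdw (f - g) = sdw f - sdw g.
Proof. by rewrite sdwD -scaleN1r sdwZ scaleN1r. Qed.

Lemma twist1_shiftw j f : shiftw j (twist 1 f) = (-1) ^ u j *: twist 1 (shiftw j f).
Proof.
apply/funext => K; rewrite /shiftw /twist wfunE wdeg_cons !mul1r signzD.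
by rewrite mulrA.
Qed.

(** [twist 1] is the sign of the derivation passing f. The terms in which some [d i] contributes the
    empty word vanish by [d0]. *)
Lemma sdw_mulw f g :
  sdw (mulw f g) = mulw (sdw f) g + mulw (twist 1 f) (sdw g).
Proof.
apply/funext => K; elim: K f g => [|j K IH] f g.
  by rewrite wfunE !mulw_nil mul0r mulr0 addr0.
rewrite wfunE sdw_cons shiftw_mulw sdwD sdwZ !wfunE IH wfunE.
under eq_bigr do rewrite shiftw_mulw mulwDr mulwZr mulwA !wfunE.
rewrite big_split /= -mulr_sumr.
rewrite [mulw (sdw f) g _]mulw_cons [mulw (twist 1 f) _ _]mulw_cons.
rewrite twist1_shiftw mulwZl wfunE.
have -> : shiftw j (sdw f) =
    shiftw j (\sum_i mulw (d i) (shiftw i f)) + (-1) ^ u j *: sdw (shiftw j f).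
  by apply/funext => H; rewrite wfunE /shiftw sdw_cons fct_sumE.
rewrite mulwDl mulwZl !wfunE.
have -> : \sum_i (mulw (mulw (d i) (shiftw i f)) g (j :: K) : F) =
    \sum_i (mulw (d i) (shiftw i f) [::] : F) * g (j :: K) +
    mulw (shiftw j (\sum_i mulw (d i) (shiftw i f))) g K.
  under eq_bigr do rewrite mulw_cons.
  rewrite big_split /=; congr (_ + _).
  have -> : shiftw j (\sum_i mulw (d i) (shiftw i f)) =
      \sum_i shiftw j (mulw (d i) (shiftw i f)).
    by rewrite /shiftw fct_sumE; apply/funext => H; rewrite fct_sumE.
  rewrite (big_morph (fun h => mulw h g) (id1 := 0) (op1 := +%R)); last first.
  - by have := mulwZl 0 0 g; rewrite !scale0r.
  - by move=> x y; exact: mulwDl.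
  by rewrite fct_sumE.
rewrite [X in _ + (X + _) + _]big1 => [|i _]; last first.
  by rewrite mulw_nil d0 !mul0r.
rewrite sdw_cons {2}/twist wdeg_nil mulr0 expr0z mul1r.
rewrite -[sdw f [::]]/(0 : F) mul0r !add0r.
by ring.
Qed.

(** Such an f is a multiple of the unit, and derivations kill the unit. *)
Lemma sdw_unit f : (forall i, shiftw i f = 0) -> sdw f = 0.
Proof.
move=> f0; apply/funext => -[//|j K]; rewrite sdw_cons f0 sdw0 mulr0 addr0 big1 // => i _.
by rewrite f0 /mulw big1 // => p _; rewrite mulr0.
Qed.

Lemma sdw_gen i : sdw (genw i) = d i.
Proof.
apply/funext => -[|j K]; first by rewrite d0.
have gi l : shiftw l (genw i) = if l == i then (fun K => if K is [::] then 1 else 0) else 0.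
  apply/funext => H; rewrite /shiftw /genw eqseq_cons.
  by case: eqP => //= _; case: H.
have unitw (f : wfun) H : mulw f (fun K => if K is [::] then 1 else 0) H = f H.
  rewrite /mulw; elim: H f => [|l H IH] f.
    by rewrite (big_splits_nil (fun I J => (f I : F) * (if J is [::] then 1 else 0 : F))) mulr1.
  rewrite (big_splits_cons l H (fun I J => (f I : F) * (if J is [::] then 1 else 0 : F))).
  by rewrite mulr0 add0r (IH (fun I => f (l :: I))).
rewrite sdw_cons sdw_unit ?mulr0 ?addr0 => [|l]; last first.
  by rewrite gi; case: eqP => // _; apply/funext.
rewrite (bigD1 i) //= gi eqxx unitw big1 ?addr0 // => l li.
by rewrite gi (negPf li) /mulw big1 // => p _; rewrite mulr0.
Qed.

(** As the [d i] have no constant term, the derivation never shortens words. *)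
Lemma sdw_eq f g K :
  (forall J, (size J <= size K)%N -> f J = g J) -> sdw f K = sdw g K.
Proof.
elim: K f g => // j K IH f g fg; rewrite !sdw_cons (IH _ (shiftw j g)); last first.
  by move=> J JK; exact: fg.
congr (_ + _); apply: eq_bigr => i _; rewrite /mulw !big_seq.
apply: eq_bigr => -[[|l I] J] /splits_size /= pK; first by rewrite d0 !mul0r.
  by rewrite /shiftw fg /=; last lia.
Qed.

Hypothesis d_hom : forall i, homw (u i - 1) (d i).

(** Stated for a set D of degrees so as to cover both homogeneous functions and those with finitely
    many degrees. *)
Lemma sdw_supp (D : pred int) f : (forall J, ~~ D (wdeg J) -> f J = 0) ->
  forall K, ~~ D (wdeg K + 1) -> sdw f K = 0.
Proof.
move=> fD K; elim: K D f fD => // j K IH D f fD Kd.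
rewrite sdw_cons big1 ?add0r => [|i _].
  rewrite (IH (fun q => D (u j + q))) ?mulr0 //.
  - by move=> J Jd; apply: fD; rewrite wdeg_cons.
  - by rewrite addrA -wdeg_cons.
rewrite /mulw big_seq big1 // => p /splits_cat pK.
have [p1|/d_hom->] := eqVneq (wdeg p.1) (u i - 1); last by rewrite mul0r.
rewrite /shiftw fD ?mulr0 // wdeg_cons; move: Kd.
by rewrite -pK wdeg_cat p1 addrAC subrK.
Qed.

Lemma homw_sdw m f : homw m f -> homw (m - 1) (sdw f).
Proof.
move=> fm K Kd; apply: (@sdw_supp (pred1 m)) => [J /fm //|].
by apply: contra Kd => /eqP <-; rewrite addrK.
Qed.

Lemma sdw_brw i m g : homw m g ->
  sdw (brw (genw i) g) = brw (d i) g + (-1) ^ u i *: brw (genw i) (sdw g).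
Proof.
move=> gm; have gi := @homw_gen F T u i.
rewrite (brwE g gi) (brwE g (@d_hom i)) (brwE (sdw g) gi).
rewrite sdwB !sdw_mulw !sdw_gen (twist_hom 1 gi).
rewrite !(twist_hom _ gm) (twist_hom _ (homw_sdw gm)) (twist_hom 1 (homwZ _ gm)).
rewrite !mul1r sdwZ !mulwE scalerBr !scalerA.
have -> : (-1) ^ m * (-1) ^ (u i * m) = (-1) ^ ((u i - 1) * m) :> F.
  by rewrite -signzD; apply: signz_eq; lia.
have -> : (-1) ^ u i * (-1) ^ (u i * (m - 1)) = (-1) ^ (u i * m) :> F.
  rewrite -signzD; apply: signz_eq; rewrite !odd_absE.
  by case: (odd _); case: (odd _).
by rewrite [X in _ - X]addrC opprD addrACA.
Qed.

Hypothesis d_lie : forall i, liew (d i).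

Lemma liew_sdw_wb I : liew (sdw (wb I)).
Proof.
elim: I => [|i I IH]; first by rewrite /wb /= sdw0; exact: liew0.
have [->|I0] := eqVneq I [::]; first by rewrite /wb /= sdw_gen.
rewrite /wb nest_cons // (sdw_brw _ (@wb_hom F T u I)).
apply: liewD; first by apply: liew_brw => //; exact: liew_wb.
apply/liewZ/liew_brw => //.
exact: (@liew_wb F T u char0 [:: i]).
Qed.

Lemma sdw_rep c f n K : rep u c f -> (size K <= n)%N ->
  sdw f K = \sum_(k < n.+1) \sum_(I <- words T k) (c I : F) * sdw (wb I) K :> F.
Proof.
move=> cf Kn.
rewrite (@sdw_eq _ (\sum_(k < n.+1) \sum_(I <- words T k) c I *: wb I)); last first.
  move=> J JK; have Jn : (size J < n.+1)%N by apply: leq_trans Kn.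
  rewrite fct_sumE; under eq_bigr do rewrite fct_sumE.
  rewrite (bigD1 (Ordinal Jn)) //= [X in _ + X]big1 => [|k kJ]; last first.
    rewrite big_seq big1 // => I /words_size Ik.
    rewrite wfunE wb_size ?mulr0 // Ik; apply: contraNneq kJ => Jk.
    exact/eqP/val_inj.
  by rewrite addr0 cf; apply: eq_bigr.
rewrite sdw_sum fct_sumE; apply: eq_bigr => k _.
by rewrite sdw_sum fct_sumE; apply: eq_bigr => I _; rewrite sdwZ.
Qed.

(** In each length only finitely many nested brackets matter, and for these the Leibniz rule
    [sdw_brw] keeps the values Lie. *)
Lemma liew_sdw f : liew f -> liew (sdw f).
Proof.
move=> fl; apply: liew_local => k.
exists (\sum_(l < k.+1) \sum_(I <- words T l) dynk f I *: sdw (wb I)) => [|J Jk].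
  apply: (big_ind liew) => [|? ? |l _]; [exact: liew0|exact: liewD|].
  apply: (big_ind liew) => [|? ? |I _]; [exact: liew0|exact: liewD|].
  by apply/liewZ; exact: liew_sdw_wb.
rewrite (sdw_rep fl (n := k)) ?Jk // fct_sumE; apply: eq_bigr => l _.
by rewrite fct_sumE.
Qed.

End Derivation.

(** * Coordinates in a homogeneous basis *)

Section Basis.
Variables (F : fieldType) (V : gmod F).

Definition hom_span (P : V -> V) (k : nat) (e : 'I_k -> V) (n : 'I_k -> int) :=
  (forall i, gpr (n i) (e i) = e i) /\
  (forall v, exists c : 'I_k -> F, P v = \sum_i c i *: e i).

Lemma hom_span_degrees (D : seq int) :
  (forall n, exists s : seq V, forall v : V,
    exists c : nat -> F, gpr n v = \sum_(i < size s) c i *: s`_i) ->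
  exists k e n, @hom_span (fun v => \sum_(m <- D) gpr m v) k e n.
Proof.
move=> ft; elim: D => [|m D [k [e [n [eh esp]]]]].
  exists 0%N, (fun=> 0), (fun=> 0); split=> [i|v]; first exact: linear0.
  by exists (fun=> 0); rewrite big_nil big_ord0.
have [s sP] := ft m.
exists (size s + k)%N,
  (fun i => match fintype.split i with inl a => gpr m s`_a | inr a => e a end),
  (fun i => match fintype.split i with inl a => m | inr a => n a end); split=> [i|v].
  by case: (fintype.split i) => a //; rewrite gprK eqxx.
have [c vc] := sP v; have [c' vc'] := esp v.
exists (fun i => match fintype.split i with inl a => c a | inr a => c' a end).
rewrite big_cons big_split_ord /= vc'; congr (_ + _); last first.
  by apply: eq_bigr => a _; rewrite (unsplitK (inr a)).
have -> : gpr m v = gpr m (gpr m v) by rewrite gprK eqxx.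
rewrite vc linear_sum; apply: eq_bigr => a _.
by rewrite (unsplitK (inl a)) linearZ.
Qed.

Lemma finite_type_hom_span : finite_type V ->
  exists k e n, @hom_span id k e n.
Proof.
move=> [[N VN] ft].
have [k [e [n [eh esp]]]] :=
  hom_span_degrees (undup [seq (i%:Z - N%:Z) | i <- iota 0 (N + N).+1]) ft.
exists k, e, n; split=> // v; have [c vc] := esp v; exists c; rewrite -vc.
apply: gpr_sumE => m mD; apply: VN; rewrite ltnNge; apply: contra mD => mN.
apply/mapP; exists `|(m + N%:Z)%R|%N; first by rewrite mem_iota; lia.
by lia.
Qed.

(** A homogeneous spanning family of least cardinality is a basis: a nontrivial relation would allow
    one member to be dropped. *)
Lemma finite_type_basis : finite_type V ->
  exists (r : nat) (e : 'I_r -> V) (n : 'I_r -> int) (es : 'I_r -> dual V),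
  [/\ forall i, gpr (n i) (e i) = e i,
      forall i j, es i (e j) = (i == j)%:R,
      forall v, v = \sum_i es i v *: e i &
      forall i q v, q != n i -> es i (gpr q v) = 0].
Proof.
move=> /finite_type_hom_span spans.
pose P k := `[< exists e n, @hom_span id k e n >].
have exP : exists k, P k by have [k kP] := spans; exists k; apply/asboolP.
case: (ex_minnP exP) => r /asboolP[e [n [eh esp]]] rmin.
have e_free (c : 'I_r -> F) : \sum_i c i *: e i = 0 -> forall i, c i = 0.
  move=> c0 j; apply: contrapT => /eqP cj.
  case: r e n eh esp rmin c c0 j cj => [|r] e n eh esp rmin c c0 j cj;
    first by case: (j).
  suff /rmin : P r by rewrite ltnn.
  apply/asboolP; exists (fun i => e (lift j i)), (fun i => n (lift j i)).
  split=> // v; have [a ->] := esp v.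
  (* [e j] is eliminated by subtracting [a j / c j] times the relation. *)
  exists (fun i => a (lift j i) - a j / c j * c (lift j i)).
  have -> : \sum_i a i *: e i = \sum_i a i *: e i - (a j / c j) *: \sum_i c i *: e i.
    by rewrite c0 scaler0 subr0.
  rewrite scaler_sumr -sumrB (@bigD1_ord _ _ _ _ j) //= scalerA divfK // subrr add0r.
  by apply: eq_bigr => i _; rewrite scalerBl scalerA.
pose co v := projT1 (cid (esp v)).
have coP v : v = \sum_i co v i *: e i by rewrite /co; case: cid.
have co_uniq v c : v = \sum_i c i *: e i -> forall i, co v i = c i.
  move=> vc i; apply/eqP; rewrite -subr_eq0; apply/eqP.
  apply: (e_free (fun i => co v i - c i)).
  under eq_bigr do rewrite scalerBl.
  by rewrite sumrB -coP -vc subrr.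
have co_lin i : linear (fun v => co v i : F^o).
  move=> a v w; rewrite (co_uniq (a *: v + w) (fun i => a * co v i + co w i)) //.
  under eq_bigr do rewrite scalerDl -scalerA.
  by rewrite big_split -scaler_sumr -!coP.
have co_gpr q v i : co (gpr q v) i = if q == n i then co v i else 0.
  apply: (co_uniq _ (fun i => if q == n i then co v i else 0)).
  rewrite {1}(coP v) linear_sum; apply: eq_bigr => j _.
  by rewrite linearZ /= -(eh j) gprK eh; case: eqP => // _; rewrite scaler0 scale0r.
have co_dual i : (fun v => co v i : F^o) \in dual_pred (M := V).
  apply/asboolP; split=> //; exists [:: n i] => q v.
  by rewrite inE co_gpr => /negPf->.
exists r, e, n, (fun i => Dual (co_dual i)); split=> //=.
  move=> i j; apply: (co_uniq _ (fun i => (i == j)%:R)).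
  by rewrite (bigD1 j) //= eqxx scale1r big1 ?addr0 // => l /negPf->; rewrite scale0r.
by move=> i q v /negPf qn; rewrite co_gpr qn.
Qed.

End Basis.

(** * Tensor powers in coordinates *)

Section TensorWords.
Variables (F : fieldType) (M : gmod F) (T : finType).
Variables (b : T -> M) (ev : T -> M -> F^o) (u : T -> int).
Hypothesis ev_lin : forall i, linear (ev i).
Hypothesis ev_b : forall m, m = \sum_i ev i m *: b i.
Hypothesis ev_bb : forall i j, ev i (b j) = (i == j)%:R.
Hypothesis b_hom : forall i, gpr (u i) (b i) = b i.
Implicit Types (i j : T) (I J K : seq T).

(* The coefficient of t : M^{(x) k} at a word of length k in the basis b. *)
Fixpoint tcoef (k : nat) : tpow M k -> seq T -> F^o :=
  match k with
  | 0 => fun c _ => c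
  | k'.+1 => fun t I =>
      if I is i :: I' then
        tlift (fun (m : M) (v : tpow M k') => (ev i m : F) *: tcoef v I') t
      else 0
  end.

Lemma ev_gpr q i m : ev i (gpr q m) = if q == u i then ev i m else 0.
Proof.
rewrite {1}(ev_b m) linear_sum /=.
have evs (f : T -> M) : ev i (\sum_j f j) = \sum_j ev i (f j).
  apply: big_morph => [x y|]; first exact: linD.
  exact: lin0 (ev_lin i).
rewrite evs (bigD1 i) //= [X in _ + X]big1 ?addr0 => [|j ji].
  rewrite linearZ /= (linZ _ _ (ev_lin i)) -(b_hom i) gprK b_hom.
  case: eqP => _; first by rewrite ev_bb eqxx; exact: mulr1.
  by rewrite (lin0 (ev_lin i)) scaler0.
rewrite linearZ /= (linZ _ _ (ev_lin i)) -(b_hom j) gprK b_hom.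
have ev0 : ev i 0 = 0 by exact: lin0 (ev_lin i).
by case: eqP => _; rewrite ?ev0 ?ev_bb 1?eq_sym ?(negPf ji) scaler0.
Qed.

Lemma tcoef_bilin k i I : linear (fun v : tpow M k => tcoef v I) ->
  bilin (fun (m : M) (v : tpow M k) => (ev i m : F) *: tcoef v I).
Proof.
move=> cl; split=> [m|v] c x y /=.
  by rewrite cl scalerDr !scalerA mulrC.
by rewrite ev_lin scalerDl -scalerA.
Qed.

Lemma tcoef_linear k I : linear (fun v : tpow M k => tcoef v I).
Proof.
elim: k I => [|k IH] I //=; case: I => [|i I] c x y.
  by rewrite scaler0 addr0.
by rewrite (tlift_linear (tcoef_bilin i (IH I))).
Qed.

Lemma tcoef_pure k i I (m : M) (v : tpow M k) :
  tcoef (k := k.+1) (tpure m v) (i :: I) = (ev i m : F) * tcoef v I :> F.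
Proof. exact: (tlift_pure _ _ (tcoef_bilin i (@tcoef_linear k I))). Qed.

Arguments tcoef : simpl never.

Lemma tcoefD k (s t : tpow M k) I : tcoef (s + t) I = (tcoef s I : F) + tcoef t I :> F.
Proof. exact: linD (@tcoef_linear k I). Qed.

Lemma tcoef0 k I : tcoef (0 : tpow M k) I = 0.
Proof. exact: lin0 (@tcoef_linear k I). Qed.

Lemma tcoef_sum k (X : Type) (s : seq X) (P : pred X) (f : X -> tpow M k) I :
  tcoef (\sum_(x <- s | P x) f x) I = \sum_(x <- s | P x) (tcoef (f x) I : F) :> F.
Proof.
by apply: (big_morph (fun t => tcoef t I : F)) => [x y|]; [exact: tcoefD|exact: tcoef0].
Qed.

Lemma tcoef_gpr k q (t : tpow M k) I : size I = k ->
  tcoef (gpr q t) I = if q == wdeg u I then tcoef t I else 0.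
Proof.
elim: k q t I => [|k IH] q t I.
  by move=> /size0nil->; rewrite wdeg_nil.
case: I => // i I [Ik]; elim/tens_ind: t => [|x y IHx IHy|j l m v].
- by rewrite linear0 tcoef0 if_same.
- rewrite (linD x y (@gpr_linear F (tpow M k.+1) q)) tcoefD IHx IHy tcoefD.
  by case: eqP => // _; rewrite addr0.
rewrite -[gpr q _]/(tgpr q _) tgpr_homog wdeg_cons.
have E : tcoef (k := k.+1) (tpure (gpr j m) (gpr l v)) (i :: I) =
    if (j == u i) && (l == wdeg u I) then (ev i m : F) * tcoef v I else 0 :> F.
  rewrite tcoef_pure ev_gpr IH //.
  by case: eqP; case: eqP => //=; rewrite ?mul0r ?mulr0.
case: (q =P j + l) => [->|qjl].
  by rewrite !E; case: andP => [[/eqP-> /eqP->]|_]; rewrite ?eqxx // if_same.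
rewrite tcoef0; case: (q =P u i + _) => [qd|//]; rewrite E.
by case: andP => // -[/eqP jE /eqP lE]; case: qjl; rewrite qd jE lE.
Qed.

(** Inverse of [tcoef]; it produces tensors from prescribed coefficients. *)
Fixpoint mkt (k : nat) (g : seq T -> F) : tpow M k :=
  match k with
  | 0 => g [::]
  | k'.+1 => \sum_i tpure (b i) (mkt k' (fun I => g (i :: I)))
  end.

Lemma mktS k (g : seq T -> F) :
  mkt k.+1 g = \sum_i (tpure (b i) (mkt k (fun I => g (i :: I))) : tpow M k.+1).
Proof. by []. Qed.

Arguments mkt : simpl never.

Lemma tcoef_mkt k g I : size I = k -> tcoef (mkt k g) I = g I.
Proof.
elim: k g I => [|k IH] g I; first by move=> /size0nil->.
case: I => // i I [Ik]; rewrite mktS tcoef_sum (bigD1 i) //= [X in _ + X]big1 ?addr0 => [|j ji].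
  by rewrite tcoef_pure ev_bb eqxx mul1r IH.
by rewrite tcoef_pure ev_bb eq_sym (negPf ji) mul0r.
Qed.

Lemma eq_mkt k (g h : seq T -> F) :
  (forall I, size I = k -> g I = h I) -> mkt k g = mkt k h.
Proof.
elim: k g h => [|k IH] g h gh; first exact: gh.
rewrite !mktS; by apply: eq_bigr => i _; rewrite (IH _ (fun I => h (i :: I))) // => I Ik; rewrite gh //= Ik.
Qed.

Lemma mkt_lin k c (g h : seq T -> F) :
  mkt k (fun I => c * g I + h I) = c *: mkt k g + mkt k h.
Proof.
elim: k g h => [//|k IH] g h.
rewrite !mktS scaler_sumr -big_split; apply: eq_bigr => i _.
by rewrite IH (tpure_bilin _ _).1.
Qed.

Lemma mkt_tcoef k (t : tpow M k) : t = mkt k (tcoef t).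
Proof.
elim: k t => [//|k IH] t; elim/tens_ind: t => [|x y IHx IHy|j l m v].
- rewrite (@eq_mkt _ _ (fun I => -1 * 0 + 0)) => [|I _]; last first.
    by rewrite tcoef0 mulr0 addr0.
  by rewrite (@mkt_lin _ (-1) (fun=> 0) (fun=> 0)) scaleN1r addNr.
- have := @mkt_lin k.+1 1 (tcoef (k := k.+1) x) (tcoef (k := k.+1) y).
  rewrite -IHx -IHy scale1r => E; rewrite -[LHS]E.
  by apply: eq_mkt => I _; rewrite mul1r; exact/esym/(@tcoefD k.+1).
rewrite mktS {1}(ev_b (gpr j m)) tpure_suml; apply: eq_bigr => i _.
rewrite (@eq_mkt _ _ (fun I => (ev i (gpr j m) : F) * tcoef (gpr l v) I + 0)); last first.
  by move=> I _; rewrite tcoef_pure addr0.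
rewrite mkt_lin -IH (tpure_bilin _ _).1 (linZ _ _ ((tpure_bilin M (tpow M k)).2 _)).
rewrite (@eq_mkt _ _ (fun I => -1 * 0 + 0)) => [|I _]; last by rewrite mulr0 addr0.
rewrite (@mkt_lin _ (-1) (fun=> 0) (fun=> 0)) scaleN1r addNr.
by rewrite (tpure0r _) addr0.
Qed.

Lemma tcoef_inj k (s t : tpow M k) :
  (forall I, size I = k -> tcoef s I = tcoef t I) -> s = t.
Proof. by move=> st; rewrite [s]mkt_tcoef [t]mkt_tcoef; exact: eq_mkt. Qed.

End TensorWords.

Lemma par_homog (F : fieldType) (M : gmod F) m (x : M) :
  gpr m x = x -> par x = (-1) ^ m *: x.
Proof.
move=> xm; rewrite /par (@fsum_seq _ [:: m]) ?big_seq1 ?xm // => k.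
by rewrite inE -xm gprK => /negPf->; rewrite scaler0.
Qed.

Lemma par_linear (F : fieldType) (M : gmod F) : linear (@par F M).
Proof.
apply: fsum_linear => [k c x y|k x ->]; last exact: scaler0.
by rewrite linearP scalerDr !scalerA mulrC.
Qed.

Lemma ev_par (F : fieldType) (M : gmod F) (f : M -> F^o) m x :
  linear f -> (forall q y, f (gpr q y) = if q == m then f y else 0) ->
  f (par x) = (-1) ^ m * (f x : F) :> F.
Proof.
move=> fl fm; have [s xs] := gpr_supp x.
have f0 : f 0 = 0 by exact: (lin0 fl).
rewrite /par (@fsum_seq _ (m :: s)); last first.
  by move=> k; rewrite inE negb_or => /andP[_ /xs ->]; rewrite scaler0.
rewrite (big_morph f (fun x y => linD x y fl) f0).
rewrite (bigD1_seq m) ?undup_uniq ?mem_undup ?mem_head //=.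
rewrite (linZ _ _ fl) fm eqxx big1 ?addr0 // => k km.
by rewrite (linZ _ _ fl) fm (negPf km) scaler0.
Qed.

(** * Series as functions on words *)

Section Series.
Variables (F : fieldType) (V : cplx F) (r : nat).
Variables (e : 'I_r -> V) (n : 'I_r -> int) (es : 'I_r -> dual V).
Hypothesis e_hom : forall i, gpr (n i) (e i) = e i.
Hypothesis es_e : forall i j, es i (e j) = (i == j)%:R.
Hypothesis e_exp : forall v, v = \sum_i es i v *: e i.
Hypothesis es_gpr : forall i q v, q != n i -> es i (gpr q v) = 0.

Local Notation T := ('I_r).
Local Notation W := (desus (dualg V)).
Local Notation wfun := (seq T -> F^o).

(** The degree of the generator s^{-1} e_i^#. *)
Definition udeg (i : T) : int := - n i - 1.
Local Notation u := udeg.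

Definition evd (i : T) (f : dual V) : F^o := f (e i).

Lemma evd_lin i : linear (evd i).
Proof. by []. Qed.

Lemma evd_es i j : evd i (es j) = (i == j)%:R.
Proof. by rewrite /evd es_e eq_sym. Qed.

Lemma evd_exp (f : dual V) : f = \sum_i (evd i f : F) *: es i.
Proof.
apply: val_inj; rewrite raddf_sum; apply/funext => v.
rewrite -[LHS]/(dual_val f v) {1}(e_exp v) (linear_sum f) fct_sumE; apply: eq_bigr => i _.
rewrite linearZ; exact: mulrC.
Qed.

Lemma es_homV i : gpr (- n i) (es i : dualg V) = es i.
Proof.
apply/val_inj/funext => v /=; rewrite opprK.
have [s vs] := gpr_supp v; rewrite {2}(@gpr_sumE _ _ v (n i :: s)); last first.
  by move=> q; rewrite inE negb_or => /andP[_ /vs].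
rewrite (linear_sum (es i)) (bigD1_seq (n i)) ?undup_uniq ?mem_undup ?mem_head //=.
by rewrite big1 ?addr0 // => q qn; rewrite es_gpr.
Qed.

Lemma es_homW i : gpr (u i) (es i : W) = es i.
Proof. by rewrite -[LHS]/(gpr (u i + 1) (es i : dualg V)) /u subrK es_homV. Qed.

Local Notation coefW := (@tcoef F W T evd).
Local Notation mktW := (@mkt F W T es).

Definition coefW_linear := @tcoef_linear F W T evd evd_lin.
Definition coefW_pure := @tcoef_pure F W T evd evd_lin.
Definition coefW_gpr := @tcoef_gpr F W T es evd u evd_lin evd_exp evd_es es_homW.
Definition coefW_mkt := @tcoef_mkt F W T es evd evd_lin evd_es.
Definition coefW_inj := @tcoef_inj F W T es evd evd_lin evd_exp.

Lemma evW_par i (w : W) : evd i (par w) = (-1) ^ u i * (evd i w : F) :> F.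
Proof.
apply: ev_par => // q y.
exact: (@ev_gpr F W T es evd u evd_lin evd_exp evd_es es_homW).
Qed.

Lemma evd_par i (w : dualg V) : evd i (par w) = (-1) ^ n i * (evd i w : F) :> F.
Proof.
rewrite -[in RHS](@signz_eq F (- n i)) ?abszN //; apply: ev_par => // q y.
exact: (@ev_gpr F (dualg V) T es evd (fun i => - n i) evd_lin evd_exp evd_es es_homV).
Qed.

(** Coordinates of a series: on this side products need no [ecast] and brackets no sums over
    degrees. *)
Definition cf (f : series V) : wfun := fun I => coefW (f (size I)) I.

Lemma cfE (f : series V) k I : size I = k -> cf f I = coefW (f k) I.
Proof. by move=> <-. Qed.

Lemma cf_inj f g : cf f = cf g -> f = g.
Proof.
move=> fg; apply: functional_extensionality_dep => k.
by apply: coefW_inj => I Ik; rewrite -!cfE // fg.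
Qed.

Lemma cf_eq_at f g k : (forall I, size I = k -> cf f I = cf g I) -> f k = g k.
Proof. by move=> fg; apply: coefW_inj => I Ik; rewrite -!cfE // fg. Qed.

Definition mkser (g : wfun) : series V := fun k => mktW k g.

Lemma cf_mkser g : cf (mkser g) = g.
Proof. by apply/funext => I; rewrite (cfE _ erefl) coefW_mkt. Qed.

Lemma cf_linear : linear cf.
Proof.
move=> c f g; apply/funext => I.
exact: (@coefW_linear (size I) I c (f (size I)) (g (size I))).
Qed.

Lemma cfD f g : cf (f + g) = cf f + cf g. Proof. exact: linD cf_linear. Qed.
Lemma cfZ c f : cf (c *: f) = c *: cf f. Proof. exact: linZ cf_linear. Qed.
Lemma cf0 : cf 0 = 0.
Proof. exact: (lin0 cf_linear). Qed.
Lemma cfN f : cf (- f) = - cf f.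
Proof. by rewrite -scaleN1r cfZ scaleN1r. Qed.
Lemma cf_sum (X : Type) (s : seq X) (P : pred X) (f : X -> series V) :
  cf (\sum_(x <- s | P x) f x) = \sum_(x <- s | P x) cf (f x).
Proof. by apply: (big_morph cf) => [x y|]; [exact: cfD|exact: cf0]. Qed.

Lemma cf_sproj q f I : cf (sproj q f) I = if q == wdeg u I then cf f I else 0.
Proof. exact: (coefW_gpr q (f (size I)) erefl). Qed.

Lemma cat_pow_linear k m (t : tpow W m) : linear (fun s : tpow W k => cat_pow s t).
Proof.
elim: k => [|k IH] c s s' /=; first by rewrite scalerDl scalerA.
apply: tlift_linear; split=> [w|v] a x y /=; first by rewrite IH (tpure_bilin _ _).1.
by rewrite [LHS](tpure_bilin _ _).2.
Qed.

Lemma tcoef_cat k m (s : tpow W k) (t : tpow W m) I J : size I = k ->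
  coefW (cat_pow s t) (I ++ J) = (coefW s I : F) * coefW t J :> F.
Proof.
elim: k s I => [|k IH] s I.
  move=> /size0nil->; exact: (linZ _ _ (@coefW_linear m J)).
case: I => // i I [Ik]; elim/tens_ind: s => [|x y IHx IHy|a b w v].
- have c0 : cat_pow (0 : tpow W k.+1) t = 0.
    exact: lin0 (@cat_pow_linear k.+1 m t).
  transitivity (0 : F); last first.
    by rewrite [X in X * _](@tcoef0 F W T evd evd_lin k.+1) mul0r.
  by rewrite [cat_pow _ t]c0; exact: (@tcoef0 F W T evd evd_lin (k + m).+1).
- rewrite (linD x y (@cat_pow_linear k.+1 m t)).
  rewrite (linD _ _ (@coefW_linear (k.+1 + m) _)) IHx IHy.
  by rewrite (linD _ _ (@coefW_linear k.+1 _)) mulrDl.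
rewrite [cat_pow _ t](tlift_pure (f := fun w v => tpure w (cat_pow v t))); last first.
  split=> [x|x] c y z /=; first by rewrite cat_pow_linear (tpure_bilin _ _).1.
  by rewrite [LHS](tpure_bilin _ _).2.
by rewrite !coefW_pure IH // mulrA.
Qed.

Lemma cf_smul f g : cf (smul f g) = mulw (cf f) (cf g).
Proof.
apply/funext => K; rewrite (cfE _ erefl) /smul (@tcoef_sum F W T evd evd_lin).
rewrite /mulw (big_splits_sym K (fun I J => (cf f I : F) * cf g J)).
apply: eq_bigr => -[j jK] _ /=.
have ecoef k l (E : k = l) (t : tpow W k) :
  coefW (ecast j (tpow W j) E t) K = coefW t K by case: l / E.
rewrite ecoef.
have sj : size (take j K) = j by rewrite size_takel // -ltnS.
have := tcoef_cat (f j) (g (size K - j)%N) (drop j K) sj.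
by rewrite cat_take_drop => ->; rewrite -!cfE ?size_drop.
Qed.

Lemma cf_sinj k (t : tpow W k) I :
  cf (sinj t) I = if size I == k then coefW t I else 0.
Proof.
rewrite /cf /sinj; case: (k =P size I) => [E|kI].
  have ecoef l (E' : k = l) : coefW (ecast j (tpow W j) E' t) I = coefW t I.
    by case: l / E'.
  by rewrite ecoef -E eqxx.
rewrite eq_sym; case: eqP => // _; exact: (@tcoef0 F W T evd evd_lin).
Qed.

Lemma cf_sgen (w : W) : cf (sgen w) = \sum_i (evd i w : F) *: genw F i.
Proof.
apply/funext => I; rewrite cf_sinj fct_sumE.
case: I => [|i [|j I]] /=.
- by rewrite big1 // => i _; rewrite wfunE mulr0.
- transitivity ((evd i w : F) * 1); first exact: (@coefW_pure 0 i [::] w 1).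
  rewrite mulr1 (bigD1 i) //= big1 => [|j ji].
    by rewrite wfunE /genw eqxx mulr1 addr0.
  by rewrite wfunE /genw eqseq_cons eq_sym (negPf ji) mulr0.
by rewrite big1 // => l _; rewrite wfunE /genw eqseq_cons andbF mulr0.
Qed.

Lemma cf_sgen_es i : cf (sgen (es i : W)) = genw F i.
Proof.
rewrite cf_sgen (bigD1 i) //= evd_es eqxx scale1r big1 ?addr0 // => j ji.
by rewrite evd_es (negPf ji) scale0r.
Qed.

Definition fdeg (g : wfun) :=
  exists s : seq int, forall I, wdeg u I \notin s -> g I = 0.

Lemma fdeg_sproj f : fdeg (cf f) <->
  exists s : seq int, forall q, q \notin s -> sproj q f = 0.
Proof.
split=> -[s sP]; exists s; last move=> I Is.
  move=> q qs; apply: cf_inj; apply/funext => I; rewrite cf_sproj cf0.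
  by case: eqP => // qI; rewrite sP // -qI.
have := congr1 cf (sP _ Is); rewrite cf0 => /(congr1 (fun g : wfun => g I)).
by rewrite cf_sproj eqxx.
Qed.

Lemma fdeg_brw f g : fdeg f -> fdeg g -> fdeg (brw u f g).
Proof.
move=> [s fs] [t gt]; exists [seq a + b | a <- s, b <- t] => K Kst.
rewrite /brw big_seq big1 // => p /splits_cat pK.
suff fg I J : wdeg u K = wdeg u I + wdeg u J -> (f I : F) * g J = 0.
  have dK : wdeg u K = wdeg u p.1 + wdeg u p.2 by rewrite -pK wdeg_cat.
  by rewrite fg // (mulrC (g p.1 : F)) fg ?mulr0 ?subr0 // dK addrC.
move=> KIJ; have [Is|/fs->] := boolP (wdeg u I \in s); last by rewrite mul0r.
have [Jt|/gt->] := boolP (wdeg u J \in t); last by rewrite mulr0.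
case/negP: Kst; rewrite KIJ.
exact: (allpairs_f (fun a b => a + b)).
Qed.

(** [sbr] sums over all pairs of degrees, which is meaningful only when finitely many terms are
    nonzero; hence the condition [fdeg]. *)
Lemma cf_sbr f g : fdeg (cf f) -> fdeg (cf g) ->
  cf (sbr f g) = brw u (cf f) (cf g).
Proof.
move=> /fdeg_sproj[s fs] /fdeg_sproj[t gt].
have sm0 (h : series V) : smul h 0 = 0 :> series V.
  apply: cf_inj; rewrite cf_smul cf0; apply/funext => K.
  by rewrite /mulw big1 // => p _; rewrite mulr0.
have s0m (h : series V) : smul 0 h = 0 :> series V.
  apply: cf_inj; rewrite cf_smul cf0; apply/funext => K.
  by rewrite /mulw big1 // => p _; rewrite mul0r.
rewrite /sbr (@fsum_seq _ s) => [|m ms]; last first.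
  rewrite (@fsum_seq _ [::]) ?big_nil // => k _.
  by rewrite fs // sm0 scaler0.
have E m : \sum_(k \in [set: int])
      (-1) ^ (m * k) *: smul (sproj k g) (sproj m f) =
    \sum_(k <- undup t) (-1) ^ (m * k) *: smul (sproj k g) (sproj m f).
  by rewrite (@fsum_seq _ t) // => k kt; rewrite gt // s0m scaler0.
under eq_bigr do rewrite E.
rewrite cfD cfN cf_smul cf_sum; apply/funext => K.
rewrite wfunE [(- _) K]wfunN fct_sumE /brw sumrB; congr (_ - _).
under eq_bigr do rewrite cf_sum fct_sumE.
under eq_bigr do under eq_bigr do rewrite cfZ cf_smul wfunE /mulw mulr_sumr.
under eq_bigr do rewrite exchange_big; rewrite exchange_big /=.
apply: eq_bigr => p _.
(* A deconcatenation contributes to exactly one pair of degrees, those of its two factors; if one of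
   these is not listed, the term is zero on both sides. *)
have [p2|p2] := boolP (wdeg u p.2 \in s); last first.
  have fp2 : cf f p.2 = 0.
    have := congr1 cf (fs _ p2); rewrite cf0 => /(congr1 (fun g : wfun => g p.2)).
    by rewrite cf_sproj eqxx.
  rewrite fp2 !mulr0 big1 // => m _; rewrite big1 // => k _.
  by rewrite [cf (sproj m f) _]cf_sproj fp2 if_same !mulr0.
have [p1|p1] := boolP (wdeg u p.1 \in t); last first.
  have gp1 : cf g p.1 = 0.
    have := congr1 cf (gt _ p1); rewrite cf0 => /(congr1 (fun g : wfun => g p.1)).
    by rewrite cf_sproj eqxx.
  rewrite gp1 !mul0r !mulr0 big1 // => m _; rewrite big1 // => k _.
  by rewrite [cf (sproj k g) _]cf_sproj gp1 if_same mul0r mulr0.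
rewrite (bigD1_seq (wdeg u p.2)) ?undup_uniq ?mem_undup //=.
rewrite [X in _ + X]big1 ?addr0 => [|m mp]; last first.
  rewrite big1 // => k _.
  by rewrite [cf (sproj m f) _]cf_sproj (negPf mp) !mulr0.
rewrite (bigD1_seq (wdeg u p.1)) ?undup_uniq ?mem_undup //=.
rewrite [X in _ + X]big1 ?addr0 => [|k kp]; last first.
  by rewrite [cf (sproj k g) _]cf_sproj (negPf kp) mul0r mulr0.
by rewrite !cf_sproj !eqxx mulrC (mulrC (wdeg u p.2)) mulrC.
Qed.

End Series.

(** * Trees *)

Section Koszul.
Variables (F : fieldType) (M N : gmod F) (U : lmodType F).
Implicit Types (f : M -> N -> U).

Lemma kos_supp f x y (s t : seq int) : (forall y, f 0 y = 0) -> (forall x, f x 0 = 0) ->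
  (forall m, m \notin s -> gpr m x = 0) -> (forall m, m \notin t -> gpr m y = 0) ->
  kos f x y = \sum_(m <- undup s) \sum_(k <- undup t)
    (-1) ^ (m * k) *: f (gpr m x) (gpr k y).
Proof.
move=> f0l f0r xs yt; rewrite /kos (@fsum_seq _ s) => [|m /xs ->]; last first.
  by rewrite (@fsum_seq _ [::]) ?big_nil // => k _; rewrite f0l scaler0.
apply: eq_bigr => m _; rewrite (@fsum_seq _ t) // => k /yt ->.
by rewrite f0r scaler0.
Qed.

Lemma kos_homog f m k x y : (forall y, f 0 y = 0) -> (forall x, f x 0 = 0) ->
  gpr m x = x -> gpr k y = y -> kos f x y = (-1) ^ (m * k) *: f x y.
Proof.
move=> f0l f0r xm yk; rewrite (@kos_supp f x y [:: m] [:: k]) //= ?big_seq1 ?xm ?yk //.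
- by move=> q; rewrite inE -xm gprK => /negPf->.
- by move=> q; rewrite inE -yk gprK => /negPf->.
Qed.

Lemma kos_bilin f : bilin f -> bilin (kos f).
Proof.
move=> fb; have f0l y : f 0 y = 0 by exact: bilin0l.
have f0r x : f x 0 = 0 by exact: bilin0r.
split=> [x|y].
  have [s xs] := gpr_supp x => c y y'.
  have E z : kos f x z = \sum_(m <- undup s) \sum_(k \in [set: int])
      (-1) ^ (m * k) *: f (gpr m x) (gpr k z).
    rewrite /kos (@fsum_seq _ s) // => m /xs ->.
    by rewrite (@fsum_seq _ [::]) ?big_nil // => k _; rewrite f0l scaler0.
  rewrite !E scaler_sumr -big_split; apply: eq_bigr => m _.
  apply: (@fsum_linear F N U (fun k z => (-1) ^ (m * k) *: f (gpr m x) (gpr k z))).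
    by move=> k a z z'; rewrite linearP /= fb.1 scalerDr !scalerA mulrC.
  by move=> k z ->; rewrite f0r scaler0.
have [t yt] := gpr_supp y.
apply: (@fsum_linear F M U (fun m x => \sum_(k \in [set: int])
   (-1) ^ (m * k) *: f (gpr m x) (gpr k y))) => [m c x x'|m x ->].
  have E z : \sum_(k \in [set: int]) (-1) ^ (m * k) *: f (gpr m z) (gpr k y)
      = \sum_(k <- undup t) (-1) ^ (m * k) *: f (gpr m z) (gpr k y).
    by rewrite (@fsum_seq _ t) // => k /yt->; rewrite f0r scaler0.
  rewrite !E scaler_sumr -big_split; apply: eq_bigr => k _.
  by rewrite linearP /= (fb.2 _) scalerDr !scalerA mulrC.
by rewrite (@fsum_seq _ [::]) ?big_nil // => k _; rewrite f0l scaler0.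
Qed.

Lemma kos_lin c f g x y : bilin f -> bilin g ->
  kos (fun x y => c *: f x y + g x y) x y = c *: kos f x y + kos g x y.
Proof.
move=> fb gb; have [s xs] := gpr_supp x; have [t yt] := gpr_supp y.
rewrite !(kos_supp _ _ xs yt); try by move=> z; rewrite ?(bilin0l _ fb) ?(bilin0l _ gb)
  ?(bilin0r _ fb) ?(bilin0r _ gb) ?scaler0 ?addr0.
rewrite scaler_sumr -big_split; apply: eq_bigr => m _; rewrite scaler_sumr -big_split.
by apply: eq_bigr => k _; rewrite /= scalerDr !scalerA mulrC.
Qed.

End Koszul.

(** * Multilinear maps on sequences *)

Section Multilinear.
Variables (F : fieldType) (V : lmodType F).

(** Multilinearity of G on sequences of length k; its values on other lengths are unconstrained. *)
Fixpoint mlin (U : lmodType F) (k : nat) (G : seq V -> U) : Prop :=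
  if k is k'.+1 then
    (forall a, size a = k' -> linear (fun v => G (v :: a))) /\
    (forall v, mlin k' (fun a => G (v :: a)))
  else True.

Variable U : lmodType F.
Implicit Types G H : seq V -> U.

Lemma mlin_ext k G H : (forall a, size a = k -> G a = H a) -> mlin k G -> mlin k H.
Proof.
elim: k G H => [//|k IH] G H GH [G1 G2]; split=> [a ak c x y|v].
  by rewrite -!GH /= ?ak // G1.
by apply: IH (G2 v) => a ak; rewrite GH //= ak.
Qed.

Lemma mlin0 k : mlin k (fun=> 0 : U).
Proof. by elim: k => //= k IH; split=> // a _ c x y; rewrite scaler0 addr0. Qed.

Lemma mlin_lin k c G H : mlin k G -> mlin k H -> mlin k (fun a => c *: G a + H a).
Proof.
elim: k G H => [//|k IH] G H [G1 G2] [H1 H2]; split=> [a ak b x y|v].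
  by rewrite (G1 a ak) (H1 a ak) !scalerDr !scalerA (mulrC b c) addrACA.
exact: (IH (fun a => G (v :: a)) (fun a => H (v :: a)) (G2 v) (H2 v)).
Qed.

Lemma mlin_sum k (X : Type) (s : seq X) (G : X -> seq V -> U) :
  (forall x, mlin k (G x)) -> mlin k (fun a => \sum_(x <- s) G x a).
Proof.
move=> Gm; elim: s => [|x s IH].
  by apply: mlin_ext (mlin0 k) => a _; rewrite big_nil.
by apply: mlin_ext (mlin_lin 1 (Gm x) IH) => a _; rewrite big_cons scale1r.
Qed.

Lemma mlin_sum_seq k (X : eqType) (s : seq X) (G : X -> seq V -> U) :
  (forall x, x \in s -> mlin k (G x)) -> mlin k (fun a => \sum_(x <- s) G x a).
Proof.
elim: s => [|x s IH] Gm.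
  by apply: mlin_ext (mlin0 k) => a _; rewrite big_nil.
have xm := Gm x (mem_head _ _).
have sm := IH (fun y ys => Gm y (mem_behead (s := x :: s) ys)).
by apply: mlin_ext (mlin_lin 1 xm sm) => a _; rewrite big_cons scale1r.
Qed.

Lemma mlin_comp (U' : lmodType F) (h : U -> U') k G :
  linear h -> mlin k G -> mlin k (fun a => h (G a)).
Proof.
move=> hl; elim: k G => [//|k IH] G [G1 G2]; split=> [a ak c x y|v].
  by rewrite G1 // hl.
exact: (IH (fun a => G (v :: a)) (G2 v)).
Qed.

Lemma mlin_map (h : V -> V) k G :
  linear h -> mlin k G -> mlin k (fun a => G (map h a)).
Proof.
move=> hl; elim: k G => [//|k IH] G [G1 G2]; split=> [a ak c x y|v] /=.
  by rewrite hl G1 // size_map.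
exact: (IH (fun a => G (h v :: a)) (G2 (h v))).
Qed.

End Multilinear.

Section MultilinearCat.
Variables (F : fieldType) (V U : lmodType F).

Lemma mlin_scale (X : Type) k (G : seq V -> U) (c : X -> F) (f : X -> V) s :
  mlin k G -> size s = k ->
  G [seq c i *: f i | i <- s] = (\prod_(i <- s) c i) *: G (map f s).
Proof.
elim: k G s => [|k IH] G s.
  by move=> _ /size0nil->; rewrite big_nil scale1r.
case: s => // x s [G1 G2] [sk] /=.
rewrite (linZ _ _ (G1 _ _)) ?size_map // (IH (fun a => G (f x :: a)) s (G2 _) sk).
by rewrite scalerA big_cons.
Qed.

Lemma mlin_cat (U1 U2 : lmodType F) (f : U1 -> U2 -> U) k l
    (G1 : seq V -> U1) (G2 : seq V -> U2) :
  bilin f -> mlin k G1 -> mlin l G2 ->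
  mlin (k + l) (fun a => f (G1 (take k a)) (G2 (drop k a))).
Proof.
move=> fb; elim: k G1 => [|k IH] G1.
  move=> _ G2m; apply: (@mlin_ext _ _ _ _ (fun a => f (G1 [::]) (G2 a))).
    by move=> a _; rewrite take0 drop0.
  exact: (mlin_comp (fb.1 (G1 [::])) G2m).
move=> [G11 G12] G2m; split=> [a ak c x y|v] /=; last exact: (IH (fun a => G1 (v :: a)) (G12 v) G2m).
by rewrite G11 ?(fb.2 _) // size_takel // ak leq_addr.
Qed.

Lemma mlin_expand (T : finType) (e : T -> V) (es : T -> V -> F) k (G H : seq V -> U) :
  (forall v, v = \sum_i es i v *: e i) -> mlin k G -> mlin k H ->
  (forall I : seq T, size I = k -> G (map e I) = H (map e I)) ->
  forall a, size a = k -> G a = H a.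
Proof.
move=> eE; elim: k G H => [|k IH] G H Gm Hm GH a.
  by move=> /size0nil->; exact: (GH [::]).
case: a => // v a [ak]; have [G1 G2] := Gm; have [H1 H2] := Hm.
have sumlin (h : V -> U) : linear h -> h v = \sum_i es i v *: h (e i).
  move=> hl; have h0 : h 0 = 0 by exact: (lin0 hl).
  rewrite {1}(eE v) (big_morph h (fun x y => linD x y hl) h0).
  by apply: eq_bigr => i _; rewrite (linZ _ _ hl).
rewrite (sumlin _ (G1 a ak)) (sumlin _ (H1 a ak)).
apply: eq_bigr => i _; congr (_ *: _).
apply: (IH (fun a => G (e i :: a)) (fun a => H (e i :: a)) (G2 _) (H2 _)) => // I Ik.
by apply: (GH (i :: I)); rewrite /= Ik.
Qed.

End MultilinearCat.

Section TreeMultilinear.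
Variables (F : fieldType) (H E : lmodType F).
Variables (inc : H -> E) (op : E -> E -> E) (h : E -> E) (sg : H -> H).
Variable eps : nat -> nat -> nat.
Hypotheses (inc_lin : linear inc) (op_bilin : bilin op) (h_lin : linear h)
  (sg_lin : linear sg).

Definition tree_edge (T : btree) (x : E) : E := if T is Leaf then x else h x.

Lemma tree_edge_linear T : linear (tree_edge T).
Proof. by case: T. Qed.

Lemma tree_opN l r a : tree_op inc op h sg eps (Node l r) a =
  (-1) ^+ eps (leaves l) (leaves r) *:
  op (tree_edge l (tree_op inc op h sg eps l
        (map (iter (leaves r).-1 sg) (take (leaves l) a))))
     (tree_edge r (tree_op inc op h sg eps r (drop (leaves l) a))).
Proof. by []. Qed.

Lemma iter_linear k : linear (iter k sg).
Proof. by elim: k => // k IH c x y /=; rewrite IH sg_lin. Qed.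

Lemma mlin_tree_op T : mlin (leaves T) (tree_op inc op h sg eps T).
Proof.
elim: T => [|l IHl r IHr] /=.
  by split=> // a _ c x y; exact: inc_lin.
apply: (@mlin_ext _ _ _ _ (fun a => (-1) ^+ eps (leaves l) (leaves r) *:
  op (tree_edge l (tree_op inc op h sg eps l
        (map (iter (leaves r).-1 sg) (take (leaves l) a))))
     (tree_edge r (tree_op inc op h sg eps r (drop (leaves l) a))))) => //.
apply: mlin_comp; first by move=> c x y; rewrite scalerDr !scalerA mulrC.
apply: (mlin_cat (G1 := fun a => tree_edge l (tree_op inc op h sg eps l
   (map (iter (leaves r).-1 sg) a))) (G2 := fun a => tree_edge r (tree_op inc op h sg eps r a))) => //.
  apply: (mlin_comp (tree_edge_linear l)); apply: mlin_map => //; exact: iter_linear.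
exact: (mlin_comp (tree_edge_linear r)).
Qed.

End TreeMultilinear.

(** * Counting planar and non-planar trees *)

HB.instance Definition _ := gen_eqMixin btree.

Lemma leaves_gt0 T : (0 < leaves T)%N.
Proof. by elim: T => //= l IHl r _; rewrite addn_gt0 IHl. Qed.

Lemma ptrees_recS h k : k != 1%N -> ptrees_rec h.+1 k =
  flatten [seq [seq Node l r | l <- ptrees_rec h j, r <- ptrees_rec h (k - j)]
          | j <- iota 1 k.-1].
Proof. by rewrite /=; case: eqP. Qed.

Lemma ptrees_rec1 h : ptrees_rec h 1 = [:: Leaf].
Proof. by case: h. Qed.

Lemma ptrees_rec_leaves h k T : T \in ptrees_rec h k -> leaves T = k.
Proof.
elim: h k T => [|h IH] k T.
  by rewrite /=; case: eqP => [->|//]; rewrite inE => /eqP->.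
have [->|k1] := eqVneq k 1%N; first by rewrite ptrees_rec1 inE => /eqP->.
rewrite ptrees_recS // => /flatten_mapP[j]; rewrite mem_iota => jk.
case/allpairsP => -[l r] /= [/IH lj /IH rk ->] /=; rewrite lj rk subnKC //.
by lia.
Qed.

(** A tree with k leaves has height less than k, so every bound that is at least k gives the same
    list. *)
Lemma ptrees_rec_enough h h' k :
  (k <= h)%N -> (k <= h')%N -> ptrees_rec h k = ptrees_rec h' k.
Proof.
elim: h h' k => [|h IH] h' k.
  by rewrite leqn0 => /eqP-> _; case: h'.
case: h' => [|h']; first by rewrite leqn0 => _ /eqP->.
move=> kh kh'; have [->|k1] := eqVneq k 1%N; first by rewrite !ptrees_rec1.
rewrite !ptrees_recS //; congr flatten; apply/eq_in_map => j.
rewrite mem_iota => jk; rewrite (IH h' j) ?(IH h' (k - j)%N) //; lia.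
Qed.

Lemma ptrees_leaves k T : T \in ptrees k -> leaves T = k.
Proof. exact: ptrees_rec_leaves. Qed.

Lemma big_ptrees (U : nmodType) k (G : btree -> U) : (1 < k)%N ->
  \sum_(T <- ptrees k) G T =
  \sum_(1 <= j < k) \sum_(l <- ptrees j) \sum_(r <- ptrees (k - j)) G (Node l r).
Proof.
case: k => [|k] // k1; rewrite /ptrees ptrees_recS; last lia.
rewrite big_flatten big_map /index_iota subn1 /= !big_seq.
apply: eq_bigr => j; rewrite mem_iota => jk.
rewrite big_allpairs_dep (@ptrees_rec_enough k j j); [|lia|lia].
by apply: eq_bigr => l _; rewrite (@ptrees_rec_enough k (k.+1 - j) (k.+1 - j)) //; lia.
Qed.

Lemma big_ptrees1 (U : nmodType) (G : btree -> U) :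
  \sum_(T <- ptrees 1) G T = G Leaf.
Proof. by rewrite /ptrees ptrees_rec1 big_seq1. Qed.

Lemma num_isoC S T : num_iso S T = num_iso T S.
Proof.
elim: S T => [|a IHa b IHb] [|c d] //=.
by rewrite (IHa c) (IHa d) (IHb c) (IHb d) (mulnC (num_iso d a)).
Qed.

(** Precomposition with an isomorphism is a bijection; transitivity of being isomorphic follows. *)
Lemma num_iso_pos_eq S T : (0 < num_iso S T)%N -> num_iso S =1 num_iso T.
Proof.
elim: S T => [|a IHa b IHb] [|c d] //=.
rewrite addn_gt0 !muln_gt0 => /orP[] /andP[/IHa ac /IHb bd] [|e f] //=.
  by rewrite !ac !bd.
by rewrite !ac !bd addnC; congr addn; rewrite mulnC.
Qed.

Lemma num_iso_refl T : (0 < num_iso T T)%N.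
Proof. by elim: T => //= l IHl r IHr; rewrite addn_gt0 muln_gt0 IHl IHr. Qed.

Lemma num_iso_leaves S T : (0 < num_iso S T)%N -> leaves S = leaves T.
Proof.
elim: S T => [|a IHa b IHb] [|c d] //=.
rewrite addn_gt0 !muln_gt0 => /orP[] /andP[/IHa -> /IHb ->] //.
exact: addnC.
Qed.

(** An isomorphism from S to some planar tree is a choice, at each of the k-1 vertices of S, of
    exchanging the two branches or not. *)
Lemma sum_num_iso S : (\sum_(T <- ptrees (leaves S)) num_iso S T)%N = (2 ^ (leaves S).-1)%N.
Proof.
elim: S => [|a IHa b IHb]; first by rewrite big_ptrees1.
have a0 := leaves_gt0 a; have b0 := leaves_gt0 b.
have zero S k : k != leaves S -> forall T, T \in ptrees k -> num_iso S T = 0%N.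
  move=> kS T /ptrees_leaves Tk; apply/eqP; rewrite -leqn0 leqNgt.
  by apply: contra kS => /num_iso_leaves ->; rewrite Tk.
set k := leaves (Node a b); have kE : k = (leaves a + leaves b)%N by [].
rewrite (@big_ptrees nat); last by rewrite kE; lia.
under eq_bigr do under eq_bigr do rewrite big_split /=.
under eq_bigr do rewrite big_split /=.
rewrite big_split /=.
have E1 : (\sum_(1 <= j < k) \sum_(l <- ptrees j) \sum_(r <- ptrees (k - j))
    num_iso a l * num_iso b r = 2 ^ (leaves a).-1 * 2 ^ (leaves b).-1)%N.
  rewrite (bigD1_seq (leaves a)) ?iota_uniq ?mem_index_iota //=; last by rewrite kE; lia.
  rewrite [X in (_ + X)%N]big1 ?addn0 => [|j ja].
    by rewrite -IHa -IHb kE addKn big_distrlr.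
  rewrite big_seq big1 // => l /(zero _ _ ja) ->; by rewrite big1.
have E2 : (\sum_(1 <= j < k) \sum_(l <- ptrees j) \sum_(r <- ptrees (k - j))
    num_iso a r * num_iso b l = 2 ^ (leaves a).-1 * 2 ^ (leaves b).-1)%N.
  rewrite (bigD1_seq (leaves b)) ?iota_uniq ?mem_index_iota //=; last by rewrite kE; lia.
  rewrite [X in (_ + X)%N]big1 ?addn0 => [|j jb].
    rewrite -IHa -IHb kE addnK mulnC big_distrlr /=.
    by apply: eq_bigr => l _; apply: eq_bigr => ? _; rewrite mulnC.
  rewrite big_seq big1 // => l /(zero _ _ jb) ->.
  by rewrite big1 // => ? _; rewrite muln0.
rewrite E1 E2 -[LHS]/(_ + _)%N addnn -mul2n -!expnD -expnS; congr (2 ^ _)%N; rewrite kE; lia.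
Qed.

(** The selection made by [nptrees], for an arbitrary list, so that induction on the list
    applies. *)
Definition tree_reps (s : seq btree) : seq btree :=
  foldr (fun T s => if has (fun S => 0 < num_iso T S)%N s then s else T :: s)
        [::] s.

Lemma num_iso_trans S T S' :
  (0 < num_iso S T)%N -> (0 < num_iso S' T)%N -> (0 < num_iso S S')%N.
Proof.
by move=> ST; rewrite (num_iso_pos_eq ST) num_isoC.
Qed.

Lemma count_tree_reps s S : S \in s ->
  count (fun T => 0 < num_iso T S)%N (tree_reps s) = 1%N.
Proof.
have le1 S' : (count (fun T => 0 < num_iso T S') (tree_reps s) <= 1)%N.
  elim: s => //= T s IH; case: ifP => // /hasPn nT /=.
  case: posnP => [_|TS]; first exact: IH.
  rewrite addnC leq_eqVlt; apply/orP; left.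
  rewrite addn1 eqSS -leqn0 leqNgt -has_count; apply/hasPn => T' T's.
  by apply: contra (nT _ T's) => T'S; apply: num_iso_trans TS T'S.
move=> Ss; apply/eqP; rewrite eqn_leq le1 -has_count.
elim: s {le1} Ss => //= T s IH; rewrite inE => /orP[/eqP <-|/IH Ss].
  case: ifP => /= [|_]; last by rewrite num_iso_refl.
  by apply: sub_has => T'; rewrite num_isoC.
by case: ifP => _ //=; rewrite Ss orbT.
Qed.

Lemma tree_reps_sub s : {subset tree_reps s <= s}.
Proof.
elim: s => //= T s IH; case: ifP => _ S.
  by move=> /IH Ss; rewrite inE Ss orbT.
by rewrite !inE => /orP[->//|/IH->]; rewrite orbT.
Qed.

(* Each class of non-planar trees with k leaves has 2^{k-1} / |Aut T| planar
   representatives. *)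
Lemma big_nptrees (F : fieldType) (U : lmodType F) k (G : btree -> U) :
  [pchar F] =i pred0 ->
  (forall S T, (0 < num_iso S T)%N -> G S = G T) ->
  \sum_(T <- nptrees k) (num_iso T T)%:R^-1 *: G T =
  (2 ^ k.-1)%:R^-1 *: \sum_(T <- ptrees k) G T.
Proof.
move=> /pcharf0P char0 Giso; have nz (m : nat) : (0 < m)%N -> m%:R != 0 :> F.
  by rewrite char0 lt0n.
pose N : F := (2 ^ k.-1)%:R.
have N0 : N != 0 by apply: nz; rewrite expn_gt0.
rewrite -/(tree_reps _) big_seq; transitivity (\sum_(T <- tree_reps (ptrees k) | T \in tree_reps (ptrees k))
    N^-1 *: \sum_(S <- ptrees k) (0 < num_iso T S)%N%:R *: G S).
  apply: eq_bigr => T /tree_reps_sub Tk; have TT := num_iso_refl T.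
  (* The value is spread evenly over the 2^{k-1} isomorphisms from T to planar trees. *)
  have -> : G T = N^-1 *: \sum_(S <- ptrees k) (num_iso T S)%:R *: G T.
    rewrite -scaler_suml -natr_sum -(ptrees_leaves Tk) sum_num_iso (ptrees_leaves Tk).
    by rewrite scalerA mulVf // scale1r.
  rewrite scalerA mulrC -scalerA scaler_sumr; congr (_ *: _).
  apply: eq_bigr => S _; rewrite scalerA.
  case: posnP => [->|TS]; first by rewrite mulr0 !scale0r.
  rewrite scale1r (Giso _ _ TS) (num_iso_pos_eq TS T) num_isoC mulVf ?scale1r //.
  exact: nz.
rewrite -big_seq -scaler_sumr exchange_big /= !big_seq; congr (_ *: _).
apply: eq_bigr => S Sk; rewrite -scaler_suml -natr_sum.
by rewrite -(big_mkcond) /= sum1_count count_tree_reps // scale1r.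
Qed.

(** * Tree sums and their Lie property *)

Section TreeSums.
Variables (F : fieldType) (A : cdga F) (V : cplx F) (R : retract A V) (r : nat).
Hypothesis char0 : [pchar F] =i pred0.
Variables (e : 'I_r -> V) (n : 'I_r -> int).
Hypothesis e_hom : forall i, gpr (n i) (e i) = e i.
Local Notation T := ('I_r).
Local Notation u := (udeg n).
Implicit Types (I J K H : seq T).

(** The homotopy labels internal edges only, and a branch with a single leaf is a leaf. *)
Definition hedge (k : nat) (a : A) : A := if k == 1%N then a else rK R a.

Lemma hedge_linear k : linear (hedge k).
Proof. by rewrite /hedge; case: eqP => // _; exact: rK_linear. Qed.

Lemma tree_edge_leaves t x : tree_edge (rK R) t x = hedge (leaves t) x.
Proof.
case: t => [|a b] //=; rewrite /hedge.
have := leaves_gt0 a; have := leaves_gt0 b.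
by case: eqP => // ? ? ?; lia.
Qed.

Local Notation top := (tree_op (ri R) (@amul F A) (rK R) (@par F V) (fun k _ => k.-1)).

Lemma mlin_top t : mlin (leaves t) (top t).
Proof.
apply: mlin_tree_op; [exact: ri_linear|exact: amul_bilin|exact: rK_linear|].
exact: par_linear.
Qed.

Definition tree_sum (k : nat) (a : seq V) : A := \sum_(t <- ptrees k) top t a.

Lemma mlin_tree_sum k : mlin k (tree_sum k).
Proof.
by apply: mlin_sum_seq => t /ptrees_leaves <-; exact: mlin_top.
Qed.

Lemma iter_par m i : iter m (@par F V) (e i) = ((-1) ^ (n i * m%:Z) : F) *: e i.
Proof.
elim: m => [|m IH]; first by rewrite mulr0 expr0z scale1r.
rewrite iterS IH (linZ _ _ (@par_linear F V)) (par_homog (e_hom i)) scalerA.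
by congr (_ *: _); rewrite -signzD; apply: signz_eq; rewrite !odd_absE; lia.
Qed.

Definition wsum I : int := \sum_(i <- I) n i.

Lemma wsum_cat I J : wsum (I ++ J) = wsum I + wsum J.
Proof. exact: big_cat. Qed.

Lemma wsum_cons i I : wsum (i :: I) = n i + wsum I.
Proof. exact: big_cons. Qed.

Lemma wdegE I : wdeg u I = - wsum I - (size I)%:Z.
Proof.
elim: I => [|i I IH]; first by rewrite /wsum wdeg_nil big_nil.
by rewrite wdeg_cons wsum_cons IH /udeg /=; lia.
Qed.

(** Decomposition at the root. The summand j - 1 of the exponent is the sign of the vertex; the
    other one comes from the sign operators applied to the entries on the left. *)
Lemma tree_sum_rec K : (1 < size K)%N -> tree_sum (size K) (map e K) =
  \sum_(1 <= j < size K) ((-1) ^ (j%:Z - 1 + wsum (take j K) * ((size K)%:Z - j%:Z - 1)) : F) *: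
    amul (hedge j (tree_sum j (map e (take j K))))
         (hedge (size K - j) (tree_sum (size K - j) (map e (drop j K)))).
Proof.
move=> K1; rewrite /tree_sum big_ptrees // !big_seq; apply: eq_bigr => j.
rewrite mem_index_iota => jK; have hl := hedge_linear.
have sumh m (s : seq btree) (G : btree -> A) :
    hedge m (\sum_(t <- s) G t) = \sum_(t <- s) hedge m (G t).
  apply: (big_morph (hedge m)) => [x y|]; first exact: linD.
  exact: lin0 (hl m).
rewrite !sumh (bilin_suml _ _ _ _ (amul_bilin A)) scaler_sumr !big_seq.
apply: eq_bigr => t /ptrees_leaves tj.
rewrite (bilin_sumr _ _ _ _ (amul_bilin A)) scaler_sumr !big_seq.
apply: eq_bigr => t' /ptrees_leaves tj'.
rewrite tree_opN !tree_edge_leaves tj tj' -map_take -map_drop.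
rewrite -map_comp (@eq_map _ _ _ (fun i => ((-1) ^ (n i * (size K - j).-1%:Z) : F) *: e i));
  last by move=> i; exact: iter_par.
rewrite (mlin_scale _ _ (mlin_top t)); last by rewrite size_takel; lia.
rewrite (linZ _ _ (hl j)) (bilinZl _ _ _ (amul_bilin A)) scalerA map_drop.
congr (_ *: _).
have -> : \prod_(i <- take j K) (-1) ^ (n i * (size K - j).-1%:Z)
    = (-1) ^ (wsum (take j K) * (size K - j).-1%:Z) :> F.
  elim: (take j K) => [|i I IH]; first by rewrite big_nil /wsum big_nil mul0r expr0z.
  by rewrite big_cons IH wsum_cons mulrDl signzD.
rewrite -[X in X * _]/((-1) ^ (j.-1%:Z)) -signzD; congr (_ ^ (_ + _ * _)); lia.
Qed.

Lemma bin2D k l : 'C(k + l, 2) = ('C(k, 2) + 'C(l, 2) + k * l)%N.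
Proof.
elim: l => [|l IH]; first by rewrite addn0 muln0 !addn0.
by rewrite addnS !binS !bin1 IH; lia.
Qed.

(* The signs attached to a word by [pairing], by [desus_pow], and by both
   together with those of d_k and Delta_k. *)
Fixpoint pair_sign I : F :=
  if I is i :: I' then (-1) ^ (wsum I' * n i) * pair_sign I' else 1.

Fixpoint desus_sign I : F :=
  if I is i :: I' then (-1) ^ (n i * (size I')%:Z) * desus_sign I' else 1.

Definition word_sign I : F :=
  - ((-1) ^+ 'C(size I, 2) * pair_sign I * desus_sign I *
     (-1) ^ (((size I)%:Z + 1) * wdeg u I)).

Lemma pair_sign_cat I J :
  pair_sign (I ++ J) = pair_sign I * pair_sign J * (-1) ^ (wsum I * wsum J).
Proof.
elim: I => [|i I IH] /=; first by rewrite /wsum big_nil mul0r expr0z mul1r mulr1.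
rewrite IH wsum_cat wsum_cons !mulrDl !signzD (mulrC (n i) (wsum J)); ring.
Qed.

Lemma desus_sign_cat I J :
  desus_sign (I ++ J) = desus_sign I * desus_sign J * (-1) ^ (wsum I * (size J)%:Z).
Proof.
elim: I => [|i I IH] /=; first by rewrite /wsum big_nil mul0r expr0z mul1r mulr1.
rewrite IH size_cat PoszD wsum_cons !mulrDl !mulrDr !signzD; ring.
Qed.

(** The property for which [word_sign] is made: the sign of [tree_sum_rec], which involves lengths,
    becomes one that involves degrees only. After [bin2D] the check depends on four parities. *)
Lemma word_sign_cat I J :
  word_sign (I ++ J) * (-1) ^ ((size I)%:Z - 1 + wsum I * ((size J)%:Z - 1)) =
  word_sign I * word_sign J * (-1) ^ (wdeg u I * (1 + wdeg u J)).
Proof.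
rewrite /word_sign pair_sign_cat desus_sign_cat size_cat bin2D !exprD wdeg_cat.
rewrite -[(-1) ^+ (_ * _)%N]/((-1 : F) ^ ((size I * size J)%N%:Z)) PoszM PoszD.
set k := (size I)%:Z; set l := (size J)%:Z; set a := wsum I; set b := wsum J.
have -> : wdeg u I = - a - k by exact: wdegE.
have -> : wdeg u J = - b - l by exact: wdegE.
rewrite !signzE !odd_absE /=.
by case: (odd `|k|%N); case: (odd `|l|%N); case: (odd `|a|%N); case: (odd `|b|%N) => /=;
  ring.
Qed.

Lemma word_sign1 i : word_sign [:: i] = -1.
Proof.
rewrite /word_sign /= /wsum big_nil mul0r expr0z !mulr1 wdeg1 bin_small // expr0.
by rewrite mulr0 expr0z !mul1r signz_even // odd_absE.
Qed.

(* The signs turn the recursion for tree sums into [wtree_rec], where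
   they depend only on the degrees of the two words. *)
Definition wtree K : A := word_sign K *: tree_sum (size K) (map e K).

Definition wedge K : A := hedge (size K) (wtree K).

Lemma tree_sum0 a : tree_sum 0 a = 0.
Proof. by rewrite /tree_sum /ptrees /= big_nil. Qed.

Lemma wtree_nil : wtree [::] = 0.
Proof. by rewrite /wtree tree_sum0 scaler0. Qed.

Lemma hedge0 k : hedge k 0 = 0.
Proof. exact: lin0 (hedge_linear k). Qed.

Lemma wedge_nil : wedge [::] = 0.
Proof. by rewrite /wedge wtree_nil hedge0. Qed.

Lemma wtree1 i : wtree [:: i] = - ri R (e i).
Proof. by rewrite /wtree word_sign1 /tree_sum big_ptrees1 scaleN1r. Qed.

(** The Koszul sign of moving the word I past [wedge J], whose degree is -1 - |J|. *)
Definition split_sign I J : F := (-1) ^ (wdeg u I * (1 + wdeg u J)).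

Lemma wtree_rec K : (1 < size K)%N -> wtree K =
  \sum_(p <- splits K) split_sign p.1 p.2 *: amul (wedge p.1) (wedge p.2).
Proof.
move=> K1; rewrite (big_splits_sym K (fun I J =>
  split_sign I J *: amul (wedge I) (wedge J))).
rewrite -(big_mkord xpredT (fun j => split_sign (take j K) (drop j K) *:
   amul (wedge (take j K)) (wedge (drop j K)))).
rewrite big_ltn // take0 wedge_nil (bilin0l _ (amul_bilin A)) scaler0 add0r.
rewrite big_nat_recr /=; last lia.
rewrite drop_size wedge_nil (bilin0r _ (amul_bilin A)) scaler0 addr0.
rewrite /wtree tree_sum_rec // scaler_sumr !big_seq; apply: eq_bigr => j.
rewrite mem_index_iota => jK.
have sj : size (take j K) = j by rewrite size_takel; lia.
rewrite /wedge /wtree sj size_drop.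
rewrite (linZ _ _ (hedge_linear _)) (linZ _ _ (hedge_linear _)).
rewrite (bilinZl _ _ _ (amul_bilin A)) (bilinZr _ _ _ (amul_bilin A)) !scalerA.
congr (_ *: _); rewrite -{1}(cat_take_drop j K).
have := word_sign_cat (take j K) (drop j K); rewrite sj size_drop => E.
rewrite (_ : (size K)%:Z - j%:Z - 1 = (size K - j)%N%:Z - 1); last lia.
by rewrite E mulrC mulrA.
Qed.

Lemma amul_gpr a b p q : gpr p a = a -> gpr q b = b ->
  gpr (p + q) (amul a b) = amul a b :> A.
Proof. by move=> <- <-; exact: amul_degree. Qed.

Lemma gpr_sum_hom (M : gmod F) q (X : eqType) (s : seq X) (G : X -> M) :
  (forall x, x \in s -> gpr q (G x) = G x) ->
  gpr q (\sum_(x <- s) G x) = \sum_(x <- s) G x.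
Proof.
by move=> Gq; rewrite linear_sum !big_seq; apply: eq_bigr.
Qed.

(** Together with the word K the coefficient has total degree -1, that of a Maurer-Cartan element.
    For [wtree], before the homotopy is applied, the total degree is -2 on words of two or more
    letters. *)
Lemma wedge_hom K : K != [::] -> gpr (-1 - wdeg u K) (wedge K) = wedge K.
Proof.
have [m] := ubnP (size K); elim: m K => // m IH K Km K0.
have [K1|K1] := leqP (size K) 1%N.
  case: K Km K0 K1 => [|i [|]] // _ _ _; rewrite /wedge /hedge /= wtree1.
  have ei : gpr (n i) (ri R (e i)) = ri R (e i).
    by rewrite -{2}(e_hom i) (ri_degree R) addr0.
  by rewrite wdeg1 (_ : -1 - u i = n i) ?linearN /= ?ei // /udeg; ring.
rewrite /wedge /hedge ifN; last by lia.
rewrite (_ : -1 - wdeg u K = -2 - wdeg u K + 1); last ring.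
rewrite -(rK_degree R); congr (rK R _); rewrite wtree_rec // gpr_sum_hom // => p pK.
rewrite linearZ /=; congr (_ *: _).
have [pe|p1] := eqVneq p.1 [::].
  by rewrite pe wedge_nil (bilin0l _ (amul_bilin A)) linear0.
have [pe|p2] := eqVneq p.2 [::].
  by rewrite pe wedge_nil (bilin0r _ (amul_bilin A)) linear0.
have s1 : (0 < size p.1)%N by case: (p.1) p1.
have s2 : (0 < size p.2)%N by case: (p.2) p2.
have [l1 l2] : (size p.1 < size K)%N /\ (size p.2 < size K)%N.
  by rewrite -(splits_size pK) -{1}[size p.1]addn0 ltn_add2l -{2}[size p.2]add0n ltn_add2r.
rewrite (_ : -2 - wdeg u K = (-1 - wdeg u p.1) + (-1 - wdeg u p.2)); last first.
  by rewrite -(splits_cat pK) wdeg_cat; ring.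
by apply: amul_gpr; apply: IH => //; [apply: leq_trans l1 _|apply: leq_trans l2 _].
Qed.

Lemma wtree_hom K : (1 < size K)%N -> gpr (-2 - wdeg u K) (wtree K) = wtree K.
Proof.
move=> K1; rewrite wtree_rec // gpr_sum_hom // => p pK.
rewrite linearZ /=; congr (_ *: _).
have [pe|p1] := eqVneq p.1 [::].
  by rewrite pe wedge_nil (bilin0l _ (amul_bilin A)) linear0.
have [pe|p2] := eqVneq p.2 [::].
  by rewrite pe wedge_nil (bilin0r _ (amul_bilin A)) linear0.
rewrite (_ : -2 - wdeg u K = (-1 - wdeg u p.1) + (-1 - wdeg u p.2)); last first.
  by rewrite -(splits_cat pK) wdeg_cat; ring.
by apply: amul_gpr; exact: wedge_hom.
Qed.

Lemma wedge_com I J : amul (wedge I) (wedge J) =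
  (-1) ^ ((-1 - wdeg u I) * (-1 - wdeg u J)) *: amul (wedge J) (wedge I) :> A.
Proof.
have [->|I0] := eqVneq I [::].
  by rewrite wedge_nil (bilin0l _ (amul_bilin A)) (bilin0r _ (amul_bilin A)) scaler0.
have [->|J0] := eqVneq J [::].
  by rewrite wedge_nil (bilin0l _ (amul_bilin A)) (bilin0r _ (amul_bilin A)) scaler0.
by rewrite -(wedge_hom I0) -(wedge_hom J0) amul_com.
Qed.

Local Notation wb := (@wb F T u).

(** The A-valued form of [liew], cleared of denominators. *)
Definition lie_tree K :=
  (size K)%:R *: wtree K = \sum_(I <- words T (size K)) (wb I K : F) *: wtree I.

Definition wedge' K : A := (size K)%:R^-1 *: wedge K.

(** Coefficients of the tree sums on nested brackets, built as in [rep_brw]: the left factor is kept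
    and the right one is replaced by its coefficients [wedge']. The factor 1/2 compensates for the
    two orders of the branches, which give equal contributions. *)
Definition ctree_coef K : A :=
  \sum_(p <- splits K) (2%:R^-1 * split_sign p.1 p.2) *: amul (wedge p.1) (wedge' p.2).

Lemma lie_tree_wedge K : lie_tree K ->
  wedge K = \sum_(I <- words T (size K)) (wb I K : F) *: wedge' I.
Proof.
have [->|K0] := eqVneq K [::].
  by rewrite wedge_nil big_words0 => _; rewrite scale0r.
move=> lK; have k0 : (size K)%:R != 0 :> F.
  by move/pcharf0P: char0 => ->; rewrite size_eq0.
rewrite /wedge (_ : wtree K = (size K)%:R^-1 *: ((size K)%:R *: wtree K)); last first.
  by rewrite scalerA mulVf ?scale1r.
rewrite lK (linZ _ _ (hedge_linear _)).
rewrite (big_morph (hedge (size K)) (fun x y => linD x y (hedge_linear _)) (hedge0 _)).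
rewrite scaler_sumr; apply: eq_big_words => I Ik.
by rewrite (linZ _ _ (hedge_linear _)) /wedge' /wedge Ik !scalerA mulrC.
Qed.

Section Target.
Variables (U Z : lmodType F) (br : U -> U -> U) (t : T -> U) (tau : A -> U -> Z).
Hypotheses (brb : bilin br) (tau_bilin : bilin tau).
Hypothesis br_jac : forall i I z, I != [::] ->
  br (br (t i) (nest br t I)) z = br (t i) (br (nest br t I) z)
    - (-1) ^ (u i * wdeg u I) *: br (nest br t I) (br (t i) z).

(* Both the Lie property of the tree sums and their evaluation in A (x) L are
   instances of this identity. *)
Lemma ctree_coefP k :
  (forall K, (size K < k)%N -> lie_tree K) ->
  \sum_(H <- words T k) tau (ctree_coef H) (nest br t H) =
  2%:R^-1 *: \sum_(j < k.+1) \sum_(I <- words T j) \sum_(J <- words T (k - j))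
    split_sign I J *:
      tau (amul (wedge' I) (wedge' J)) (br (nest br t I) (nest br t J)).
Proof.
move=> lieK.
rewrite (@eq_big_words _ _ _ _ _ _ (fun H => \sum_(p <- splits H)
   (2%:R^-1 * split_sign p.1 p.2) *:
   tau (amul (wedge p.1) (wedge' p.2)) (nest br t (p.1 ++ p.2)))); last first.
  move=> H _; rewrite /ctree_coef (bilin_suml _ _ _ _ tau_bilin) !big_seq.
  apply: eq_bigr => p /splits_cat ->.
  by rewrite (bilinZl _ _ _ tau_bilin).
rewrite (big_words_splits k (fun I J => (2%:R^-1 * split_sign I J) *:
   tau (amul (wedge I) (wedge' J)) (nest br t (I ++ J)))).
rewrite scaler_sumr; apply: eq_bigr => j _.
rewrite exchange_big [in RHS]exchange_big /= scaler_sumr.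
apply: eq_big_words => J Jk.
have [->|J0] := eqVneq J [::].
  rewrite /wedge' wedge_nil scaler0.
  rewrite !big1 ?scaler0 // => I _;
    by rewrite (bilin0r _ (amul_bilin A)) (bilin0l _ tau_bilin) scaler0.
have jk : (j < k)%N by case: J Jk J0 => //= _ J; lia.
(* The left factor is expanded by its Lie property; summation over I then turns the products of
   adjoint maps back into the bracket with the nested bracket along H. *)
transitivity (\sum_(I <- words T j) \sum_(H <- words T j)
  (2%:R^-1 * split_sign H J * (wb H I : F)) *:
    tau (amul (wedge' H) (wedge' J)) (nest br t (I ++ J))).
  apply: eq_big_words => I Ij.
  rewrite (lie_tree_wedge (lieK I _)) ?Ij // (bilin_suml _ _ _ _ (amul_bilin A)).
  rewrite (bilin_suml _ _ _ _ tau_bilin) scaler_sumr; apply: eq_bigr => H _.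
  rewrite (bilinZl _ _ _ (amul_bilin A)) (bilinZl _ _ _ tau_bilin) scalerA.
  have [HI|/wb_hom ->] := eqVneq (wdeg u I) (wdeg u H); last by rewrite !mulr0.
  by rewrite /split_sign HI.
rewrite exchange_big scaler_sumr; apply: eq_big_words => H Hj.
rewrite (br_nest brb br_jac) Hj (bilin_sumr _ _ _ _ tau_bilin) !scaler_sumr.
apply: eq_bigr => I _; rewrite (bilinZr _ _ _ tau_bilin) !scalerA.
by rewrite nest_cat.
Qed.

End Target.

(** [ctree_coefP] is applied with word functions as target, paired by evaluation at K. The graded
    commutator has two terms; graded commutativity of A makes their sums equal, which cancels the
    factor 1/2. *)
Lemma ctree_coef_wtree K : (1 < size K)%N ->
  (forall H, (size H < size K)%N -> lie_tree H) ->
  wtree K = \sum_(H <- words T (size K)) (wb H K : F) *: ctree_coef H.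
Proof.
move=> K1 lieK.
pose tau (a : A) (f : seq T -> F^o) : A := (f K : F) *: a.
have tau_bilin : bilin tau.
  split=> [a|f] c x y; rewrite /tau.
    by rewrite wfunD wfunZ scalerDl scalerA.
  by rewrite scalerDr !scalerA mulrC.
have := ctree_coefP (@brw_bilin F T u) tau_bilin
  (fun i I z _ => wb_jac u i I z) lieK.
rewrite /tau -/(wb _) => ->.
have term (I1 I2 : seq T) : (size I1 + size I2)%N = size K ->
  \sum_(j < (size K).+1) \sum_(I <- words T j) \sum_(J <- words T (size K - j))
    (split_sign I J * ((wb I I1 : F) * wb J I2)) *: amul (wedge' I) (wedge' J) =
  split_sign I1 I2 *: amul (wedge I1) (wedge I2).
  move=> sK; have j1 : (size I1 < (size K).+1)%N by rewrite -sK ltnS leq_addr.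
  rewrite (bigD1 (Ordinal j1)) //= [X in _ + X]big1 ?addr0 => [|j jI]; last first.
    rewrite big_seq big1 // => I /words_size Ij; rewrite big1 // => J _.
    rewrite wb_size ?mul0r ?mulr0 ?scale0r // Ij; apply: contraNneq jI => jI.
    exact/eqP/val_inj.
  rewrite -sK addKn.
  have [->|I10] := eqVneq I1 [::].
    rewrite wedge_nil (bilin0l _ (amul_bilin A)) scaler0.
    by rewrite big_words0 big1 // => J _; rewrite mul0r mulr0 scale0r.
  have [->|I20] := eqVneq I2 [::].
    rewrite wedge_nil (bilin0r _ (amul_bilin A)) scaler0.
    by rewrite big1 // => I _; rewrite big_words0 mulr0 mulr0 scale0r.
  have s1 : (0 < size I1)%N by case: (I1) I10.
  have s2 : (0 < size I2)%N by case: (I2) I20.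
  have l1 : (size I1 < size K)%N by lia.
  have l2 : (size I2 < size K)%N by lia.
  rewrite (lie_tree_wedge (lieK I1 l1)) (lie_tree_wedge (lieK I2 l2)).
  rewrite (bilin_suml _ _ _ _ (amul_bilin A)) scaler_sumr; apply: eq_bigr => I _.
  rewrite (bilin_sumr _ _ _ _ (amul_bilin A)) scaler_sumr; apply: eq_bigr => J _.
  rewrite (bilinZl _ (wedge' I) _ (amul_bilin A)) (bilinZr _ _ (wedge' J) (amul_bilin A)).
  rewrite [in RHS]scalerA [in RHS]scalerA.
  have [d1|/wb_hom ->] := eqVneq (wdeg u I1) (wdeg u I); last by rewrite !(mul0r, mulr0) !scale0r.
  have [d2|/wb_hom ->] := eqVneq (wdeg u I2) (wdeg u J); last by rewrite !(mul0r, mulr0) !scale0r.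
  by rewrite /split_sign d1 d2 mulrA.
have -> : \sum_(j < (size K).+1) \sum_(I <- words T j) \sum_(J <- words T (size K - j))
    split_sign I J *: ((brw u (wb I) (wb J) K : F) *: amul (wedge' I) (wedge' J)) =
  \sum_(p <- splits K) (split_sign p.1 p.2 *: amul (wedge p.1) (wedge p.2)) *+ 2.
  transitivity (\sum_(p <- splits K) (
    (\sum_(j < (size K).+1) \sum_(I <- words T j) \sum_(J <- words T (size K - j))
      (split_sign I J * ((wb I p.1 : F) * wb J p.2)) *: amul (wedge' I) (wedge' J))
  - (-1) ^ (wdeg u p.1 * wdeg u p.2) *:
    (\sum_(j < (size K).+1) \sum_(I <- words T j) \sum_(J <- words T (size K - j))
      (split_sign I J * ((wb I p.2 : F) * wb J p.1)) *: amul (wedge' I) (wedge' J)))).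
    under eq_bigr do under eq_bigr do under eq_bigr do
      rewrite brw_def scaler_suml scaler_sumr.
    under eq_bigr do under eq_bigr do rewrite exchange_big.
    under eq_bigr do rewrite exchange_big.
    rewrite exchange_big; apply: eq_bigr => p _ /=.
    rewrite scaler_sumr -sumrB; apply: eq_bigr => j _.
    rewrite scaler_sumr -sumrB; apply: eq_bigr => I _.
    rewrite scaler_sumr -sumrB; apply: eq_bigr => J _.
    rewrite !scalerA -scalerBl; congr (_ *: _); first by ring.
  rewrite !big_seq; apply: eq_bigr => p pK; have sK := splits_size pK.
  rewrite !term //; last by rewrite addnC.
  rewrite [amul (wedge p.2) _]wedge_com !scalerA -scaleNr mulr2n; congr (_ + _ *: _).
  rewrite /split_sign !signzE !odd_absE /=.
  by case: (odd _); case: (odd _); rewrite /=; ring.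
rewrite sumrMnl -wtree_rec // -scaler_nat scalerA mulVf ?scale1r //.
by move/pcharf0P: char0 => ->.
Qed.

(** By induction on the length, the tree sum is a combination of nested brackets, on which [wb_wb]
    acts as multiplication by the length. This is why the dual coproducts take values in Lie
    polynomials. *)
Lemma lie_treeP K : lie_tree K.
Proof.
have [m] := ubnP (size K); elim: m K => // m IH K Km.
have lieK H : (size H < size K)%N -> lie_tree H.
  by move=> HK; apply: IH; apply: leq_trans HK _.
have [K1|K1] := leqP (size K) 1%N.
  case: K Km K1 {lieK} => [|i [|]] // _ _; rewrite /lie_tree.
    by rewrite big_words0 wtree_nil !scaler0.
  rewrite big_words1 (bigD1 i) //= big1 ?addr0 => [|j ji].
    by rewrite /wb /= /genw eqxx.
  by rewrite /wb /= /genw eqseq_cons eq_sym (negPf ji) scale0r.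
rewrite /lie_tree; set k := size K.
rewrite [RHS](@eq_big_words _ _ _ _ _ _ (fun I =>
    \sum_(H <- words T k) ((wb H I : F) * wb I K) *: ctree_coef H)); last first.
  move=> I Ik; rewrite (ctree_coef_wtree _ (K := I)) ?Ik //.
  by rewrite scaler_sumr; apply: eq_bigr => H _; rewrite scalerA mulrC.
rewrite exchange_big /= (ctree_coef_wtree K1 lieK) scaler_sumr.
apply: eq_big_words => H Hk.
by have := @wb_wb F T u H K; rewrite Hk -scaler_suml => ->; rewrite scalerA.
Qed.

End TreeSums.

(** * The differential of the free Lie algebra *)

Section Differential.
Variables (F : fieldType) (A : cdga F) (V : cplx F) (R : retract A V) (r : nat).
Hypothesis char0 : [pchar F] =i pred0.
Variables (e : 'I_r -> V) (n : 'I_r -> int) (es : 'I_r -> dual V).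
Hypothesis e_hom : forall i, gpr (n i) (e i) = e i.
Hypothesis es_e : forall i j, es i (e j) = (i == j)%:R.
Hypothesis e_exp : forall v, v = \sum_i es i v *: e i.
Hypothesis es_gpr : forall i q v, q != n i -> es i (gpr q v) = 0.
Local Notation T := ('I_r).
Local Notation u := (udeg n).
Local Notation W := (desus (dualg V)).
Local Notation evd := (evd e).
Local Notation coefV := (@tcoef F (dualg V) T evd).
Local Notation coefW := (@tcoef F W T evd).
Implicit Types (I J K : seq T).

Let es_hom := es_homV es_gpr.

Lemma cinf_tree_sum k a : (1 < k)%N -> cinf R k a = rp R (tree_sum R k a).
Proof.
case: k => [|[|k]] // _; have rp0 : rp R 0 = 0.
  exact: lin0 (rp_linear R).
by rewrite /tree_sum (big_morph _ (fun x y => linD x y (rp_linear R)) rp0).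
Qed.

Lemma mlin_cinf k : mlin k (cinf R k).
Proof.
case: k => [|[|k]] //.
  by split=> // a _ c x y; exact: cd_linear.
apply: (@mlin_ext _ _ _ _ (fun a => rp R (tree_sum R k.+2 a))).
  by move=> a _; rewrite cinf_tree_sum.
by apply: mlin_comp; [exact: rp_linear|exact: mlin_tree_sum].
Qed.

Lemma pairing_form_bilin k (f : dualg V) (a : seq V) :
  linear (fun t : tpow (dualg V) k => pairing t a) ->
  bilin (fun (v : tpow (dualg V) k) (x : V) => (f x : F) *: pairing v a).
Proof.
move=> pl; split=> [v|x] c y z.
  by rewrite linearP scalerDl -scalerA.
by rewrite pl scalerDr !scalerA mulrC.
Qed.

Lemma pairing_step_bilin k (a : seq V) (x : V) :
  linear (fun t : tpow (dualg V) k => pairing t a) ->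
  bilin (fun (f : dualg V) (v : tpow (dualg V) k) =>
    kos (fun (v : tpow (dualg V) k) (x : V) => (f x : F) *: pairing v a) v x).
Proof.
move=> pl; split=> [f|v] c y z /=.
  exact: (kos_bilin (pairing_form_bilin f pl)).2.
rewrite -kos_lin; [|exact: pairing_form_bilin|exact: pairing_form_bilin].
congr (kos _ v x); apply/funext => w; apply/funext => b.
by rewrite scalerA -scalerDl.
Qed.

Lemma pairing_linear k a : linear (fun t : tpow (dualg V) k => pairing t a).
Proof.
elim: k a => [|k IH] a //; apply: tlift_linear.
exact: pairing_step_bilin (IH _).
Qed.

Lemma pairing_pure k (f : dualg V) (v : tpow (dualg V) k) x a :
  pairing (k := k.+1) (tpure f v) (x :: a) =
  kos (fun (v : tpow (dualg V) k) (x : V) => (f x : F) *: pairing v a) v x.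
Proof. exact: (tlift_pure _ _ (pairing_step_bilin x (@pairing_linear k a))). Qed.

Lemma pairing_cons k (t : tpow (dualg V) k.+1) x a : pairing t (x :: a) =
  \sum_(p <- repr t)
    kos (fun (v : tpow (dualg V) k) (x : V) => (p.1 x : F) *: pairing v a) p.2 x.
Proof. by []. Qed.

Lemma mlin_pairing k (t : tpow (dualg V) k) : mlin k (pairing t).
Proof.
elim: k t => [//|k IH] t; split=> [a ak c x y|v].
  rewrite !pairing_cons scaler_sumr -big_split; apply: eq_bigr => p _.
  exact: (kos_bilin (pairing_form_bilin p.1 (@pairing_linear k a))).1.
apply: (@mlin_ext _ _ _ _ (fun a => \sum_(p <- repr t)
    kos (fun (v : tpow (dualg V) k) (x : V) => (p.1 x : F) *: pairing v a) p.2 v)) => //.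
apply: mlin_sum => p; have [s ps] := gpr_supp p.2; have [s' vs] := gpr_supp v.
apply: (@mlin_ext _ _ _ _ (fun a => \sum_(m <- undup s) \sum_(q <- undup s')
    (-1) ^ (m * q) *: ((p.1 (gpr q v) : F) *: pairing (gpr m p.2) a))) => [a _|].
  have fb := pairing_form_bilin p.1 (@pairing_linear k a).
  by rewrite (kos_supp _ _ ps vs) // => z; [exact: (bilin0l z fb)|exact: (bilin0r z fb)].
apply: mlin_sum => m; apply: mlin_sum => q.
apply: (@mlin_comp _ _ _ _ (fun x : F^o => (-1) ^ (m * q) *: ((p.1 (gpr q v) : F) *: x))).
  by move=> c x y; rewrite !scalerDr !scalerA; congr (_ *: _ + _); ring.
exact: IH.
Qed.

Definition coefV_pure := @tcoef_pure F (dualg V) T evd (evd_lin e).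
Definition coefV_gpr := @tcoef_gpr F (dualg V) T es evd (fun i => - n i)
  (evd_lin e) (evd_exp e_exp) (evd_es es_e) es_hom.

Lemma wdegN I : wdeg (fun i => - n i) I = - wsum n I.
Proof. by rewrite /wdeg /wsum sumrN. Qed.

Lemma pairing_basis k (t : tpow (dualg V) k) I : size I = k ->
  pairing t (map e I) = (pair_sign F n I : F) * coefV t I :> F.
Proof.
elim: k t I => [|k IH] t I; first by move=> /size0nil->; rewrite mul1r.
case: I => // i I [Ik]; elim/tens_ind: t => [|x y IHx IHy|a b f v].
- have -> : pairing (0 : tpow (dualg V) k.+1) (map e (i :: I)) = 0.
    exact: lin0 (@pairing_linear k.+1 (map e (i :: I))).
  by rewrite [X in _ * X](@tcoef0 F (dualg V) T evd (evd_lin e) k.+1) mulr0.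
- rewrite (linD x y (@pairing_linear k.+1 (map e (i :: I)))) IHx IHy.
  by rewrite (linD x y (@tcoef_linear F (dualg V) T evd (evd_lin e) k.+1 _)) mulrDr.
rewrite [map e _]/= pairing_pure.
have fb := pairing_form_bilin (gpr a f) (@pairing_linear k (map e I)).
rewrite (@kos_homog _ _ _ _ _ b (n i)) //; first last.
- by rewrite gprK eqxx.
- by move=> x; exact: bilin0r fb.
- by move=> x; exact: bilin0l fb.
rewrite IH // coefV_pure coefV_gpr // wdegN.
have [->|_] := eqVneq b (- wsum n I); last first.
  by rewrite !mulr0 !(scaler0, mulr0).
rewrite /= /GRing.scale /= (_ : (-1) ^ (- wsum n I * n i) = (-1) ^ (wsum n I * n i) :> F).
  by rewrite /evd; ring.
by apply: signz_eq; rewrite !odd_absE.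
Qed.

Lemma pair_signK I : pair_sign F n I * pair_sign F n I = 1.
Proof.
elim: I => [|i I IH] /=; first by rewrite mulr1.
by rewrite mulrACA IH signzMK mulr1.
Qed.

Lemma desus_signK I : desus_sign F n I * desus_sign F n I = 1.
Proof.
elim: I => [|i I IH] /=; first by rewrite mulr1.
by rewrite mulrACA IH signzMK mulr1.
Qed.

Lemma word_signK I : word_sign F n I * word_sign F n I = 1.
Proof.
rewrite /word_sign mulrNN; set c := (-1) ^+ _; set s := (-1) ^ _.
set p := pair_sign _ _ _; set q := desus_sign _ _ _.
transitivity ((c * c) * (p * p) * (q * q) * (s * s)); first ring.
by rewrite pair_signK desus_signK signzMK -expr2 sqrr_sign !mul1r.
Qed.

(** [delta] is chosen by its pairing property, so a tensor with this property has to be produced: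
    [t0] is built from the required values on basis words. *)
Lemma coef_delta k (f : dualg V) I : size I = k ->
  coefV (delta R k f) I =
  pair_sign F n I * (iter k (@par F (dualg V)) f (cinf R k (map e I)) : F) :> F.
Proof.
move=> Ik; set g := iter k _ f.
pose t0 := @mkt F (dualg V) T es k (fun I => pair_sign F n I * (g (cinf R k (map e I)) : F)).
have : exists t : tpow (dualg V) k, forall a : seq V, size a = k ->
    pairing t a = g (cinf R k a).
  exists t0 => a; apply: (@mlin_expand F V F^o T e (fun i v => es i v) k (pairing t0)
    (fun a => g (cinf R k a)) e_exp).
  - exact: mlin_pairing.
  - by apply: mlin_comp (mlin_cinf k); exact: dual_linear.
  move=> J Jk; rewrite pairing_basis //.
  rewrite (@tcoef_mkt F (dualg V) T es evd (evd_lin e) (evd_es es_e)) //.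
  by rewrite mulrA pair_signK mul1r.
move=> /(xgetPex 0) /(_ (map e I)); rewrite size_map -/(delta R k f) => /(_ Ik) E.
rewrite -[LHS]mul1r -(pair_signK I) -mulrA -pairing_basis //.
by rewrite [pairing _ _]E.
Qed.

Lemma evd_iter_par m i (f : dualg V) :
  evd i (iter m (@par F (dualg V)) f) = (-1) ^ (n i * m%:Z) * (evd i f : F) :> F.
Proof.
elim: m => [|m IH]; first by rewrite mulr0 expr0z mul1r.
rewrite iterS (evd_par es_e e_exp es_gpr) IH mulrA; congr (_ * _).
by rewrite -signzD; apply: signz_eq; rewrite !odd_absE; lia.
Qed.

Lemma iter_par_linear m : linear (iter m (@par F (dualg V))).
Proof.
by elim: m => // m IH c x y; rewrite !iterS IH; exact: par_linear.
Qed.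

Lemma desus_step_bilin k : linear (@desus_pow F V k) ->
  bilin (fun (f : dualg V) (v : tpow (dualg V) k) =>
    tpure (iter k (@par F (dualg V)) f : W) (desus_pow v)).
Proof.
move=> dl; split=> [f|v] c x y /=; first by rewrite dl (tpure_bilin _ _).1.
by rewrite iter_par_linear; exact: (tpure_bilin _ _).2.
Qed.

Lemma desus_pow_linear k : linear (@desus_pow F V k).
Proof.
by elim: k => // k IH; apply: tlift_linear; exact: desus_step_bilin.
Qed.

Lemma coef_desus k (t : tpow (dualg V) k) I : size I = k ->
  coefW (desus_pow t) I = desus_sign F n I * (coefV t I : F) :> F.
Proof.
elim: k t I => [|k IH] t I; first by move=> /size0nil->; rewrite mul1r.
case: I => // i I [Ik]; elim/tens_ind: t => [|x y IHx IHy|a b f v].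
- have -> : desus_pow (0 : tpow (dualg V) k.+1) = 0.
    exact: lin0 (@desus_pow_linear k.+1).
  rewrite [X in _ * X](@tcoef0 F (dualg V) T evd (evd_lin e) k.+1) mulr0.
  exact: (@tcoef0 F W T evd (evd_lin e) k.+1).
- rewrite (linD x y (@desus_pow_linear k.+1)).
  rewrite (linD _ _ (@tcoef_linear F W T evd (evd_lin e) k.+1 _)) IHx IHy.
  by rewrite (linD x y (@tcoef_linear F (dualg V) T evd (evd_lin e) k.+1 _)) mulrDr.
rewrite [desus_pow _](tlift_pure _ _ (desus_step_bilin (@desus_pow_linear k))).
rewrite (@tcoef_pure F W T evd (evd_lin e)) coefV_pure IH //= evd_iter_par Ik.
by ring.
Qed.

Local Notation cf := (cf e).

Lemma cf_sd_gen (w : W) K : K != [::] -> cf (sd_gen R w) K =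
  - (-1) ^+ 'C(size K, 2) * desus_sign F n K * pair_sign F n K *
    (iter (size K) (@par F (dualg V)) w (cinf R (size K) (map e K)) : F) :> F.
Proof.
move=> K0; rewrite /cf /sd_gen.
have [k Kk] : exists k, size K = k.+1 by case: K K0 => // i K _; exists (size K).
rewrite Kk (linZ _ _ (@tcoef_linear F W T evd (evd_lin e) k.+1 K)).
rewrite coef_desus // coef_delta //.
by rewrite -!mulrA.
Qed.

Lemma cf_sd_gen_nil (w : W) : cf (sd_gen R w) [::] = 0.
Proof. by []. Qed.

Lemma sd_gen_linear : linear (@sd_gen F A V R).
Proof.
move=> c x y; apply: (cf_inj e_exp); rewrite cf_linear; apply/funext => K.
have [->|K0] := eqVneq K [::].
  by rewrite wfunD wfunZ !cf_sd_gen_nil mulr0 addr0.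
rewrite wfunD wfunZ !cf_sd_gen // iter_par_linear.
rewrite -[dual_val _ _]/(c * (dual_val (iter (size K) (@par F (dualg V)) x) _ : F) + dual_val (iter (size K) (@par F (dualg V)) y) _ : F).
by ring.
Qed.

Definition gen_diff (i : T) : seq T -> F^o := cf (sd_gen R (es i : W)).

Lemma iter_par_es m i : iter m (@par F (dualg V)) (es i) = ((-1) ^ (n i * m%:Z) : F) *: es i.
Proof.
elim: m => [|m IH]; first by rewrite mulr0 expr0z scale1r.
rewrite iterS IH (linZ _ _ (@par_linear F (dualg V))) (par_homog (es_hom i)) scalerA.
by congr (_ *: _); rewrite -signzD; apply: signz_eq; rewrite !odd_absE; lia.
Qed.

Lemma dual_scale c (f : dual V) v : (c *: f) v = c * (f v : F) :> F.
Proof. by []. Qed.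

Lemma gen_diff1 i j : gen_diff i [:: j] = - ((-1) ^ n i * (es i (cd (e j)) : F)) :> F.
Proof.
rewrite /gen_diff cf_sd_gen // iter_par_es dual_scale /= bin_small // expr0.
by rewrite /wsum big_nil mul0r mulr0 expr0z !mulr1 mulN1r.
Qed.

Lemma es_hom_neq i q v : gpr q v = v -> q != n i -> es i v = 0.
Proof. by move=> <- /es_gpr ->. Qed.

Local Notation wtree := (wtree R e n).

Lemma rp_wtree_hom K : (1 < size K)%N ->
  gpr (-2 - wdeg u K) (rp R (wtree K)) = rp R (wtree K).
Proof.
by move=> K1; rewrite -{2}(wtree_hom R e_hom K1) (rp_degree R) addr0.
Qed.

(** All signs but one are absorbed by [word_sign], which is its own inverse. *)
Lemma gen_diffE i K : (1 < size K)%N ->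
  gen_diff i K = (-1) ^ (u i - 1) * (es i (rp R (wtree K)) : F) :> F.
Proof.
move=> K1; have K0 : K != [::] by case: K K1.
rewrite /gen_diff cf_sd_gen // iter_par_es cinf_tree_sum //.
rewrite dual_scale.
have : rp R (wtree K) = word_sign F n K *: rp R (tree_sum R (size K) (map e K)).
  exact: linZ (rp_linear R).
move=> /(congr1 (fun v => word_sign F n K * (es i v : F))).
rewrite (linZ _ _ (dual_linear (es i))) [_ *: _]/(_ * _) mulrA word_signK mul1r => <-.
(* The form e_i^# sees a single degree. There |K| = |s^{-1} e_i^#| - 1, which identifies the sign of
   Delta_k with the last factor of [word_sign] up to (-1)^|K|. *)
have [d|d] := eqVneq (-2 - wdeg u K) (n i); last first.
  by rewrite (es_hom_neq (rp_wtree_hom K1) d) !mulr0.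
have -> : (-1) ^ (n i * (size K)%:Z) = (-1) ^ (wdeg u K * (size K)%:Z) :> F.
  by rewrite -d; apply: signz_eq; rewrite !odd_absE.
have -> : u i - 1 = wdeg u K by rewrite {1}/udeg -d; ring.
rewrite /word_sign.
have -> : (-1) ^ (((size K)%:Z + 1) * wdeg u K) =
    (-1) ^ (wdeg u K * (size K)%:Z) * (-1) ^ wdeg u K :> F.
  by rewrite -signzD; apply: signz_eq; rewrite !odd_absE /=; case: odd; case: odd.
set x := es i _; set p := pair_sign _ _ _; set q := desus_sign _ _ _.
set c := (-1) ^+ _; set s := (-1) ^ (_ * _); set s' := (-1) ^ _.
transitivity ((c * c) * (p * p) * (q * q) * (s * s) * (s' * x)); first ring.
by rewrite pair_signK desus_signK signzMK -expr2 sqrr_sign !mul1r.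
Qed.

Lemma gen_diff_nil i : gen_diff i [::] = 0.
Proof. exact: cf_sd_gen_nil. Qed.

Lemma gen_diff_hom i : homw u (u i - 1) (gen_diff i).
Proof.
move=> K Kd; have [K1|K1] := leqP (size K) 1%N.
  case: K Kd K1 => [|j [|]] // Kd _.
  rewrite gen_diff1 (_ : es i (cd (e j)) = 0) ?mulr0 ?oppr0 //.
  apply: (@es_hom_neq i (n j - 1)).
    by rewrite -{2}(e_hom j) cd_degree.
  by apply: contraNneq Kd; rewrite wdeg1 /udeg => <-; apply/eqP; ring.
rewrite gen_diffE // (es_hom_neq (rp_wtree_hom K1)) ?mulr0 //.
by apply: contraNneq Kd; rewrite /udeg => <-; apply/eqP; ring.
Qed.

(** The part of length one is a combination of generators; from length two on, the linear form e_i^#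
    o p carries the Lie property of [lie_treeP] from A to the field. *)
Lemma liew_gen_diff i : liew u (gen_diff i).
Proof.
apply: liew_local => k.
case: k => [|[|k]].
- exists 0; first exact: liew0.
  by move=> J /size0nil->; rewrite gen_diff_nil.
- exists (\sum_j (gen_diff i [:: j] : F) *: genw F j).
    apply: (big_ind (liew u)) => [|? ?|j _]; [exact: liew0|exact: liewD|].
    by apply: liewZ; exact: (@liew_wb F T u char0 [:: j]).
  case=> [|j [|]] // _; rewrite fct_sumE (bigD1 j) //= big1 => [|l lj].
    by rewrite wfunE /genw eqxx mulr1 addr0.
  by rewrite wfunE /genw eqseq_cons eq_sym (negPf lj) mulr0.
pose g : seq T -> F^o := fun K => (es i (rp R (wtree K)) : F).
have gl : liew u g.
  move=> J; have [->|J0] := eqVneq J [::].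
    rewrite big_words0 dynk_nil mul0r /g wtree_nil.
    have -> : rp R 0 = 0 by exact: lin0 (rp_linear R).
    exact: linear0.
  have k0 : (size J)%:R != 0 :> F by rewrite natr_neq0 // size_eq0.
  apply: (mulfI k0); rewrite mulr_sumr.
  have E := lie_treeP R char0 e_hom J; rewrite /lie_tree in E.
  pose phi (a : A) : F := es i (rp R a).
  have phiZ c a : phi (c *: a) = c * phi a.
    by rewrite /phi (linZ _ _ (rp_linear R)) (linZ _ _ (dual_linear (es i))).
  have phi0 : phi 0 = 0 by rewrite -(scale0r 0) phiZ mul0r.
  have phiD : {morph phi : a b / a + b}.
    by move=> a b; rewrite /phi (linD _ _ (rp_linear R)) (linD _ _ (dual_linear (es i))).
  rewrite -[LHS]phiZ E (big_morph phi phiD phi0); apply: eq_big_words => I Ij.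
  by rewrite phiZ /dynk Ij !mulrA divff // mul1r mulrC.
exists ((-1) ^ (u i - 1) *: g); first exact: liewZ.
by move=> J Jk; rewrite gen_diffE ?Jk.
Qed.

Local Notation sdw := (sdw u gen_diff).

Lemma cf_sd_gen_exp w : cf (sd_gen R w) = \sum_i (evd i w : F) *: gen_diff i.
Proof.
have s0 : sd_gen R 0 = 0 by exact: (lin0 sd_gen_linear).
rewrite {1}(evd_exp e_exp w) (big_morph _ (fun x y => linD x y sd_gen_linear) s0).
rewrite cf_sum; apply: eq_bigr => i _.
by rewrite (linZ _ _ sd_gen_linear) cfZ.
Qed.

Lemma smul_linl (g : series V) : linear (fun f : series V => smul f g).
Proof.
move=> c x y; apply: (cf_inj e_exp).
by rewrite cf_linear !cf_smul cf_linear mulwDl mulwZl.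
Qed.

Lemma smul_linr (f : series V) : linear (smul f).
Proof.
move=> c x y; apply: (cf_inj e_exp).
by rewrite cf_linear !cf_smul cf_linear mulwDr mulwZr.
Qed.

Lemma sinj_linear k : linear (@sinj F V k).
Proof.
move=> c x y; apply: (cf_inj e_exp); rewrite cf_linear; apply/funext => I.
rewrite wfunD wfunZ !cf_sinj; case: eqP => _; last by rewrite mulr0 addr0.
exact: (@tcoef_linear F W T evd (evd_lin e) k I).
Qed.

Lemma sgen_linear : linear (@sgen F V).
Proof.
by move=> c x y; rewrite /sgen (tpure_bilin _ _).2; exact: (@sinj_linear 1).
Qed.

Lemma sd_step_bilin k : linear (@sd_pow F A V R k) ->
  bilin (fun (w : W) (t : tpow W k) =>
    smul (sd_gen R w) (sinj t) + smul (sgen (par w)) (sd_pow R t)).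
Proof.
move=> dl; split=> [w|t] c x y /=.
  by rewrite sinj_linear dl !smul_linr scalerDr addrACA.
rewrite sd_gen_linear (@par_linear F W) sgen_linear !smul_linl.
by rewrite scalerDr addrACA.
Qed.

Lemma sd_pow_linear k : linear (@sd_pow F A V R k).
Proof.
elim: k => [|k IH]; first by move=> c x y; rewrite /= scaler0 addr0.
by apply: tlift_linear; exact: sd_step_bilin.
Qed.

Lemma sinj_pure k (w : W) (t : tpow W k) :
  sinj (n := k.+1) (tpure w t) = smul (sgen w) (sinj t).
Proof.
apply: (cf_inj e_exp); rewrite cf_smul; apply/funext => -[|i I].
  by rewrite mulw_nil cf_sinj cf_sgen fct_sumE big1 ?mul0r // => j _; rewrite wfunE mulr0.
rewrite cf_sgen (bilin_suml (f := @mulw F T)); last first.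
  by split=> [f|f] c x y /=; rewrite ?mulwDl ?mulwDr ?mulwZl ?mulwZr.
rewrite fct_sumE (bigD1 i) //= [X in _ + X]big1 => [|j ji].
  rewrite mulwZl wfunE mulw_genl eqxx addr0 !cf_sinj eqSS.
  by case: eqP => _; [exact: (@tcoef_pure F W T evd (evd_lin e))|rewrite mulr0].
by rewrite mulwZl wfunE mulw_genl eq_sym (negPf ji) mulr0.
Qed.

Lemma cf_sgen_par w : cf (sgen (par w)) = twist u 1 (cf (sgen w)).
Proof.
rewrite !cf_sgen; apply/funext => I; rewrite /twist !fct_sumE mulr_sumr.
apply: eq_bigr => i _; rewrite !wfunE (evW_par es_e e_exp es_gpr) mul1r.
by rewrite /genw; case: eqP => [->|_]; rewrite ?mulr0 // wdeg1 !mulr1.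
Qed.

Lemma cf_sd_pow k (t : tpow W k) : cf (sd_pow R t) = sdw (cf (sinj t)).
Proof.
elim: k t => [|k IH] t.
  rewrite cf0 sdw_unit // => i; apply/funext => I.
  by rewrite /shiftw cf_sinj.
elim/tens_ind: t => [|x y IHx IHy|a b w v].
- have -> : sd_pow R (0 : tpow W k.+1) = 0.
    exact: lin0 (@sd_pow_linear k.+1).
  have -> : sinj (0 : tpow W k.+1) = 0.
    exact: lin0 (@sinj_linear k.+1).
  by rewrite cf0 sdw0.
- rewrite (linD x y (@sd_pow_linear k.+1)) (linD x y (@sinj_linear k.+1)).
  by rewrite !cfD IHx IHy sdwD.
rewrite [sd_pow R _](tlift_pure _ _ (sd_step_bilin (@sd_pow_linear k))).
rewrite cfD !cf_smul IH cf_sgen_par sinj_pure cf_smul sdw_mulw; last exact: gen_diff_nil.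
congr (mulw _ _ + _); rewrite cf_sd_gen_exp cf_sgen sdw_sum.
by apply: eq_bigr => i _; rewrite sdwZ sdw_gen //; exact: gen_diff_nil.
Qed.

(** In length m, [sd] uses only the components of f up to length m; these suffice because the
    derivation does not shorten words. *)
Lemma cf_sd f : cf (sd R f) = sdw (cf f).
Proof.
apply/funext => K.
have -> : cf (sd R f) K = (\sum_(k < (size K).+1) cf (sd_pow R (f k))) K.
  rewrite fct_sumE /cf /sd.
  exact: (@tcoef_sum F W T evd (evd_lin e)).
under eq_bigr do rewrite cf_sd_pow.
rewrite -sdw_sum; apply: (@sdw_eq F T u gen_diff gen_diff_nil) => J JK.
have JK' : (size J < (size K).+1)%N by [].
rewrite fct_sumE (bigD1 (Ordinal JK')) //= big1 => [|k kJ].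
  by rewrite cf_sinj eqxx addr0.
rewrite cf_sinj; case: eqP => // Jk; case/eqP: kJ.
exact/val_inj.
Qed.

Lemma lie_poly_cf f : lie_poly f -> liew u (cf f) /\ fdeg n (cf f).
Proof.
have fd0 : fdeg n (0 : seq T -> F^o) by exists [::].
elim=> [w||c f' g _ [fl fd] _ [gl gd]|f' g _ [fl fd] _ [gl gd]].
- rewrite cf_sgen; split.
    apply: (big_ind (liew u)) => [|? ?|j _]; [exact: liew0|exact: liewD|].
    by apply: liewZ; exact: (@liew_wb F T u char0 [:: j]).
  exists [seq u i | i <- enum T] => I Is; rewrite fct_sumE big1 // => i _.
  rewrite wfunE /genw; case: eqP => [IE|_]; last by rewrite mulr0.
  by case/negP: Is; rewrite IE wdeg1 map_f // mem_enum.
- by rewrite cf0; split=> //; exact: liew0.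
- rewrite cf_linear; split; first by apply: liewD => //; exact: liewZ.
  case: fd => s fs; case: gd => t gt; exists (s ++ t) => I.
  rewrite mem_cat negb_or => /andP[/fs fI /gt gI].
  by rewrite wfunD wfunZ fI gI mulr0 addr0.
- rewrite (cf_sbr es_e e_exp es_gpr fd gd); split; first exact: liew_brw.
  exact: fdeg_brw.
Qed.

Definition nested_series I : series V := nest (@sbr F V) (fun i => sgen (es i : W)) I.

Lemma nested_seriesP I :
  lie_poly (nested_series I) /\ cf (nested_series I) = wb F u I.
Proof.
elim: I => [|i I [IHp IHc]]; first by split; [exact: LieZero|exact: cf0].
have [->|I0] := eqVneq I [::].
  by split; [exact: LieGen|exact: (cf_sgen_es es_e)].
rewrite /nested_series /wb !nest_cons //; split.
  by apply: LieBr => //; exact: LieGen.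
have [_ gd] := lie_poly_cf (LieGen (es i : W)).
have [_ pd] := lie_poly_cf IHp.
by rewrite (cf_sbr es_e e_exp es_gpr gd pd) (cf_sgen_es es_e) IHc.
Qed.

(** The nested brackets of length at most m with coefficients [dynk] form a Lie polynomial that
    approximates f. In the other direction, [liew] can be checked one length at a time. *)
Lemma lie_seriesP f : f \in @lie_series_pred F V <-> liew u (cf f) /\ fdeg n (cf f).
Proof.
split=> [/asboolP[fP fd]|[fl fd]]; last first.
  apply/asboolP; split; last exact/(fdeg_sproj es_e e_exp es_gpr).
  move=> m; exists (\sum_(k < m.+1) \sum_(I <- words T k) (dynk (cf f) I : F) *: nested_series I).
    have add (g h : series V) : lie_poly g -> lie_poly h -> lie_poly (g + h).
      by move=> gP hP; rewrite -[g]scale1r; exact: LieLin.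
    apply: (big_ind (@lie_poly F V)) => [|? ? |k _]; [exact: LieZero|exact: add|].
    apply: (big_ind (@lie_poly F V)) => [|? ? |I _]; [exact: LieZero|exact: add|].
    rewrite -[_ *: _]addr0; apply: LieLin; last exact: LieZero.
    exact: (nested_seriesP I).1.
  move=> k km; apply: (cf_eq_at e_exp) => J Jk.
  rewrite cf_sum fct_sumE.
  have km' : (k < m.+1)%N by [].
  rewrite (bigD1 (Ordinal km')) //= [X in _ + X]big1 ?addr0 => [|l lk]; last first.
    rewrite cf_sum fct_sumE big_seq big1 // => I /words_size Il.
    rewrite cfZ wfunE (nested_seriesP I).2 wb_size ?mulr0 // Jk Il.
    by apply: contraNneq lk => lk; exact/eqP/val_inj.
  rewrite cf_sum fct_sumE fl Jk; apply: eq_bigr => I _.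
  by rewrite cfZ wfunE (nested_seriesP I).2.
split; last exact/(fdeg_sproj es_e e_exp es_gpr).
apply: liew_local => k; have [g gP fg] := fP k.
exists (cf g); first by have [] := lie_poly_cf gP.
by move=> J Jk; rewrite !(cfE _ _ Jk) fg.
Qed.

Lemma sbr_lie (f g : lie_series V) : sbr f g \in @lie_series_pred F V.
Proof.
have /lie_seriesP[fl fd] := lie_valP f; have /lie_seriesP[gl gd] := lie_valP g.
apply/lie_seriesP; rewrite (cf_sbr es_e e_exp es_gpr fd gd).
by split; [exact: liew_brw|exact: fdeg_brw].
Qed.

Lemma fdeg_sdw f : fdeg n f -> fdeg n (sdw f).
Proof.
move=> [s fs]; exists [seq q - 1 | q <- s] => I Is.
apply: (sdw_supp gen_diff_hom (D := [in s])) => //.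
by apply: contra Is => Is; apply/mapP; exists (wdeg u I + 1); rewrite ?addrK.
Qed.

Lemma sd_lie (f : lie_series V) : sd R f \in @lie_series_pred F V.
Proof.
have /lie_seriesP[fl fd] := lie_valP f.
apply/lie_seriesP; rewrite cf_sd; split; last exact: fdeg_sdw.
exact: (liew_sdw char0 gen_diff_nil gen_diff_hom liew_gen_diff fl).
Qed.

End Differential.

Arguments lcs_pred : simpl never.

(** * Morphisms to a complete DGL *)

Section LowerCentral.
Variables (F : fieldType) (L : dgl F).
Local Notation br := (@lbr F L).
Local Notation mod n := (qpi (lcs L n)).
Local Notation lcsp n := (@lcs_pred F L n).

Lemma qpi_eqP (M : gmod F) (N : gsub M) x y :
  qpi N x = qpi N y <-> x - y \in gsub_pred N.
Proof. by split=> [/eqmodP//|]; exact: qpi_eq. Qed.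

Lemma mod0P n x : mod n x = 0 <-> x \in lcsp n.
Proof. by rewrite -[0](linear0 (mod n)) qpi_eqP subr0. Qed.

Lemma lcsD n x y :
  x \in lcsp n -> y \in lcsp n -> x + y \in lcsp n.
Proof. by rewrite -!mod0P linearD /= => -> ->; rewrite addr0. Qed.

Lemma lcsZ n c x : x \in lcsp n -> c *: x \in lcsp n.
Proof. by rewrite -!mod0P linearZ /= => ->; rewrite scaler0. Qed.

Lemma lcs0 n : 0 \in lcsp n.
Proof. by rewrite -mod0P linear0. Qed.

Lemma lcs_sum n (X : eqType) (s : seq X) (P : pred X) (G : X -> L) :
  (forall x, x \in s -> G x \in lcsp n) -> \sum_(x <- s | P x) G x \in lcsp n.
Proof.
move=> Gn; rewrite big_seq_cond; apply: (big_ind [in lcsp n]); [exact: lcs0|exact: lcsD|].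
by move=> x /andP[/Gn].
Qed.

Lemma lcsS_br n x y : y \in lcsp n.+1 -> br x y \in lcsp n.+2.
Proof.
move=> yn; apply/asboolP; exists [:: (x, y)]; rewrite big_seq1; split=> // p.
by rewrite inE => /eqP->.
Qed.

Lemma lcsSP n x : x \in lcsp n.+2 -> exists s : seq (L * L),
  (forall p, p \in s -> p.2 \in lcsp n.+1) /\ x = \sum_(p <- s) br p.1 p.2.
Proof. by move=> /asboolP. Qed.

Lemma lcs_leS n x : x \in lcsp n.+1 -> x \in lcsp n.
Proof.
elim: n x => [//|[//|n] IH] x /lcsSP[s [sP ->]].
by apply: lcs_sum => p /sP /IH; exact: lcsS_br.
Qed.

Lemma lcs_le m n x : (m <= n)%N -> x \in lcsp n -> x \in lcsp m.
Proof.
by elim: n => [|n IH]; [case: m|rewrite leq_eqVlt => /orP[/eqP->//|/IH mn /lcs_leS/mn]].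
Qed.

Lemma lcs_brr n x y : y \in lcsp n -> br x y \in lcsp n.
Proof.
case: n => [//|[//|n]] /lcs_leS; exact: lcsS_br.
Qed.

Lemma lbr_hom m k (x y : L) : gpr m x = x -> gpr k y = y ->
  br x y = - ((-1) ^ (m * k) *: br y x).
Proof. by move=> <- <-; exact: lbr_anti. Qed.

(** L^n is graded, and homogeneous arguments may be exchanged up to a sign. *)
Lemma lcs_brl n x y : y \in lcsp n -> br y x \in lcsp n.
Proof.
move=> yn; have [s xs] := gpr_supp x; have [t yt] := gpr_supp y.
rewrite (gpr_sumE xs) (gpr_sumE yt) (bilin_suml _ _ _ _ (lbr_bilin L)).
apply: lcs_sum => p _; rewrite (bilin_sumr _ _ _ _ (lbr_bilin L)).
apply: lcs_sum => q _; rewrite lbr_anti -scaleNr; apply/lcsZ/lcs_brr.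
exact: lcs_gpr.
Qed.

Lemma cd_sum (X : Type) (s : seq X) (P : pred X) (G : X -> L) :
  cd (\sum_(x <- s | P x) G x) = \sum_(x <- s | P x) cd (G x) :> L.
Proof.
have cd0 : cd (0 : L) = 0 by exact: lin0 (@cd_linear F L).
exact: (big_morph _ (fun x y => linD x y (@cd_linear F L)) cd0).
Qed.

Lemma lcs_cd n x : x \in lcsp n -> cd x \in lcsp n.
Proof.
elim: n x => [//|[//|n] IH] x /lcsSP[s [sP ->]].
rewrite cd_sum; apply: lcs_sum => -[a b] /sP /= bn; have [t at_] := gpr_supp a.
rewrite (gpr_sumE at_) (bilin_suml _ _ _ _ (lbr_bilin L)).
rewrite cd_sum; apply: lcs_sum => q _; rewrite lbr_leibniz; apply: lcsD; first exact: lcsS_br.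
by apply/lcsZ/lcsS_br; exact: IH.
Qed.

Lemma lqbr_pi n x y : lqbr (mod n x) (mod n y) = mod n (br x y).
Proof.
apply: qpi_eq.
have -> : br (repr (mod n x)) (repr (mod n y)) - br x y =
    br (repr (mod n x) - x) (repr (mod n y)) + br x (repr (mod n y) - y).
  rewrite (bilinDl _ _ _ (lbr_bilin L)) (bilinDr _ _ _ (lbr_bilin L)).
  by rewrite (bilinNl _ _ (lbr_bilin L)) (bilinNr _ _ (lbr_bilin L)) addrA subrK.
by apply: lcsD; [apply: lcs_brl|apply: lcs_brr]; exact: qpi_repr.
Qed.

Lemma lqd_pi n x : lqd (mod n x) = mod n (cd x).
Proof.
apply: qpi_eq; have -> : cd (repr (mod n x)) - cd x = cd (repr (mod n x) - x).
  rewrite (linD _ _ (@cd_linear F L)) -scaleN1r.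
  by rewrite -[- x]scaleN1r (linZ _ _ (@cd_linear F L)).
exact/lcs_cd/qpi_repr.
Qed.

Lemma lproj_pi n x : lproj (mod n.+1 x) = mod n x.
Proof. by apply: qpi_eq; apply: lcs_leS; exact: qpi_repr. Qed.

Lemma lqbr_bilin n : bilin (@lqbr F L n).
Proof.
have modP c x y : c *: mod n x + mod n y = mod n (c *: x + y).
  by rewrite linearP.
split=> x c; elim/quotW: x => x; elim/quotW => y; elim/quotW => z /=.
  by rewrite modP !lqbr_pi modP (lbr_bilin L).1.
by rewrite modP !lqbr_pi modP (bilinDl _ _ _ (lbr_bilin L)) (bilinZl _ _ _ (lbr_bilin L)).
Qed.

Hypothesis L_complete : complete L.

Lemma complete_sep (x : L) : (forall n, x \in lcsp n) -> x = 0.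
Proof.
move=> xn; have [s xs] := gpr_supp x; rewrite (gpr_sumE xs) big1 // => q _.
have [sep _] := L_complete q; apply: sep; first by rewrite gprK eqxx.
by move=> n; apply: lcs_gpr.
Qed.

Lemma complete_eq (x y : L) : (forall n, mod n x = mod n y) -> x = y.
Proof.
move=> xy; apply/eqP; rewrite -subr_eq0; apply/eqP; apply: complete_sep => n.
by rewrite -mod0P linearB /= xy subrr.
Qed.

(** Completeness is a statement in each degree, so it provides limits for sequences that stay within
    finitely many degrees. *)
Lemma complete_lim (y : nat -> L) (s : seq int) :
  (forall n, mod n (y n.+1) = mod n (y n)) ->
  (forall n q, q \notin s -> gpr q (y n) = 0) ->
  exists x, forall n, mod n x = mod n (y n).
Proof.
move=> yS ys.
have lim q : exists x : L, forall n, mod n x = mod n (gpr q (y n)).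
  have [_ /(_ (fun n => mod n (gpr q (y n))))] := L_complete q.
  case=> [n|n|x _ xP]; last by exists x.
    by rewrite lproj_pi -!qgpr_pi yS.
  by rewrite -[LHS]/(qgpr _ _) qgpr_pi gprK eqxx.
exists (\sum_(q <- undup s) projT1 (cid (lim q))) => n.
rewrite (gpr_sumE (ys n)) !linear_sum; apply: eq_bigr => q _.
by case: cid => x /= ->.
Qed.

End LowerCentral.

(** * Evaluation of Lie series modulo the lower central series *)

Section Evaluation.
Variables (F : fieldType) (L : dgl F) (T : finType) (u : T -> int) (t : T -> L).
Hypothesis char0 : [pchar F] =i pred0.
Hypothesis t_hom : forall i, gpr (u i) (t i) = t i.
Implicit Types (I J K : seq T).
Local Notation wfun := (seq T -> F^o).
Implicit Types (f g c : wfun).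
Local Notation br := (@lbr F L).
Local Notation tb := (nest br t).
Local Notation mod n := (qpi (lcs L n)).
Local Notation lcsp n := (@lcs_pred F L n).
Local Notation brb := (lbr_bilin L).

Lemma nest_hom I : gpr (wdeg u I) (tb I) = tb I.
Proof.
elim: I => [|i I IH]; first exact: linear0.
have [->|I0] := eqVneq I [::]; first by rewrite wdeg1.
rewrite nest_cons // wdeg_cons.
by have := lbr_degree (u i) (wdeg u I) (t i) (tb I); rewrite t_hom IH.
Qed.

Lemma nest_jac i I z : I != [::] ->
  br (br (t i) (tb I)) z = br (t i) (br (tb I) z)
    - (-1) ^ (u i * wdeg u I) *: br (tb I) (br (t i) z).
Proof.
by move=> _; rewrite -(t_hom i) -(nest_hom I) (lbr_jacobi (u i) (wdeg u I)) addrK.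
Qed.

Lemma nest_anti i I : I != [::] ->
  br (tb I) (t i) = - ((-1) ^ (u i * wdeg u I) *: br (t i) (tb I)).
Proof. by move=> _; rewrite mulrC; apply: lbr_hom; rewrite ?nest_hom ?t_hom. Qed.

Lemma adw_lcs I b z : z \in lcsp b.+1 -> adw br t I z \in lcsp (size I + b.+1).
Proof.
by move=> zb; elim: I => //= i I IH; rewrite addSn addnS; apply: lcsS_br; rewrite -addnS.
Qed.

Lemma nest_lcs I : tb I \in lcsp (size I).
Proof.
elim: I => // i I IH; have [->//|I0] := eqVneq I [::].
rewrite nest_cons //; case: I I0 IH => // j I _; exact: lcsS_br.
Qed.

Lemma evalk_lcs k c : evalk br t k c \in lcsp k.
Proof. by apply: lcs_sum => I /words_size <-; apply/lcsZ; exact: nest_lcs. Qed.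

Lemma evalk0 c : evalk br t 0 c = 0.
Proof. by rewrite /evalk big_words0 scaler0. Qed.

(** Expanded into products of a adjoint maps, the bracket raises the filtration by one for each
    letter. *)
Lemma br_evalk_lcs a b f z : liew u f -> z \in lcsp b.+1 ->
  br (evalk br t a (dynk f)) z \in lcsp (a + b.+1).
Proof.
move=> fl zb; rewrite -(adw_lie brb nest_jac) //.
by apply: lcs_sum => I /words_size <-; apply/lcsZ; exact: adw_lcs.
Qed.

(* If f is a Lie series, this is its image, up to brackets of length > N, under
   the morphism with values t on the generators. *)
Definition evalN (N : nat) f : L := \sum_(k < N.+1) evalk br t k (dynk f).

Lemma evalN_eq N f g : (forall J, (size J <= N)%N -> f J = g J) ->
  evalN N f = evalN N g.
Proof.
move=> fg; apply: eq_bigr => k _; apply: eq_big_words => I Ik.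
by rewrite /dynk fg // Ik -ltnS.
Qed.

Lemma evalN_linear N : linear (evalN N).
Proof.
move=> c f g; rewrite /evalN scaler_sumr -big_split; apply: eq_bigr => k _.
rewrite /evalk scaler_sumr -big_split; apply: eq_bigr => I _.
by rewrite /= scalerA -scalerDl /dynk; congr (_ *: _); rewrite wfunD wfunZ; ring.
Qed.

Lemma evalN_sum N (X : Type) (s : seq X) (P : pred X) (G : X -> wfun) :
  evalN N (\sum_(x <- s | P x) G x) = \sum_(x <- s | P x) evalN N (G x).
Proof.
have e0 : evalN N 0 = 0 by exact: lin0 (@evalN_linear N).
exact: (big_morph _ (fun x y => linD x y (@evalN_linear N)) e0).
Qed.

Lemma evalN_rep N c f : rep u c f -> evalN N f = \sum_(k < N.+1) evalk br t k c.
Proof.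
by move=> cf; apply: eq_bigr => k _; apply: (evalk_dynk char0 brb nest_jac nest_anti).
Qed.

Lemma mod_evalN m N f : (m <= N)%N -> mod m (evalN N f) = mod m (evalN m f).
Proof.
elim: N => [|N IH]; first by rewrite leqn0 => /eqP->.
rewrite leq_eqVlt => /orP[/eqP->//|mN].
rewrite /evalN big_ord_recr linearD /= -/(evalN N f) IH // -[RHS]addr0.
congr (_ + _); apply/mod0P; apply: lcs_le (evalk_lcs _ _); exact: ltnW.
Qed.

Lemma evalN_wb N I : mod N (evalN N (wb F u I)) = mod N (tb I).
Proof.
rewrite (evalN_rep _ (@rep_wb F T u I)).
have E k : evalk br t k (fun J => if J == I then 1 else 0) =
    if size I == k then tb I else 0.
  rewrite /evalk; case: eqP => [<-|/eqP Ik].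
    rewrite -[RHS](@big_words_pred1 T L I (fun H => tb H)).
    by apply: eq_bigr => H _; case: eqP => _; rewrite ?scale1r ?scale0r.
  rewrite big_seq big1 // => J /words_size Jk.
  by case: eqP => [JI|_]; [rewrite -Jk JI eqxx in Ik|rewrite scale0r].
have [IN|IN] := leqP (size I) N.
  rewrite (bigD1 (Ordinal (IN : (size I < N.+1)%N))) //= E eqxx big1 ?addr0 // => k kI.
  by rewrite E; case: eqP => // Ik; case/eqP: kI; apply/val_inj.
rewrite big1 => [|k _]; last by rewrite E; case: eqP => // Ik; have := ltn_ord k; lia.
rewrite linear0; apply/esym/mod0P; apply: lcs_le (nest_lcs I); exact: ltnW.
Qed.

Lemma triangle_sum (U : nmodType) N (G : nat -> nat -> U) :
  \sum_(k < N.+1) \sum_(a < k.+1) G a (k - a)%N =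
  \sum_(a < N.+1) \sum_(b < (N - a).+1) G a b.
Proof.
elim: N G => [|N IH] G.
  by rewrite !big_ord1.
rewrite big_ord_recr IH [RHS]big_ord_recr /= subnn big_ord1.
rewrite [X in _ + X]big_ord_recr /= subnn addrA; congr (_ + _).
rewrite -big_split; apply: eq_bigr => a _ /=.
by rewrite subSn ?[RHS]big_ord_recr // -ltnS.
Qed.

(** Length by length this is [evalk_mulw]. The bracket on the right has in addition the terms of
    lengths a and b with a + b > N, which lie in L^N. *)
Lemma evalN_brw N f g : liew u f -> liew u g ->
  mod N (evalN N (brw u f g)) = mod N (br (evalN N f) (evalN N g)).
Proof.
move=> fl gl; rewrite (evalN_rep _ (rep_brw fl gl (dynk_nil g))).
under eq_bigr do rewrite (evalk_mulw brb nest_jac _ fl (dynk_nil g)).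
rewrite (triangle_sum N (fun a b => br (evalk br t a (dynk f)) (evalk br t b (dynk g)))).
rewrite {2}/evalN (bilin_suml _ _ _ _ brb) !linear_sum; apply: eq_bigr => a _.
rewrite -(bilin_sumr _ _ _ _ brb) -/(evalN (N - a) g).
apply/esym/qpi_eqP; rewrite -(bilinNr _ _ brb) -(bilinDr _ _ _ brb).
have aN : (a <= N)%N by rewrite -ltnS.
have : evalN N g - evalN (N - a) g \in lcsp (N - a).+1.
  rewrite /evalN -[in X in X - _](subnKC (leq_subr a N : (N - a <= N)%N)).
  elim: (N - (N - a))%N => [|m IH]; first by rewrite addn0 subrr; exact: lcs0.
  rewrite addnS big_ord_recr /= addrAC; apply: lcsD IH _.
  by apply: lcs_le (evalk_lcs _ _); rewrite ltnS leq_addr.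
move=> /(br_evalk_lcs a fl); apply: lcs_le.
by rewrite addnS subnKC // leqW.
Qed.

Lemma gpr_evalN q N f : gpr q (evalN N f) =
  evalN N (fun I => if wdeg u I == q then f I else 0).
Proof.
rewrite /evalN linear_sum; apply: eq_bigr => k _.
rewrite /evalk linear_sum; apply: eq_bigr => I _.
rewrite linearZ /= -{1}(nest_hom I) gprK nest_hom /dynk eq_sym.
by case: eqP => _; rewrite ?mulr0 ?scale0r ?scaler0.
Qed.

End Evaluation.

(** * Morphisms out of the free Lie algebra: uniqueness and extension *)

Section Morphisms.
Variables (F : fieldType) (A : cdga F) (V : cplx F) (R : retract A V) (r : nat).
Hypothesis char0 : [pchar F] =i pred0.
Variables (e : 'I_r -> V) (n : 'I_r -> int) (es : 'I_r -> dual V).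
Hypothesis e_hom : forall i, gpr (n i) (e i) = e i.
Hypothesis es_e : forall i j, es i (e j) = (i == j)%:R.
Hypothesis e_exp : forall v, v = \sum_i es i v *: e i.
Hypothesis es_gpr : forall i q v, q != n i -> es i (gpr q v) = 0.
Variable L : dgl F.
Local Notation T := ('I_r).
Local Notation u := (udeg n).
Local Notation W := (desus (dualg V)).
Local Notation cf := (cf e).
Local Notation S := (lie_series V).
Local Notation br := (@lbr F L).
Local Notation mod n := (qpi (lcs L n)).
Local Notation lcsp n := (@lcs_pred F L n).
Local Notation evalN := (@evalN F L T).
Implicit Types (I J K : seq T).

Let sbr_lie := sbr_lie char0 es_e e_exp es_gpr.
Let sd_lie := sd_lie R char0 e_hom es_e e_exp es_gpr.
Let lie_seriesP := lie_seriesP char0 es_e e_exp es_gpr.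
Let cf_sbr := cf_sbr es_e e_exp es_gpr.

Definition lbrs (f g : S) : S := insubd 0 (sbr f g).

Lemma lie_valE (f : S) : liew u (cf f) /\ fdeg n (cf f).
Proof. exact/lie_seriesP/lie_valP. Qed.

Lemma cf_lbrs (f g : S) : cf (lbrs f g) = brw u (cf f) (cf g).
Proof.
rewrite /lbrs (@insubdK _ _ (lie_series V)) ?sbr_lie //.
by rewrite cf_sbr //; [have [] := lie_valE f|have [] := lie_valE g].
Qed.

Lemma cf_insubd_sd (f : S) :
  cf (insubd (0 : S) (sd R f)) = sdw u (gen_diff R e es) (cf f).
Proof. by rewrite (@insubdK _ _ (lie_series V)) ?sd_lie // (cf_sd R e_hom es_e e_exp es_gpr). Qed.

Lemma cf_lie_inj (f g : S) : cf f = cf g -> f = g.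
Proof. by move=> /(cf_inj e_exp) /val_inj. Qed.

Lemma lie_series_of (g : seq T -> F^o) : liew u g -> fdeg n g ->
  exists f : S, cf f = g.
Proof.
move=> gl gd; have gP : mkser es g \in @lie_series_pred F V.
  by apply/lie_seriesP; rewrite (cf_mkser es_e).
by exists (LieSeries gP); exact: (cf_mkser es_e).
Qed.

Lemma cf_val_linear : linear (fun f : S => cf f).
Proof. by move=> c f g; exact: (cf_linear e c (val f) (val g)). Qed.

Lemma cf_val_sum (X : Type) (s : seq X) (P : pred X) (G : X -> S) :
  cf (\sum_(x <- s | P x) G x : S) = \sum_(x <- s | P x) cf (G x).
Proof.
have c0 : cf (0 : S) = 0 by exact: (lin0 cf_val_linear).
exact: (big_morph _ (fun x y => linD x y cf_val_linear) c0).
Qed.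

Lemma cf_lgen i : cf (lgen (es i)) = genw F i.
Proof. exact: (cf_sgen_es es_e). Qed.

Section Restriction.
Variable phi : S -> L.
Hypothesis phi_lin : linear phi.
Hypothesis phi_br : forall f g, phi (lbrs f g) = br (phi f) (phi g).
Local Notation t := (fun i => phi (lgen (es i))).

Lemma phi_sum (X : Type) (s : seq X) (P : pred X) (G : X -> S) :
  phi (\sum_(x <- s | P x) G x) = \sum_(x <- s | P x) phi (G x).
Proof.
have p0 : phi 0 = 0 by exact: (lin0 phi_lin).
exact: (big_morph _ (fun x y => linD x y phi_lin) p0).
Qed.

(* W being finite-dimensional, a Lie series without terms of length <= m is a
   finite sum of brackets of generators with series without terms of length
   < m: this makes phi continuous. *)
Lemma phi_small m (f : S) :
  (forall J, (size J < m)%N -> cf f J = 0) -> phi f \in lcsp m.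
Proof.
elim: m f => [//|[//|m] IH] f f0.
have [fl [s fs]] := lie_valE f.
(* f will be the sum over i of the bracket of the generator i with [h i], whose coefficients are
   those of f on nested brackets beginning with i. Excluding the empty word loses nothing, as f has
   no term of length one. *)
pose c i I : F^o := if I == [::] then 0 else dynk (cf f) (i :: I).
pose g i : seq T -> F^o := fun J => (\sum_(I <- words T (size J)) (c i I : F) * wb F u I J : F).
have gc i : rep u (c i) (g i) by [].
have gl i : liew u (g i) by apply: rep_lie (gc i).
have gd i : fdeg n (g i).
  exists [seq q - u i | q <- s] => J Js; rewrite /g big1 // => I _.
  have [d|/wb_hom->] := eqVneq (wdeg u J) (wdeg u I); last by rewrite mulr0.
  rewrite /c; case: eqP => _; first by rewrite mul0r.
  rewrite /dynk fs ?mulr0 ?mul0r // wdeg_cons; apply: contra Js => Is.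
  by apply/mapP; exists (u i + wdeg u I) => //; rewrite d addrC addKr.
pose h i : S := projT1 (cid (lie_series_of (gl i) (gd i))).
have hE i : cf (h i) = g i by rewrite /h; case: cid.
have -> : f = \sum_i lbrs (lgen (es i)) (h i).
  apply: cf_lie_inj; rewrite cf_val_sum; apply/funext => J.
  under eq_bigr do rewrite cf_lbrs cf_lgen hE.
  have grep i : rep u (mulw (genw F i) (c i)) (brw u (genw F i) (g i)).
    apply: rep_brw => //; exact: (@liew_wb F T u char0 [:: i]).
  rewrite fct_sumE; under eq_bigr do rewrite grep.
  rewrite exchange_big fl; apply: eq_big_words => I IJ /=.
  rewrite -mulr_suml; congr (_ * _).
  case: I IJ => [|i I] IJ.
    rewrite dynk_nil big1 // => i _.
    by rewrite mulw_nil /genw mul0r.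
  rewrite (bigD1 i) //= mulw_genl eqxx big1 ?addr0 => [|j ji].
    rewrite /c; case: eqP => // ->; rewrite /dynk f0 ?mulr0 //.
  by rewrite mulw_genl eq_sym (negPf ji).
rewrite phi_sum; apply: lcs_sum => i _; rewrite phi_br; apply/lcsS_br/IH => J Jm.
rewrite hE /g big_seq big1 // => I /words_size IJ.
rewrite /c; case: eqP => _; first by rewrite mul0r.
by rewrite /dynk f0 ?mulr0 ?mul0r //= IJ.
Qed.

Definition nested_lie I : S := nest lbrs (fun i => lgen (es i)) I.

Lemma cf_nested_lie I : cf (nested_lie I) = wb F u I.
Proof.
elim: I => [|i I IH]; first exact: (@cf0 F V r e).
have [->|I0] := eqVneq I [::]; first exact: cf_lgen.
by rewrite /nested_lie /wb !nest_cons // cf_lbrs cf_lgen -/(nested_lie I) IH.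
Qed.

Lemma phi_nested_lie I : phi (nested_lie I) = nest br t I.
Proof.
elim: I => [|i I IH]; first exact: (lin0 phi_lin).
have [->//|I0] := eqVneq I [::].
by rewrite /nested_lie !nest_cons // phi_br -/(nested_lie I) IH.
Qed.

(** f differs from its truncation to nested brackets by a series without short terms, which
    [phi_small] sends into L^N. Hence phi is determined by its values on the generators. *)
Lemma phi_evalN N f : mod N (phi f) = mod N (evalN t N (cf f)).
Proof.
have [fl _] := lie_valE f.
pose g : S := \sum_(k < N.+1) \sum_(I <- words T k) (dynk (cf f) I : F) *: nested_lie I.
have -> : evalN t N (cf f) = phi g.
  rewrite phi_sum; apply: eq_bigr => k _; rewrite phi_sum; apply: eq_bigr => I _.
  by rewrite (linZ _ _ phi_lin) phi_nested_lie.
apply/qpi_eqP; rewrite -[- phi g]scaleN1r -(linZ _ _ phi_lin) -(linD _ _ phi_lin).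
rewrite scaleN1r; apply: phi_small => J JN.
have -> : cf (f - g) = cf f - cf g by rewrite -!scaleN1r (linD _ _ cf_val_linear) (linZ _ _ cf_val_linear).
suff gJ : cf g J = cf f J by rewrite wfunD wfunN gJ subrr.
rewrite cf_val_sum fct_sumE.
have JN' : (size J < N.+1)%N by exact: ltnW.
rewrite (bigD1 (Ordinal JN')) //= [X in _ + X]big1 ?addr0 => [|k kJ]; last first.
  rewrite cf_val_sum fct_sumE big_seq big1 // => I /words_size Ik.
  rewrite (linZ _ _ cf_val_linear) wfunZ cf_nested_lie wb_size ?mulr0 // Ik.
  by apply: contraNneq kJ => kJ; exact/eqP/val_inj.
rewrite cf_val_sum fct_sumE fl; apply: eq_bigr => I _.
by rewrite (linZ _ _ cf_val_linear) wfunZ cf_nested_lie.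
Qed.

End Restriction.

Section Extension.
Variable t : T -> L.
Hypothesis t_hom : forall i, gpr (u i) (t i) = t i.
Hypothesis L_complete : complete L.

Local Notation d := (gen_diff R e es).
Let d_nil := @gen_diff_nil F A V R r e es.
Let d_hom := gen_diff_hom R e_hom es_e e_exp es_gpr.
Let d_lie := liew_gen_diff R char0 e_hom es_e e_exp es_gpr.

Lemma evalN_lim (f : S) : exists x : L, forall N, mod N x = mod N (evalN t N (cf f)).
Proof.
have [_ [s fs]] := lie_valE f.
apply: (complete_lim L_complete (s := s)) => [N|N q qs].
  by rewrite mod_evalN.
rewrite (gpr_evalN t_hom) (@evalN_eq _ _ _ t N _ (0 *: 0)); last first.
  move=> J _; rewrite scale0r; case: eqP => // Jq; apply: fs; by rewrite Jq.
by rewrite (linZ _ _ (@evalN_linear F L T t N)) scale0r.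
Qed.

Definition extend (f : S) : L := projT1 (cid (evalN_lim f)).

Lemma extendP f N : mod N (extend f) = mod N (evalN t N (cf f)).
Proof. by rewrite /extend; case: cid => x xP; exact: xP. Qed.

Lemma extend_linear : linear extend.
Proof.
move=> c f g; apply: (complete_eq L_complete) => N.
by rewrite linearP /= !extendP -linearP cf_val_linear evalN_linear.
Qed.

Lemma extend_lgen i : extend (lgen (es i)) = t i.
Proof.
apply: (complete_eq L_complete) => N.
rewrite extendP cf_lgen; exact: (evalN_wb char0 t_hom N [:: i]).
Qed.

Lemma extend_degree q (f : S) : sproj q f = f -> gpr q (extend f) = extend f.
Proof.
move=> fq; apply: (complete_eq L_complete) => N.
rewrite -qgpr_pi extendP qgpr_pi (gpr_evalN t_hom); congr (mod N _).
apply: evalN_eq => J _.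
have -> : cf f J = cf (sproj q f) J by rewrite fq.
by rewrite (cf_sproj es_e e_exp es_gpr) eq_sym; case: eqP.
Qed.

Lemma extend_lbrs f g : extend (lbrs f g) = br (extend f) (extend g).
Proof.
have [fl _] := lie_valE f; have [gl _] := lie_valE g.
apply: (complete_eq L_complete) => N.
rewrite extendP cf_lbrs (evalN_brw char0 t_hom) // -!lqbr_pi.
by rewrite !extendP.
Qed.

Hypothesis t_diff : forall i N, mod N (evalN t N (d i)) = mod N (cd (t i)).

(** Both differentials obey the Leibniz rule for the bracket with a generator, so agreement on
    generators propagates along nested brackets. *)
Lemma evalN_sdw_wb I N :
  mod N (evalN t N (sdw u d (wb F u I))) = mod N (cd (nest br t I)).
Proof.
have cd0 : cd (0 : L) = 0 by exact: lin0 (@cd_linear F L).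
have lwb J := @liew_wb F T u char0 J.
elim: I => [|i I IH].
  rewrite [wb F u [::]]/(0 : seq T -> F^o) sdw0 cd0.
  by rewrite (lin0 (@evalN_linear F L T t N)).
have [->|I0] := eqVneq I [::].
  by rewrite [wb F u _]/(genw F i) sdw_gen // t_diff.
rewrite /wb !nest_cons // -/(wb F u I).
rewrite (sdw_brw d_nil d_hom _ (@wb_hom F T u I)).
rewrite -[X in X + _]scale1r evalN_linear scale1r.
rewrite (linZ _ _ (@evalN_linear F L T t N)) linearD linearZ /=.
rewrite !(evalN_brw char0 t_hom) //; first last.
- exact: (liew_sdw_wb char0 d_nil d_hom d_lie).
- exact: (lwb [:: i]).
rewrite -!lqbr_pi t_diff IH (evalN_wb char0 t_hom) (evalN_wb char0 t_hom N [:: i]).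
rewrite !lqbr_pi -linearZ -linearD /=; congr (mod N _).
by rewrite -{3}(t_hom i) lbr_leibniz t_hom.
Qed.

Lemma extend_diff (f : S) : extend (insubd (0 : S) (sd R f)) = cd (extend f).
Proof.
have [fl _] := lie_valE f.
apply: (complete_eq L_complete) => N.
rewrite extendP cf_insubd_sd -lqd_pi extendP lqd_pi.
rewrite (@evalN_eq _ _ _ t N _ (\sum_(k < N.+1) \sum_(I <- words T k)
    (dynk (cf f) I : F) *: sdw u d (wb F u I))); last first.
  move=> J JN; rewrite (sdw_rep d_nil fl JN) fct_sumE; apply: eq_bigr => k _.
  by rewrite fct_sumE.
rewrite evalN_sum {2}/evalN cd_sum !linear_sum; apply: eq_bigr => k _.
rewrite evalN_sum /evalk cd_sum !linear_sum; apply: eq_bigr => I _.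
rewrite (linZ _ _ (@evalN_linear F L T t N)) (linZ _ _ (@cd_linear F L)).
by rewrite !linearZ /= evalN_sdw_wb.
Qed.

End Extension.

End Morphisms.

(** * The Maurer-Cartan equation *)

Section Inversions.
Import Order.TTheory Num.Theory.

(** Permuting the nodes of a Vandermonde matrix multiplies its determinant by the signature. The two
    products of differences agree in absolute value, and the factors that become negative are those
    at inversions. *)
Lemma prod_inversions k (s : 'S_k) :
  \prod_(i < k) \prod_(j < k | (i < j)%N && (s j < s i)%N) (-1) = (-1) ^+ s :> int.
Proof.
pose a := \row_(j < k) (j%:Z).
pose b := \row_(j < k) ((s j)%:Z).
pose D := \prod_(i < k) \prod_(j < k | (i < j)%N) (j%:Z - i%:Z).
have detb : \prod_(i < k) \prod_(j < k | (i < j)%N) ((s j)%:Z - (s i)%:Z) = (-1) ^+ s * D.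
  have -> : \prod_(i < k) \prod_(j < k | (i < j)%N) ((s j)%:Z - (s i)%:Z) = \det (Vandermonde k b).
    by rewrite det_Vandermonde; apply: eq_bigr => i _; apply: eq_bigr => j _; rewrite !mxE.
  have -> : Vandermonde k b = col_perm s (Vandermonde k a).
    by apply/matrixP => i j; rewrite !mxE.
  rewrite col_permE det_mulmx det_perm odd_permV mulrC det_Vandermonde; congr (_ * _).
  by apply: eq_bigr => i _; apply: eq_bigr => j _; rewrite !mxE.
have D0 : 0 < D.
  by apply: prodr_gt0 => i _; apply: prodr_gt0 => j ij; rewrite subr_gt0.
apply: (mulIf (lt0r_neq0 D0)); rewrite -detb.
have absD : D = \prod_(i < k) \prod_(j < k | (i < j)%N) `|(s j)%:Z - (s i)%:Z|.
  have := congr1 Num.norm detb; rewrite normrM normrX normrN1 expr1n mul1r.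
  rewrite (gtr0_norm D0) => <-; rewrite normr_prod; apply: eq_bigr => i _.
  by rewrite normr_prod.
rewrite absD -big_split; apply: eq_bigr => i _ /=.
rewrite big_mkcondr -big_split; apply: eq_bigr => j ij /=.
case: ltnP => [sji|sij].
  by rewrite ltr0_norm ?subr_lt0 // mulN1r opprK.
by rewrite mul1r ger0_norm // subr_ge0.
Qed.

End Inversions.

(** For odd elements the Koszul sign is itself the signature, and the two cancel. *)
Lemma koszul_odd (F : fieldType) k (s : 'S_k) : koszul F (fun=> -1) s = 1.
Proof.
rewrite /koszul; have -> : (-1 : int) * -1 = 1 by [].
have -> : \prod_(i < k) \prod_(j < k | (i < j)%N && (s j < s i)%N) (-1) ^ 1 =
    (\prod_(i < k) \prod_(j < k | (i < j)%N && (s j < s i)%N) (-1))%:~R :> F.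
  by rewrite rmorph_prod; apply: eq_bigr => i _; rewrite rmorph_prod; apply: eq_bigr.
by rewrite prod_inversions rmorphXn /= rmorphN1 -expr2 sqrr_sign.
Qed.

(** * The bracket of A (x) L/L^n *)

Section TensorOps.
Variables (F : fieldType) (L : dgl F).
Local Notation Q n := (lquot L n).
Local Notation mod n := (qpi (lcs L n)).

Lemma tensg_gpr_pure (B M : gmod F) q i j b m :
  gpr q (tpure (gpr i b) (gpr j m) : tensg B M) =
  if q == i + j then tpure (gpr i b) (gpr j m) else 0.
Proof. exact: tgpr_homog. Qed.

Lemma tensg_hom_ind (B M : gmod F) q (P : tens B M -> Prop) :
  P 0 -> (forall x y, P x -> P y -> P (x + y)) ->
  (forall i j b m, i + j = q -> P (tpure (gpr i b) (gpr j m))) ->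
  forall x : tensg B M, gpr q x = x -> P x.
Proof.
move=> P0 PD Pp x <-; elim/tens_ind: x => [|x y Px Py|i j b m].
- by rewrite linear0.
- by rewrite [gpr q _]linearD /=; exact: PD.
rewrite tensg_gpr_pure; case: eqP => [qij|_] //.
by apply: Pp; rewrite qij.
Qed.

Definition tmap (B C M : lmodType F) (f : B -> C) : tens B M -> tens C M :=
  tlift (fun b m => tpure (f b) m).

Lemma tmap_step (B C M : lmodType F) (f : B -> C) :
  linear f -> bilin (fun (b : B) (m : M) => tpure (f b) m).
Proof.
move=> fl; split=> [b|m] c x y; first by rewrite (tpure_bilin _ _).1.
by rewrite fl; exact: (tpure_bilin _ _).2.
Qed.

Lemma tmap_linear (B C M : lmodType F) (f : B -> C) :
  linear f -> linear (@tmap B C M f).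
Proof. by move=> fl; apply: tlift_linear; exact: tmap_step. Qed.

Lemma tmap_pure (B C M : lmodType F) (f : B -> C) (b : B) (m : M) :
  linear f -> tmap f (tpure b m) = tpure (f b) m.
Proof. by move=> fl; exact: (tlift_pure _ _ (tmap_step M fl)). Qed.

Lemma tmap_gpr (B C M : gmod F) (f : B -> C) k q (x : tensg B M) :
  linear f -> has_degree k f ->
  tmap f (gpr q x) = gpr (q + k) (tmap f x : tensg C M).
Proof.
move=> fl fk; elim/tens_ind: x => [|x y IHx IHy|i j b m].
- have t0 : tmap f (0 : tens B M) = 0.
    exact: lin0 (@tmap_linear B C M f fl).
  by rewrite [gpr q _](linear0 (tgpr q)) t0 linear0.
- rewrite [gpr q _](linearD (tgpr q)) (linD _ _ (@tmap_linear B C M f fl)) IHx IHy.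
  by rewrite (linD _ _ (@tmap_linear B C M f fl)) [RHS](linearD (tgpr (q + k))).
rewrite tensg_gpr_pure [in RHS]tmap_pure // fk tensg_gpr_pure.
rewrite addrAC (inj_eq (addIr k)); case: eqP => _.
  by rewrite tmap_pure // fk.
exact: lin0 (@tmap_linear B C M f fl).
Qed.

Variable A : cdga F.

(** The component of [cbr] at stage n. *)
Definition tbr n (x y : tens A (Q n)) : tens A (Q n) :=
  tlift (fun a (v : Q n) =>
    tlift (fun b (w : Q n) =>
      kos (fun (v : Q n) (b : A) => tpure (amul a b) (lqbr v w)) v b) y) x.

Lemma tbr_form n (a : A) (w : Q n) :
  bilin (fun (v : Q n) (b : A) => tpure (amul a b) (lqbr v w)).
Proof.
split=> [v|b] c x y /=.
  by rewrite (amul_bilin A).1; exact: (tpure_bilin _ _).2.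
by rewrite [lqbr _ _](lqbr_bilin L n).2 (tpure_bilin _ _).1.
Qed.

Lemma tbr_inner n (a : A) (v : Q n) :
  bilin (fun (b : A) (w : Q n) =>
    kos (fun (v : Q n) (b : A) => tpure (amul a b) (lqbr v w)) v b).
Proof.
split=> [b|w] c x y /=; last exact: (kos_bilin (tbr_form a w)).1.
rewrite -kos_lin; [|exact: tbr_form|exact: tbr_form].
congr (kos _ v b); apply/funext => v'; apply/funext => b'.
by rewrite (lqbr_bilin L n).1 (tpure_bilin _ _).1.
Qed.

Lemma tbr_outer n (y : tens A (Q n)) : bilin (fun (a : A) (v : Q n) =>
    tlift (fun b (w : Q n) =>
      kos (fun (v : Q n) (b : A) => tpure (amul a b) (lqbr v w)) v b) y).
Proof.
split=> [a|v] c x x' /=; rewrite /tlift scaler_sumr -big_split;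
  apply: eq_bigr => p _ /=; first exact: (kos_bilin (tbr_form a p.2)).2.
rewrite -kos_lin; [|exact: tbr_form|exact: tbr_form].
congr (kos _ v p.1); apply/funext => v'; apply/funext => b'.
by rewrite [amul _ _](amul_bilin A).2 [LHS](tpure_bilin _ _).2.
Qed.

Lemma tbr_bilin n : bilin (@tbr n).
Proof.
split=> [x|y]; last exact: tlift_linear (tbr_outer y).
move=> c y z; rewrite /tbr {1 3 4}/tlift scaler_sumr -big_split.
by apply: eq_bigr => p _ /=; rewrite (tlift_linear (tbr_inner p.1 p.2)).
Qed.

Lemma tbr_pure n m k a b (y z : Q n) : gpr m y = y -> gpr k b = b ->
  tbr (tpure a y) (tpure b z) = (-1) ^ (m * k) *: tpure (amul a b) (lqbr y z).
Proof.
move=> ym bk; rewrite /tbr (tlift_pure _ _ (tbr_outer _)) (tlift_pure _ _ (tbr_inner _ _)).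
have fb := tbr_form a z.
by rewrite (kos_homog _ _ ym bk) // => x; [exact: (bilin0l x fb)|exact: (bilin0r x fb)].
Qed.

Lemma lqbr_gpr n m k (y z : Q n) :
  gpr (m + k) (lqbr (gpr m y) (gpr k z) : Q n) = lqbr (gpr m y) (gpr k z).
Proof.
elim/quotW: y => y; elim/quotW: z => z.
by rewrite -[gpr m _]/(qgpr m _) -[gpr k _]/(qgpr k _) !qgpr_pi lqbr_pi
  -[gpr _ _]/(qgpr _ _) qgpr_pi lbr_degree.
Qed.

Lemma lqbr_anti n m k (y z : Q n) :
  lqbr (gpr m y) (gpr k z) = - ((-1) ^ (m * k) *: lqbr (gpr k z) (gpr m y)).
Proof.
elim/quotW: y => y; elim/quotW: z => z.
rewrite -[gpr m _]/(qgpr m _) -[gpr k _]/(qgpr k _) !qgpr_pi !lqbr_pi.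
by rewrite lbr_anti linearN linearZ.
Qed.

Lemma tbr_degree n p q (x y : tensg A (Q n)) :
  gpr p x = x -> gpr q y = y -> gpr (p + q) (tbr x y : tensg A (Q n)) = tbr x y.
Proof.
move=> xp yq; move: x xp.
apply: tensg_hom_ind => [|x x' IH IH'|i j a v ij].
- by rewrite (bilin0l _ (@tbr_bilin n)) linear0.
- by rewrite (bilinDl _ _ _ (@tbr_bilin n)) (linD _ _ (@gpr_linear F (tensg A (Q n)) (p + q))) IH IH'.
move: y yq; apply: tensg_hom_ind => [|y y' IH IH'|k l b w kl].
- by rewrite (bilin0r _ (@tbr_bilin n)) linear0.
- by rewrite (bilinDr _ _ _ (@tbr_bilin n)) (linD _ _ (@gpr_linear F (tensg A (Q n)) (p + q))) IH IH'.
rewrite (@tbr_pure n j k) ?gprK ?eqxx //.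
rewrite (linZ _ _ (@gpr_linear F (tensg A (Q n)) (p + q))); congr (_ *: _).
have := @tensg_gpr_pure A (Q n) (p + q) (i + k) (j + l)
  (amul (gpr i a) (gpr k b)) (lqbr (gpr j v) (gpr l w)).
by rewrite amul_degree lqbr_gpr -ij -kl addrACA eqxx.
Qed.

(** The bracket of a graded Lie algebra is symmetric on odd elements; here this combines
    commutativity of A with antisymmetry in L. *)
Lemma tbr_sym n (x y : tensg A (Q n)) :
  gpr (-1) x = x -> gpr (-1) y = y -> tbr x y = tbr y x.
Proof.
move=> xp yq; move: x xp.
apply: tensg_hom_ind => [|x x' IH IH'|i j a v ij].
- by rewrite (bilin0l _ (@tbr_bilin n)) (bilin0r _ (@tbr_bilin n)).
- by rewrite (bilinDl _ _ _ (@tbr_bilin n)) (bilinDr _ _ _ (@tbr_bilin n)) IH IH'.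
move: y yq; apply: tensg_hom_ind => [|y y' IH IH'|k l b w kl].
- by rewrite (bilin0l _ (@tbr_bilin n)) (bilin0r _ (@tbr_bilin n)).
- by rewrite (bilinDl _ _ _ (@tbr_bilin n)) (bilinDr _ _ _ (@tbr_bilin n)) IH IH'.
rewrite (@tbr_pure n j k) ?gprK ?eqxx // (@tbr_pure n l i) ?gprK ?eqxx //.
rewrite amul_com lqbr_anti (bilinZl _ _ _ (tpure_bilin _ _)).
rewrite (bilinNr _ _ (tpure_bilin _ _)) (bilinZr _ _ _ (tpure_bilin _ _)).
rewrite !scalerN !scalerA -scaleNr; congr (_ *: _).
have -> : j = -1 - i by rewrite -ij addrC addKr.
have -> : l = -1 - k by rewrite -kl addrC addKr.
rewrite !signzE !odd_absE /=.
by case: (odd `|i|%N); case: (odd `|k|%N) => /=; ring.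
Qed.

End TensorOps.

(** * Transferred brackets on copies of one element *)

Section CompletedTensor.
Variables (F : fieldType) (L : dgl F) (A : cdga F) (V : cplx F) (R : retract A V).
Local Notation Q n := (lquot L n).
Local Notation mod n := (qpi (lcs L n)).
Local Notation CV := (ctens L V).
Local Notation CA := (ctens L A).

Lemma cmap_linear (B C : gmod F) (f : B -> C) :
  linear f -> linear (@cmap F L B C f).
Proof.
move=> fl c x y; apply: functional_extensionality_dep => m.
exact: (@tmap_linear F B C (Q m) f fl c (x m) (y m)).
Qed.

Lemma cbr_bilin : bilin (@cbr F L A).
Proof.
split=> [x|y] c y' z; apply: functional_extensionality_dep => m.
  exact: (@tbr_bilin F L A m).1.
exact: (@tbr_bilin F L A m).2.
Qed.

Lemma cpar_linear (B : gmod F) : linear (@cpar F L B).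
Proof.
move=> c x y; apply: functional_extensionality_dep => m.
exact: par_linear.
Qed.

Local Notation ltop := (tree_op (cmap (ri R)) (@cbr F L A) (cmap (rK R))
  (@cpar F L V) (fun n m => n * m.-1)%N).

Lemma mlin_ltop T : mlin (leaves T) (ltop T).
Proof.
apply: mlin_tree_op.
- exact: cmap_linear (ri_linear R).
- exact: cbr_bilin.
- exact: cmap_linear (rK_linear R).
- exact: cpar_linear.
Qed.

Variable x : CV.
Hypothesis x_deg : cproj (-1) x = x.

Lemma cpar_deg : @cpar F L V x = - x.
Proof.
apply: functional_extensionality_dep => m.
have xm : gpr (-1) (x m : tensg V (Q m)) = x m.
  by have := congr1 (fun y : CV => y m) x_deg.
by rewrite /cpar (par_homog xm) exprN1 invrN1 scaleN1r.
Qed.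

(* On copies of an element of degree -1, the signs of [tree_op] cancel those
   of [cpar]. *)
Fixpoint tree_val (T : btree) : CA :=
  match T with
  | Leaf => cmap (ri R) x
  | Node l r => cbr (tree_edge (cmap (rK R)) l (tree_val l))
                    (tree_edge (cmap (rK R)) r (tree_val r))
  end.

(** At a vertex with n and m leaves the sign operators contribute (-1)^{(m-1)n}, which is also the
    sign attached to the vertex. *)
Lemma ltop_nseq T : ltop T (nseq (leaves T) x) = tree_val T.
Proof.
elim: T => [//|l IHl r IHr].
rewrite tree_opN [leaves (Node l r)]/= nseqD take_size_cat ?size_nseq //.
rewrite drop_size_cat ?size_nseq // IHr.
have -> : map (iter (leaves r).-1 (@cpar F L V)) (nseq (leaves l) x) =
    [seq ((-1) ^+ (leaves r).-1 : F) *: id y | y <- nseq (leaves l) x].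
  rewrite !map_nseq; congr (nseq _ _); elim: (leaves r).-1 => [|k IH].
    by rewrite scale1r.
  by rewrite iterS IH (linZ _ _ (@cpar_linear V)) cpar_deg exprS mulN1r scaleNr scalerN.
rewrite (@mlin_scale _ _ _ _ _ _ (fun=> (-1) ^+ (leaves r).-1) id _ (mlin_ltop l)) ?size_nseq //.
rewrite map_id IHl big_nseq iter_mulr_1.
rewrite (linZ _ _ (tree_edge_linear (cmap_linear (rK_linear R)) l)).
rewrite (bilinZl _ _ _ cbr_bilin) scalerA -exprM -exprD mulnC addnn.
by rewrite -signr_odd odd_double scale1r.
Qed.

Lemma tree_edge_deg T m :
  gpr (-1) (tree_edge (cmap (rK R)) T (tree_val T) m : tensg A (Q m)) =
  tree_edge (cmap (rK R)) T (tree_val T) m.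
Proof.
elim: T => [|l IHl r IHr].
  have xm : gpr (-1) (x m : tensg V (Q m)) = x m.
    by have := congr1 (fun y : CV => y m) x_deg.
  have := tmap_gpr (-1) (x m : tensg V (Q m)) (ri_linear R) (ri_degree R).
  by rewrite xm addr0 => /esym.
have := tmap_gpr (-1 + -1) (tree_val (Node l r) m : tensg A (Q m))
  (rK_linear R) (rK_degree R).
by rewrite [gpr _ (tree_val _ _)](tbr_degree IHl IHr) => /esym.
Qed.

Lemma cbr_edge_sym l r :
  cbr (tree_edge (cmap (rK R)) l (tree_val l)) (tree_edge (cmap (rK R)) r (tree_val r)) =
  cbr (tree_edge (cmap (rK R)) r (tree_val r)) (tree_edge (cmap (rK R)) l (tree_val l)).
Proof.
apply: functional_extensionality_dep => m.
exact: (tbr_sym (tree_edge_deg l m) (tree_edge_deg r m)).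
Qed.

Lemma tree_val_iso S T : (0 < num_iso S T)%N -> tree_val S = tree_val T.
Proof.
(* The label of the edge depends on the shape of the tree, so its value is carried along in the
   induction. Exchanging branches is harmless because both carry elements of degree -1. *)
suff: (0 < num_iso S T)%N -> tree_val S = tree_val T /\
    tree_edge (cmap (rK R)) S (tree_val S) = tree_edge (cmap (rK R)) T (tree_val T).
  by move=> H /H[].
elim: S T => [|a IHa b IHb] [|c d] //=.
by rewrite addn_gt0 !muln_gt0 => /orP[] /andP[/IHa[_ ->] /IHb[_ ->]]; rewrite // cbr_edge_sym.
Qed.

Hypothesis char0 : [pchar F] =i pred0.

(** The k! permutations contribute equally and cancel 1/k!; [big_nptrees] turns the weights 1/|Aut
    T| into 2^{1-k}. *)
Lemma linf_odd k : (1 < k)%N ->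
  (k`!)%:R^-1 *: linf R (k := k) (fun=> -1) (fun=> x) =
  (2 ^ k.-1)%:R^-1 *: cmap (rp R) (\sum_(T <- ptrees k) tree_val T).
Proof.
case: k => [|[|k]] // _; rewrite /linf.
have kf : (k.+2`!)%:R != 0 :> F by rewrite natr_neq0 // -lt0n fact_gt0.
have rp0 : cmap (rp R) (0 : CA) = 0.
  exact: (lin0 (cmap_linear (rp_linear R))).
rewrite (big_morph _ (fun x y => linD x y (cmap_linear (rp_linear R))) rp0).
rewrite -(big_nptrees k.+2 char0); last by move=> S T ST; rewrite (tree_val_iso ST).
rewrite scaler_sumr big_seq [RHS]big_seq; apply: eq_bigr => T /tree_reps_sub /ptrees_leaves Tk.
under eq_bigr do rewrite koszul_odd scale1r.
rewrite sumr_const card_Sn -scaler_nat scalerA mulrC -scalerA.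
have -> : [seq x | i <- enum 'I_k.+2] = nseq (leaves T) x.
  by rewrite Tk -[in RHS](size_enum_ord k.+2); elim: (enum _) => //= i s ->.
by rewrite /ltree ltop_nseq [in X in _ *: X]scalerA mulVf // scale1r.
Qed.

End CompletedTensor.

Lemma dprod_sum (F : fieldType) (M : nat -> lmodType F) (X : Type) (s : seq X)
    (P : pred X) (G : X -> dprod M) m :
  (\sum_(x <- s | P x) G x) m = \sum_(x <- s | P x) G x m.
Proof. exact: (big_morph (fun f : dprod M => f m)). Qed.

(** * The transferred brackets as sums over words *)

Section TreeValues.
Variables (F : fieldType) (A : cdga F) (V : cplx F) (R : retract A V) (r : nat).
Hypothesis char0 : [pchar F] =i pred0.
Variables (e : 'I_r -> V) (n : 'I_r -> int).
Hypothesis e_hom : forall i, gpr (n i) (e i) = e i.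
Variable L : dgl F.
Local Notation T := ('I_r).
Local Notation u := (udeg n).
Local Notation Q m := (lquot L m).
Local Notation mod m := (qpi (lcs L m)).
Local Notation CV := (ctens L V).
Local Notation CA := (ctens L A).
Local Notation br := (@lbr F L).
Implicit Types (I J K : seq T).
Variable t : T -> L.
Hypothesis t_hom : forall i, gpr (u i) (t i) = t i.

(* The minus sign is that of [gen_restr]. *)
Definition gen_elt : CV := fun m => - \sum_i tpure (e i) (mod m (t i)).

Lemma gen_elt_deg : cproj (-1) gen_elt = gen_elt.
Proof.
apply: functional_extensionality_dep => m.
have gl := @gpr_linear F (tensg V (Q m)) (-1).
have g0 : gpr (-1) (0 : tensg V (Q m)) = 0 by exact: linear0.
rewrite -[LHS]/(gpr (-1) (gen_elt m : tensg V (Q m))) /gen_elt -scaleN1r.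
rewrite (linZ _ _ gl) (big_morph _ (fun x y => linD x y gl) g0); congr (_ *: _).
apply: eq_bigr => i _.
rewrite -(e_hom i) -(t_hom i) -qgpr_pi.
have := @tensg_gpr_pure F V (Q m) (-1) (n i) (u i) (e i) (mod m (t i)).
by rewrite (_ : n i + u i = -1) ?eqxx // /udeg; ring.
Qed.

Lemma gen_elt_coherent : coherent gen_elt.
Proof.
move=> m.
have lp : linear (@lproj F L m).
  move=> c; elim/quotW => x; elim/quotW => y.
  have -> : c *: mod m.+1 x + mod m.+1 y = mod m.+1 (c *: x + y) by rewrite linearP.
  by rewrite !lproj_pi linearP.
have fb : bilin (fun (b : V) (y : Q m.+1) => tpure b (lproj y)).
  split=> [b|y] c x x'; first by rewrite lp (tpure_bilin _ _).1.
  exact: (tpure_bilin _ _).2.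
rewrite /gen_elt; set f := tlift _.
have fl : linear f := tlift_linear fb.
have f0 : f 0 = 0 by exact: (lin0 fl).
rewrite -scaleN1r (linZ _ _ fl) scaleN1r; congr (- _).
rewrite (big_morph f (fun x y => linD x y fl) f0); apply: eq_bigr => i _.
by rewrite /f (tlift_pure _ _ fb) lproj_pi.
Qed.

Definition tau m (a : A) (y : L) : tens A (Q m) := tpure a (mod m y).

Lemma tau_bilin m : bilin (tau m).
Proof.
split=> [a|y] c x x'; rewrite /tau; last exact: (tpure_bilin _ _).2.
by rewrite linearP (tpure_bilin _ _).1.
Qed.

Local Notation tv := (tree_val R gen_elt).

Definition cedge (k : nat) (y : CA) : CA := if k == 1%N then y else cmap (rK R) y.

Lemma cedge_linear k : linear (cedge k).
Proof. by rewrite /cedge; case: eqP => // _; exact: cmap_linear (rK_linear R). Qed.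

Lemma tree_edge_cedge S y : tree_edge (cmap (rK R)) S y = cedge (leaves S) y.
Proof.
case: S => [|a b] //=; rewrite /cedge.
have := leaves_gt0 a; have := leaves_gt0 b.
by case: eqP => // ? ? ?; lia.
Qed.

(** The element X_k; the power of 2 is the one for which [tree_mean_rec] has the constant factor
    1/2. *)
Definition tree_mean k : CA := (2 ^ k.-1)%:R^-1 *: \sum_(S <- ptrees k) tv S.

Lemma tree_mean_rec k : (1 < k)%N -> tree_mean k =
  2%:R^-1 *: \sum_(1 <= j < k) cbr (cedge j (tree_mean j)) (cedge (k - j) (tree_mean (k - j))).
Proof.
move=> k1; rewrite /tree_mean big_ptrees // !scaler_sumr !big_seq.
apply: eq_bigr => j; rewrite mem_index_iota => jk.
have cl m := cedge_linear m.
have csum m (s : seq btree) (G : btree -> CA) :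
    cedge m (\sum_(S <- s) G S) = \sum_(S <- s) cedge m (G S).
  apply: (big_morph (cedge m)) => [x y|]; first exact: linD.
  exact: lin0 (cl m).
rewrite !(linZ _ _ (cl _)) (bilinZl _ _ _ (@cbr_bilin F L A)).
rewrite (bilinZr _ _ _ (@cbr_bilin F L A)) !scalerA.
have -> : (2 ^ k.-1)%:R^-1 = 2%:R^-1 * (2 ^ j.-1)%:R^-1 * (2 ^ (k - j).-1)%:R^-1 :> F.
  by rewrite -!invfM -!natrM -expnS -expnD; congr (_%:R^-1); congr (_ ^ _)%N; lia.
congr (_ *: _); first by rewrite mulrA.
rewrite !csum (bilin_suml _ _ _ _ (@cbr_bilin F L A)) !big_seq.
apply: eq_bigr => l /ptrees_leaves lj.
rewrite (bilin_sumr _ _ _ _ (@cbr_bilin F L A)) !big_seq.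
apply: eq_bigr => l' /ptrees_leaves lj'.
by rewrite /= !tree_edge_cedge lj lj'.
Qed.

Local Notation wtree := (wtree R e n).
Local Notation wedge := (wedge R e n).
Local Notation wedge' := (wedge' R e n).

(** On the right stands the value in A (x) L of the A-valued Lie series [wtree], with coefficients
    divided by the length as in [dynk]. *)
Definition mean_val k := forall m, tree_mean k m =
  \sum_(I <- words T k) tau m ((size I)%:R^-1 *: wtree I) (nest br t I).

Lemma mean_val_cedge k m : mean_val k ->
  cedge k (tree_mean k) m = \sum_(I <- words T k) tau m (wedge' I) (nest br t I).
Proof.
rewrite /cedge => kv; case: eqP => [k1|/eqP k1].
  rewrite kv; apply: eq_big_words => I Ik; congr (tau m _ _).
  by rewrite /wedge' /wedge /hedge Ik k1 eqxx.
rewrite -[LHS]/(tmap (rK R) (tree_mean k m)) kv.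
have tl : linear (@tmap F A A (Q m) (rK R)) := tmap_linear (rK_linear R).
have t0 : tmap (rK R) (0 : tens A (Q m)) = 0 by exact: (lin0 tl).
rewrite (big_morph _ (fun x y => linD x y tl) t0); apply: eq_big_words => I Ik.
rewrite /tau (tmap_pure _ _ (rK_linear R)) (linZ _ _ (rK_linear R)).
by rewrite /wedge' /wedge /hedge Ik (negPf k1).
Qed.

Lemma wedge'_hom J : gpr (-1 - wdeg u J) (wedge' J) = wedge' J.
Proof.
have [->|J0] := eqVneq J [::].
  by rewrite /wedge' wedge_nil scaler0 linear0.
by rewrite /wedge' linearZ /= wedge_hom.
Qed.

(** Both sides satisfy the same recursion. On the right [wtree] is written with the coefficients
    [ctree_coef]; the Dynkin-Specht-Wever identity in L gives a factor k that cancels 1/k, and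
    [ctree_coefP] splits the words in two. For one letter, the sign -1 of [word_sign] agrees with
    that of [gen_elt]. *)
Lemma tree_meanP k : (0 < k)%N -> mean_val k.
Proof.
have [m] := ubnP k; elim: m k => // m IH k km k0 q.
have [k1|k1] := leqP k 1%N.
  have -> : k = 1%N by lia.
  rewrite /tree_mean expn0 invr1 scale1r big_ptrees1 big_words1.
  have tl : linear (@tmap F V A (Q q) (ri R)) := tmap_linear (ri_linear R).
  have t0 : tmap (ri R) (0 : tens V (Q q)) = 0 by exact: (lin0 tl).
  rewrite -[LHS]/(tmap (ri R) (gen_elt q)) /gen_elt -scaleN1r (linZ _ _ tl) scaleN1r.
  rewrite (big_morph _ (fun x y => linD x y tl) t0) -sumrN; apply: eq_bigr => i _.
  rewrite (tmap_pure _ _ (ri_linear R)) /= invr1 scale1r wtree1 /tau.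
  by rewrite (bilinNl _ _ (tpure_bilin _ _)).
rewrite (@eq_big_words _ _ _ _ _ _ (fun K => k%:R^-1 *:
    \sum_(H <- words T k) (wb F u H K : F) *: tau q (ctree_coef R e n H) (nest br t K))); last first.
  move=> K Kk; rewrite Kk (bilinZl _ _ _ (tau_bilin q)); congr (_ *: _).
  rewrite (ctree_coef_wtree char0 e_hom) ?Kk //; last by move=> H _; exact: lie_treeP.
  rewrite (bilin_suml _ _ _ _ (tau_bilin q)); apply: eq_bigr => H _.
  by rewrite (bilinZl _ _ _ (tau_bilin q)).
rewrite -scaler_sumr exchange_big /=.
rewrite (@eq_big_words _ _ _ _ _ _ (fun H => k%:R *: tau q (ctree_coef R e n H) (nest br t H))); last first.
  move=> H Hk; rewrite -Hk -(bilinZr _ _ _ (tau_bilin q)).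
  rewrite -(nest_wb (lbr_bilin L) (nest_jac t_hom) (nest_anti t_hom)).
  rewrite (bilin_sumr _ _ _ _ (tau_bilin q)); apply: eq_bigr => K _.
  by rewrite (bilinZr _ _ _ (tau_bilin q)).
rewrite -scaler_sumr scalerA mulVf ?scale1r; last by rewrite natr_neq0 //; lia.
rewrite (ctree_coefP char0 (lbr_bilin L) (tau_bilin q) (nest_jac t_hom)); last first.
  by move=> K _; exact: lie_treeP.
rewrite tree_mean_rec //.
rewrite -[LHS]/(2%:R^-1 *: (\sum_(1 <= j < k) cbr (cedge j (tree_mean j))
   (cedge (k - j) (tree_mean (k - j)))) q).
congr (_ *: _); rewrite dprod_sum.
rewrite -(big_mkord xpredT (fun j => \sum_(I <- words T j) \sum_(J <- words T (k - j))
     split_sign F n I J *: tau q (amul (wedge' I) (wedge' J)) (br (nest br t I) (nest br t J)))).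
have w0 : wedge' [::] = 0 by rewrite /wedge' wedge_nil scaler0.
rewrite [RHS]big_ltn // big_words0 [X in X + _]big1 ?add0r => [|J _]; last first.
  by rewrite w0 (bilin0l _ (amul_bilin A)) (bilin0l _ (tau_bilin q)) scaler0.
rewrite [RHS]big_nat_recr //= subnn [X in _ + X]big1 ?addr0 => [|I _]; last first.
  rewrite big_words0 w0 (bilin0r _ (amul_bilin A)).
  by rewrite (bilin0l _ (tau_bilin q)) scaler0.
rewrite !big_seq; apply: eq_bigr => j; rewrite mem_index_iota => jk.
rewrite -[LHS]/(tbr (cedge j (tree_mean j) q) (cedge (k - j) (tree_mean (k - j)) q)).
rewrite !mean_val_cedge; [|apply: IH; lia|apply: IH; lia].
rewrite (bilin_suml _ _ _ _ (@tbr_bilin F L A q)); apply: eq_big_words => I Ij.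
rewrite (bilin_sumr _ _ _ _ (@tbr_bilin F L A q)); apply: eq_big_words => J Jj.
rewrite /tau (@tbr_pure F L A q (wdeg u I) (-1 - wdeg u J)) ?wedge'_hom //; last first.
  by rewrite -{2}(nest_hom t_hom I); exact: qgpr_pi.
rewrite lqbr_pi /split_sign; congr (_ *: _); apply: signz_eq.
by rewrite !odd_absE /=; case: (odd _); case: (odd _).
Qed.

End TreeValues.

Section Contraction.
Variables (F : fieldType) (V U : gmod F).

(** f is applied to the first tensor factor, without a Koszul sign. *)
Definition contract (f : dual V) : tens V U -> U := tlift (fun v y => (f v : F) *: y).

Lemma contract_step (f : dual V) : bilin (fun (v : V) (y : U) => (f v : F) *: y).
Proof.
split=> [v|y] c a b /=; first by rewrite scalerDr !scalerA mulrC.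
by rewrite linearP scalerDl -scalerA.
Qed.

Lemma contract_linear f : linear (contract f).
Proof. exact: tlift_linear (contract_step f). Qed.

Lemma contract_pure f v y : contract f (tpure v y) = (f v : F) *: y.
Proof. exact: (tlift_pure _ _ (contract_step f)). Qed.

Lemma contract_sum f (X : Type) (s : seq X) (P : pred X) (G : X -> tens V U) :
  contract f (\sum_(x <- s | P x) G x) = \sum_(x <- s | P x) contract f (G x).
Proof.
have c0 : contract f 0 = 0 by exact: lin0 (contract_linear f).
exact: (big_morph _ (fun x y => linD x y (contract_linear f)) c0).
Qed.

Lemma contract_expand (T : finType) (e : T -> V) (es : T -> dual V) (x : tens V U) :
  (forall v, v = \sum_i es i v *: e i) ->
  x = \sum_i tpure (e i) (contract (es i) x).
Proof.
move=> eE; elim/tens_ind: x => [|x y IHx IHy|i j b m].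
- rewrite big1 // => i _; have -> : contract (es i) 0 = 0.
    exact: (lin0 (contract_linear (es i))).
  exact: (bilin0r _ (tpure_bilin _ _)).
- rewrite {1}IHx {1}IHy -big_split; apply: eq_bigr => i _ /=.
  by rewrite (linD _ _ (contract_linear _)) (bilinDr _ _ _ (tpure_bilin _ _)).
rewrite {1}(eE (gpr i b)) tpure_suml; apply: eq_bigr => l _.
rewrite contract_pure (bilinZr _ _ _ (tpure_bilin _ _)).
by rewrite -(bilinZl _ _ _ (tpure_bilin _ _)).
Qed.

End Contraction.

(** * Components of the Maurer-Cartan equation *)

Section MaurerCartan.
Variables (F : fieldType) (A : cdga F) (V : cplx F) (R : retract A V) (r : nat).
Hypothesis char0 : [pchar F] =i pred0.
Variables (e : 'I_r -> V) (n : 'I_r -> int) (es : 'I_r -> dual V).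
Hypothesis e_hom : forall i, gpr (n i) (e i) = e i.
Hypothesis es_e : forall i j, es i (e j) = (i == j)%:R.
Hypothesis e_exp : forall v, v = \sum_i es i v *: e i.
Hypothesis es_gpr : forall i q v, q != n i -> es i (gpr q v) = 0.
Variable L : dgl F.
Local Notation T := ('I_r).
Local Notation u := (udeg n).
Local Notation Q m := (lquot L m).
Local Notation mod m := (qpi (lcs L m)).
Local Notation CV := (ctens L V).
Local Notation br := (@lbr F L).
Local Notation d := (gen_diff R e es).
Implicit Types (I J K : seq T).
Variable t : T -> L.
Hypothesis t_hom : forall i, gpr (u i) (t i) = t i.
Local Notation x := (gen_elt e t).
Local Notation wtree := (wtree R e n).

Lemma es_par i v : es i (par v) = (-1) ^ n i * (es i v : F) :> F.
Proof.
apply: ev_par; first exact: dual_linear.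
move=> q w; case: eqP => [->|/eqP qn]; last exact: es_gpr.
by have := congr1 (fun f : dual V => f w) (es_homV es_gpr i); rewrite /= opprK.
Qed.

Lemma contract_gen_elt m i : contract (es i) (x m : tens V (Q m)) = - mod m (t i).
Proof.
rewrite /gen_elt -scaleN1r (linZ _ _ (contract_linear _)) scaleN1r contract_sum; congr (- _).
rewrite (bigD1 i) //= contract_pure es_e eqxx scale1r big1 ?addr0 // => j ji.
by rewrite contract_pure es_e eq_sym (negPf ji) scale0r.
Qed.

Lemma lqd_linear m : linear (@lqd F L m).
Proof.
move=> c; elim/quotW => y; elim/quotW => z.
have -> : c *: mod m y + mod m z = mod m (c *: y + z) by rewrite linearP.
by rewrite !lqd_pi (@cd_linear F L) linearP.
Qed.

(** The differential of V supplies the part of d e_i^# of length one, and that of L supplies d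
    t_i. *)
Lemma contract_cdiff m i :
  contract (es i) (cdiff x m : tens V (Q m)) =
  (-1) ^ n i *: (mod m (evalk br t 1 (dynk (d i))) - mod m (cd (t i))).
Proof.
have stepb : bilin (fun (b : V) (y : Q m) => tpure (cd b) y + tpure (par b) (lqd y)).
  split=> [b|y] c a b' /=.
    by rewrite lqd_linear !(tpure_bilin _ _).1 scalerDr addrACA.
  rewrite (@cd_linear F V) (@par_linear F V).
  by rewrite !(bilinDl _ _ _ (tpure_bilin _ _)) !(bilinZl _ _ _ (tpure_bilin _ _))
    scalerDr addrACA.
have stepl := tlift_linear stepb.
rewrite /cdiff /gen_elt (linN _ stepl) (linN _ (contract_linear _)).
rewrite (lin_sum _ _ _ stepl) contract_sum.
transitivity (- (\sum_j (es i (cd (e j)) : F) *: mod m (t j) + (-1) ^ n i *: mod m (cd (t i)))).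
  congr (- _); rewrite [X in _ = _ + X](_ : _ =
      \sum_j ((-1) ^ n i * (es i (e j) : F)) *: mod m (cd (t j))); last first.
    rewrite (bigD1 i) //= es_e eqxx mulr1 big1 ?addr0 // => j ji.
    by rewrite es_e eq_sym (negPf ji) mulr0 scale0r.
  rewrite -big_split; apply: eq_bigr => j _ /=.
  rewrite (tlift_pure _ _ stepb) (linD _ _ (contract_linear _)) !contract_pure.
  by rewrite lqd_pi es_par.
rewrite scalerBr opprD; congr (_ - _).
rewrite /evalk big_words1 [in RHS]linear_sum scaler_sumr -sumrN; apply: eq_bigr => j _.
rewrite [in RHS]linearZ /= scalerA -scaleNr; congr (_ *: _).
by rewrite /dynk /= invr1 mul1r (gen_diff1 R e_hom es_e e_exp es_gpr) mulrN mulrA signzMK mul1r.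
Qed.

Lemma contract_tree_mean m i k : (1 < k)%N ->
  contract (es i) (cmap (rp R) (tree_mean R e t k) m : tens V (Q m)) =
  (-1) ^ n i *: mod m (evalk br t k (dynk (d i))).
Proof.
move=> k1; have tl : linear (@tmap F A V (Q m) (rp R)) := tmap_linear (rp_linear R).
rewrite -[cmap _ _ _]/(tmap (rp R) (tree_mean R e t k m)).
rewrite (tree_meanP R char0 e_hom t_hom (ltnW k1)) (lin_sum _ _ _ tl) contract_sum.
rewrite /evalk linear_sum scaler_sumr; apply: eq_big_words => I Ik.
rewrite /tau (tmap_pure _ _ (rp_linear R)) contract_pure [in RHS]linearZ /= [in RHS]scalerA.
congr (_ *: _); rewrite (linZ _ _ (rp_linear R)) (linZ _ _ (dual_linear (es i))).
rewrite [_ *: _]/(_ * _) /dynk (gen_diffE R e_hom es_e e_exp es_gpr) //; last by rewrite Ik.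
have -> : (-1) ^ (u i - 1) = (-1) ^ n i :> F.
  by apply: signz_eq; rewrite /udeg; lia.
by rewrite mulrCA (mulrA (_ ^ _)) signzMK mul1r.
Qed.

Definition mc_sum (N : nat) : CV :=
  \sum_(1 <= k < N.+1) (k`!)%:R^-1 *: linf R (k := k) (fun=> -1) (fun=> x).

(** The term of order k yields the part of d e_i^# of length k, while d t_i comes from l_1, which is
    present as N > 0. *)
Lemma contract_mc_sum m i N : (0 < N)%N ->
  contract (es i) (mc_sum N m : tens V (Q m)) =
  (-1) ^ n i *: (mod m (evalN t N (d i)) - mod m (cd (t i))).
Proof.
move=> N0.
have -> : mc_sum N m = cdiff x m + (\sum_(2 <= k < N.+1)
    (k`!)%:R^-1 *: linf R (k := k) (fun=> -1) (fun=> x)) m.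
  by rewrite /mc_sum big_ltn // invr1 scale1r.
rewrite (linD _ _ (contract_linear _)) contract_cdiff dprod_sum contract_sum.
rewrite /evalN -(big_mkord xpredT (fun k => evalk br t k (dynk (d i)))).
rewrite big_ltn // big_ltn // evalk0 add0r !scalerBr addrAC; congr (_ - _).
rewrite [in RHS]linearD [in RHS]scalerDr /=; congr (_ + _).
rewrite [in RHS]linear_sum scaler_sumr !big_seq; apply: eq_bigr => k; rewrite mem_index_iota => k2.
rewrite -contract_tree_mean; last by lia.
have k1 : (1 < k)%N by lia.
have := linf_odd R (gen_elt_deg e_hom t_hom) char0 k1.
rewrite -(linZ _ _ (cmap_linear (rp_linear R))) -/(tree_mean R e t k).
by move=> /(congr1 (fun y : CV => contract (es i) (y m : tens V (Q m)))).
Qed.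

Lemma is_mc_gen_elt : is_mc R x <->
  forall i N, mod N (evalN t N (d i)) = mod N (cd (t i)).
Proof.
split=> [[_ _ xmc] i m|H].
  (* N' is large enough for the partial sum to vanish, for the evaluation to be stable modulo L^m,
     and for the linear term to be included. *)
  have [N NP] := xmc m; pose N' := maxn m (maxn N 1).
  have N'0 : (0 < N')%N by rewrite /N'; lia.
  have := contract_mc_sum m i N'0.
  rewrite /mc_sum NP; last by rewrite /N'; lia.
  rewrite (lin0 (contract_linear _)) => /esym /(congr1 (fun y => (-1) ^ n i *: y)).
  rewrite scalerA signzMK scale1r scaler0 mod_evalN; last by rewrite /N'; lia.
  by move/eqP; rewrite subr_eq0 => /eqP.
split; [exact: gen_elt_coherent|exact: gen_elt_deg|].
move=> m; exists (maxn m 1) => N NP; have N0 : (0 < N)%N by lia.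
rewrite -/(mc_sum N) [LHS](contract_expand _ e_exp) big1 // => i _.
rewrite contract_mc_sum // mod_evalN; last by lia.
by rewrite H subrr scaler0; exact: (bilin0r _ (tpure_bilin _ _)).
Qed.

End MaurerCartan.

(** * The bijection *)

Lemma sval_inj (T : Type) (P : T -> Prop) : injective (@sval T P).
Proof. by move=> [x px] [y py]; exact: eq_exist. Qed.

Section Correspondence.
Variables (F : fieldType) (A : cdga F) (V : cplx F) (R : retract A V) (r : nat).
Hypothesis char0 : [pchar F] =i pred0.
Variables (e : 'I_r -> V) (n : 'I_r -> int) (es : 'I_r -> dual V).
Hypothesis e_hom : forall i, gpr (n i) (e i) = e i.
Hypothesis es_e : forall i j, es i (e j) = (i == j)%:R.
Hypothesis e_exp : forall v, v = \sum_i es i v *: e i.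
Hypothesis es_gpr : forall i q v, q != n i -> es i (gpr q v) = 0.
Variable L : cdgl F.
Local Notation T := ('I_r).
Local Notation u := (udeg n).
Local Notation Q m := (lquot L m).
Local Notation mod m := (qpi (lcs L m)).
Local Notation CV := (ctens L V).
Local Notation d := (gen_diff R e es).
Local Notation hom := (hom_cdgl (free_cdgl R) L).

Definition hom_gen (phi : hom) (i : T) : L := sval phi (lgen (es i)).

Lemma hom_linear (phi : hom) : linear (sval phi : lie_series V -> L).
Proof. by have [] := proj2_sig phi. Qed.

Lemma hom_lbrs (phi : hom) (f g : lie_series V) :
  sval phi (lbrs f g) = lbr (sval phi f) (sval phi g) :> L.
Proof. by have [_ _ phi_br _] := proj2_sig phi; exact: phi_br. Qed.

Lemma hom_gen_deg (phi : hom) i : gpr (u i) (hom_gen phi i) = hom_gen phi i.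
Proof.
have [_ phi_deg _ _] := proj2_sig phi; apply: phi_deg.
apply: (cf_inj e_exp); apply/funext => I.
rewrite (cf_sproj es_e e_exp es_gpr) (cf_sgen_es es_e).
by case: eqP => // /eqP; rewrite eq_sym => /(@homw_gen F T u) ->.
Qed.

Lemma hom_evalN (phi : hom) N (f : lie_series V) :
  mod N (sval phi f : L) = mod N (evalN (hom_gen phi) N (cf e f)).
Proof.
exact: (phi_evalN char0 es_e e_exp es_gpr (hom_linear phi) (hom_lbrs phi)).
Qed.

Lemma hom_gen_diff (phi : hom) i N :
  mod N (evalN (hom_gen phi) N (d i)) = mod N (cd (hom_gen phi i)).
Proof.
have [_ _ _ phi_d] := proj2_sig phi.
have dE : cf e (insubd (0 : lie_series V) (sd R (lgen (es i)))) = d i.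
  rewrite (cf_insubd_sd R char0 e_hom es_e e_exp es_gpr) (cf_lgen es_e).
  by rewrite sdw_gen //; exact: cf_sd_gen_nil.
by rewrite -dE -hom_evalN; congr (mod N _); exact: (phi_d (lgen (es i))).
Qed.

Lemma hom_mc (phi : hom) : is_mc R (gen_elt e (hom_gen phi)).
Proof.
apply/(is_mc_gen_elt R char0 e_hom es_e e_exp es_gpr (hom_gen_deg phi)).
exact: hom_gen_diff.
Qed.

Definition hom_to_mc (phi : hom) : mc L R := exist _ _ (hom_mc phi).

(** Contraction recovers the values on generators modulo every L^N, and these determine the morphism
    by [hom_evalN]. *)
Lemma hom_to_mc_inj : injective hom_to_mc.
Proof.
move=> phi psi /(congr1 sval) /= E.
have gE i : hom_gen phi i = hom_gen psi i.
  apply: (complete_eq (cdglP L)) => N.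
  have := congr1 (fun x : CV => contract (es i) (x N : tens V (Q N))) E.
  by rewrite !(contract_gen_elt es_e) => /oppr_inj.
apply: sval_inj; apply/funext => f; apply: (complete_eq (cdglP L)) => N.
rewrite (hom_evalN phi) (hom_evalN psi); congr (mod N _).
by rewrite (_ : hom_gen phi = hom_gen psi) //; apply/funext.
Qed.

Lemma lproj_linear m : linear (@lproj F L m).
Proof.
move=> c; elim/quotW => x; elim/quotW => y.
have -> : c *: mod m.+1 x + mod m.+1 y = mod m.+1 (c *: x + y) by rewrite linearP.
by rewrite !lproj_pi linearP.
Qed.

(** Coherence makes the contractions with e_i^# compatible families, which have limits since L is
    complete; the t_i are the negatives of these limits. *)
Lemma mc_gen_elt (x : CV) : coherent x -> cproj (-1) x = x ->
  exists2 t : T -> L, forall i, gpr (u i) (t i) = t i & x = gen_elt e t.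
Proof.
move=> xc xd.
have lim i : exists2 y : L, gpr (u i) y = y &
    forall m, mod m y = contract (es i) (x m : tens V (Q m)).
  have [_ lim] := cdglP L (u i); apply: lim => m.
    rewrite -(xc m) [in RHS](contract_expand (x m.+1) e_exp).
    have fb : bilin (fun (b : V) (y : Q m.+1) => tpure b (lproj y)).
      split=> [b|y] c a a'.
        by rewrite (lproj_linear c a a'); exact: (tpure_bilin V (Q m)).1.
      exact: (tpure_bilin V (Q m)).2.
    rewrite (lin_sum _ _ _ (tlift_linear fb)) contract_sum (bigD1 i) //=.
    rewrite (tlift_pure _ _ fb) contract_pure es_e eqxx scale1r big1 ?addr0 // => j ji.
    by rewrite (tlift_pure _ _ fb) contract_pure es_e eq_sym (negPf ji) scale0r.
  have xm : gpr (-1) (x m : tensg V (Q m)) = x m.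
    by have := congr1 (fun y : CV => y m) xd.
  pose P (z : tens V (Q m)) := gpr (u i) (contract (es i) z) = contract (es i) z.
  move: xm; apply: (@tensg_hom_ind F V (Q m) (-1) P) => [|y z IHy IHz|p q b y pq].
  - by rewrite /P (lin0 (contract_linear _)) linear0.
  - by rewrite /P (linD _ _ (contract_linear _)) (linD _ _ (@gpr_linear F (Q m) (u i))) IHy IHz.
  rewrite /P contract_pure (linZ _ _ (@gpr_linear F (Q m) (u i))) (@gprK F (Q m)).
  have [pn|pn] := eqVneq p (n i); last by rewrite es_gpr // !scale0r.
  by rewrite (_ : u i = q) ?eqxx // /udeg -pn; lia.
exists (fun i => - s2val (cid2 (lim i))) => [i|].
  by case: cid2 => y yd ym /=; rewrite (linN y (@gpr_linear F L (u i))) yd.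
apply: functional_extensionality_dep => m.
rewrite [LHS](contract_expand _ e_exp) /gen_elt -sumrN; apply: eq_bigr => i _.
case: cid2 => y yd ym /=; rewrite linearN (bilinNr _ _ (tpure_bilin _ _)) opprK.
by rewrite -(ym m).
Qed.

Lemma hom_to_mc_surj (x : mc L R) : exists phi, hom_to_mc phi = x.
Proof.
case: x => x xmc; have [xc xd _] := xmc.
have [t td xE] := mc_gen_elt xc xd.
have td' := (is_mc_gen_elt R char0 e_hom es_e e_exp es_gpr td).1.
rewrite -xE in td'; have t_diff := td' xmc.
pose f := extend char0 es_e e_exp es_gpr td (cdglP L).
have fP : @is_dgl_hom F (free_cdgl R) L f.
  split.
  - exact: extend_linear.
  - by move=> q y; exact: extend_degree.
  - by move=> y z; exact: extend_lbrs.
  - move=> y; exact: (extend_diff char0 e_hom _ _ _ _ _ t_diff).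
exists (exist _ f fP); apply: sval_inj; rewrite /= [RHS]xE.
by congr (gen_elt e _); apply/funext => i; rewrite /hom_gen /=; exact: extend_lgen.
Qed.

Lemma lgen_expand (f : dual V) : lgen f = \sum_i (f (e i) : F) *: lgen (es i).
Proof.
have ll : linear (@lgen F V).
  move=> c g h; apply: val_inj; exact: (sgen_linear e_exp c g h).
by rewrite {1}(evd_exp e_exp f) (lin_sum _ _ _ ll); apply: eq_bigr => i _; rewrite (linZ _ _ ll).
Qed.

Lemma hom_to_mc_restr (phi : hom) :
  exists2 t : tens V L, sval (hom_to_mc phi) = to_ctens t &
    forall f : dualg V, Psi t f = gen_restr phi f.
Proof.
have stepb m : bilin (fun (v : V) (x : L) => tpure v (mod m x)).
  split=> [v|x] c y z; last exact: (tpure_bilin _ _).2.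
  by rewrite linearP (tpure_bilin _ _).1.
exists (- \sum_i tpure (e i) (hom_gen phi i)).
  apply: functional_extensionality_dep => m; rewrite /to_ctens /= /gen_elt.
  rewrite (linN _ (tlift_linear (stepb m))) (lin_sum _ _ _ (tlift_linear (stepb m))).
  by congr (- _); apply: eq_bigr => i _; rewrite (tlift_pure _ _ (stepb m)).
move=> f; have kb : bilin (kos (fun (a : V) (x : L) => (f a : F) *: x)).
  by apply: kos_bilin; exact: contract_step.
rewrite /Psi (linN _ (tlift_linear kb)) (lin_sum _ _ _ (tlift_linear kb)) /gen_restr.
congr (- _); rewrite lgen_expand (lin_sum _ _ _ (hom_linear phi)).
apply: eq_bigr => i _; rewrite (linZ _ _ (hom_linear phi)) (tlift_pure _ _ kb).
rewrite (kos_homog _ _ (e_hom i) (hom_gen_deg phi i)).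
(* The exponent n_i (- n_i - 1) is even, so the sign in [Psi] disappears on elements of total degree
   -1. *)
- rewrite signz_even ?scale1r // /udeg.
  by rewrite !odd_absE /=; case: (odd _).
- by move=> y; rewrite linear0 scale0r.
- by move=> y; rewrite scaler0.
Qed.

End Correspondence.

Theorem theorem0p4 (F : fieldType) (char0 : [pchar F] =i pred0)
    (A : cdga F) (V : cplx F) (R : retract A V) (V_ft : finite_type V)
    (L : cdgl F) :
  exists Theta : hom_cdgl (free_cdgl R) L -> mc L R,
    bijective Theta /\
    forall phi : hom_cdgl (free_cdgl R) L,
      exists2 t : tens V L,
        sval (Theta phi) = to_ctens t &
        forall f : dualg V, Psi t f = gen_restr phi f.
Proof.
have [r [e [n [es [e_hom es_e e_exp es_gpr]]]]] := finite_type_basis V_ft.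
exists (hom_to_mc (R := R) char0 e_hom es_e e_exp es_gpr (L := L)); split; last first.
  exact: hom_to_mc_restr.
have surj := hom_to_mc_surj (R := R) char0 e_hom es_e e_exp es_gpr (L := L).
have [g gK] := choice surj.
by exists g => // phi; exact: (hom_to_mc_inj (gK _)).
Qed.
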